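(* There is a star flow $X$ on the sphere $S^3$ whose chain recurrent set $CR(X)$ is not the disjoint union of a positively sectional-hyperbolic set of $X$ and a negatively sectional-hyperbolic set of $X$.
   Context: Let $M=S^3$ with a Riemannian metric $\langle\cdot,\cdot\rangle$, norm $\|\cdot\|$ and distance $d$. A flow is a $C^1$ vector field $X$ on $M$, with induced flow $X_t$; $-X$ is the reversed flow. Singularities are zeroes of $X$. A periodic point is a point $x$ for which there is a minimal $t>0$ with $X_t(x)=x$; a periodic orbit is the orbit of a periodic point. A set $\Lambda$ is invariant if $X_t(\Lambda)=\Lambda$ for all $t\in\mathbb{R}$. Hyperbolic: a compact invariant set $\Lambda$ is hyperbolic if there are a continuous $DX_t$-invariant splitting $T_\Lambda M=E^s\oplus E^X\oplus E^u$ and $K,\lambda>0$ such that (1) $E^s$ is contracting: $\|DX_t(x)v\|\le Ke^{-\lambda t}\|v\|$ for all $x\in\Lambda$, $v\in E^s_x$, $t\ge0$; (2) $E^X_x$ is the subspace of $T_xM$ generated by $X(x)$; (3) $E^u$ is expanding: $\|DX_t(x)v\|\ge K^{-1}e^{\lambda t}\|v\|$ for all $x\in\Lambda$, $v\in E^u_x$, $t\ge0$. Subbundles may be zero. A singularity or periodic orbit is hyperbolic if it is so as a compact invariant set. Chain recurrence: $x$ is in the chain stable set of $y$ if for every $\epsilon>0$ there are points $x_0,\dots,x_n$ and times $t_0,\dots,t_{n-1}$ (with $n\ge1$) such that $x_0=x$, $x_n=y$, $t_i\ge1$ and $d(X_{t_i}(x_i),x_{i+1})<\epsilon$ for $0\le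 i\le n-1$. Points $x,y$ are chain related if each is in the chain stable set of the other. $x$ is chain recurrent if it is chain related to itself; $CR(X)$ is the set of chain recurrent points. $X$ is star if it has a neighborhood $\mathcal{U}$ in the space of $C^1$ flows (with the $C^1$ topology) such that every periodic orbit and every singularity of every flow in $\mathcal{U}$ is hyperbolic. Dominated splitting: a compact invariant set $\Lambda$ has a dominated splitting with respect to the tangent flow if there are a $DX_t$-invariant splitting into subbundles $T_\Lambda M=E\oplus F$ and $K,\lambda>0$ with $\|DX_t(x)e\|\cdot\|f\|\le Ke^{-\lambda t}\|DX_t(x)f\|\cdot\|e\|$ for all $x\in\Lambda$, $t\ge0$, $(e,f)\in E_x\times F_x$ (either subbundle may be zero). It is a partially hyperbolic splitting if moreover $E$ is contracting. For $u,v\in T_pM$ let $\|u,v\|=\sqrt{\langle u,u\rangle\langle v,v\rangle-\langle u,v\rangle^2}$. $F$ is sectionally expanding if there are $K,\lambda>0$ with $\|DX_t(x)u,DX_t(x)v\|\ge K^{-1}e^{\lambda t}\|u,v\|$ for all $x\in\Lambda$, $u,v\in F_x$, $t\ge0$. A sectional-hyperbolic splitting for $X$ over $\Lambda$ is a partially hyperbolic splitting $T_\Lambda M=E\oplus F$ with $F$ sectionally expanding. A compact invariant set $\Lambda$ is sectional-hyperbolic for $X$ if every singularity of $X$ in $\Lambda$ is hyperbolic and there is a sectional-hyperbolic splitting for $X$ over $\Lambda$; it is positively (resp. negatively) sectional-hyperbolic if it is sectional-hyperbolic for $X$ (resp. for $-X$). *)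

(* Defs.v *)
From HB Require Import structures.
From mathcomp Require Import all_boot all_order all_algebra.
From mathcomp Require Import all_classical all_reals all_analysis.

Set Implicit Arguments.
Unset Strict Implicit.
Unset Printing Implicit Defensive.

Import Order.TTheory GRing.Theory Num.Theory.
Import numFieldNormedType.Exports.

Local Open Scope classical_set_scope.
Local Open Scope ring_scope.

(* S^3 is the unit sphere of R^4 = 'rV[R]_4.  A map defined on S^3 is a map on
   R^4 of which only the values on S^3 matter: its differential at a point of
   S^3 is that of its extension, constant on open rays, to R^4 \ {0}.  Linear
   maps act on row vectors on the right, and a linear subspace of R^4 is the
   row space of a 4x4 matrix. *)

Section Sphere.
Variable R : realType.
Local Notation V := 'rV[R]_4.
Implicit Types (x y u v : V) (E F : V -> 'M[R]_4).

Definition dot u v : R := (u *m v^T) 0 0.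

Definition sphere3 : set V := [set x | dot x x = 1].

Definition normalize x : V := (Num.sqrt (dot x x))^-1 *: x.

Definition tangent x : 'M[R]_4 := kermx x^T.

(* Differential on S^3, as the matrix of v |-> df(x) v.  It annihilates the
   normal direction x, so only its values on [tangent x] carry information. *)
Definition sphere_diff (f : V -> V) x : 'M[R]_4 := 'J (f \o normalize) x.

Fixpoint Ck (k : nat) (W : normedModType R) (U : set V) (f : V -> W) : Prop :=
  match k with
  | 0 => forall x, U x -> {for x, continuous f}
  | k'.+1 => (forall x, U x -> differentiable f x) /\
             (forall v, Ck k' U (fun x => 'D_v f x))
  end.

Definition sphere_Ck (k : nat) (W : normedModType R) (f : V -> W) : Prop :=
  Ck k [set x | x != 0] (f \o normalize).

Definition metric_form (g : V -> 'M[R]_4) x u v : R := (u *m g x *m v^T) 0 0.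

(* Only the restriction of [g x] to [tangent x] is an inner product. *)
Definition riemannian_metric (g : V -> 'M[R]_4) : Prop :=
  [/\ forall k, sphere_Ck k g,
      forall x, sphere3 x -> (g x)^T = g x
    & forall x v, sphere3 x -> (v <= tangent x)%MS -> v != 0 ->
        0 < metric_form g x v v].

Definition rnorm g x v : R := Num.sqrt (metric_form g x v v).

Definition rarea g x u v : R :=
  Num.sqrt (metric_form g x u u * metric_form g x v v
            - metric_form g x u v ^+ 2).

Definition sphere_path x y (c : R -> V) : Prop :=
  [/\ forall t, sphere3 (c t), forall t, derivable c t 1,
      continuous (derive1 c) & c 0 = x /\ c 1 = y].

Definition path_length g (c : R -> V) : R :=
  \int[lebesgue_measure]_(t in `[0, 1]) rnorm g (c t) (derive1 c t).

Definition rdist g x y : R := inf [set path_length g c | c in sphere_path x y].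

Definition vector_field (X : V -> V) : Prop :=
  (forall x, sphere3 x -> (X x <= tangent x)%MS) /\ sphere_Ck 1 X.

Definition integral_curve (X : V -> V) x (c : R -> V) : Prop :=
  [/\ c 0 = x, forall t, sphere3 (c t)
    & forall t, is_derive (t : R) (1 : R) c (X (c t))].

(* For a C^1 vector field and x in S^3 there is exactly one integral curve,
   so that the default value of [xget] is not used. *)
Definition flow (X : V -> V) (t : R) x : V :=
  xget (fun=> x) [set c | integral_curve X x c] t.

Definition flow_diff (X : V -> V) (t : R) x : 'M[R]_4 :=
  sphere_diff (flow X t) x.

Definition singularity (X : V -> V) x : Prop := sphere3 x /\ X x = 0.

Definition periodic_point (X : V -> V) x : Prop :=
  sphere3 x /\
  exists t, [/\ 0 < t, flow X t x = x
    & forall s, 0 < s -> s < t -> flow X s x <> x].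

Definition orbit (X : V -> V) x : set V := range (fun t => flow X t x).

Definition compact_invariant (X : V -> V) (L : set V) : Prop :=
  [/\ L `<=` sphere3, compact L & forall t, flow X t @` L = L].

(* Continuous family of subspaces, given locally on L by continuous frames;
   its rank is locally constant, possibly 0. *)
Definition subbundle (L : set V) E : Prop :=
  forall x, L x -> exists (U : set V) (k : nat) (B : V -> 'M[R]_(k, 4)),
    [/\ open_nbhs x U, {within L `&` U, continuous B}
      & forall y, L y -> U y -> row_free (B y) /\ (E y :=: B y)%MS].

Definition flow_invariant (X : V -> V) (L : set V) E : Prop :=
  forall x t, L x -> (E x *m flow_diff X t x :=: E (flow X t x))%MS.

Definition contracting_with (K l : R) g X (L : set V) E : Prop :=
  forall x v t, L x -> (v <= E x)%MS -> 0 <= t ->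
    rnorm g (flow X t x) (v *m flow_diff X t x)
      <= K * expR (- (l * t)) * rnorm g x v.

Definition expanding_with (K l : R) g X (L : set V) E : Prop :=
  forall x v t, L x -> (v <= E x)%MS -> 0 <= t ->
    K^-1 * expR (l * t) * rnorm g x v
      <= rnorm g (flow X t x) (v *m flow_diff X t x).

Definition contracting g X L E : Prop :=
  exists K l : R, [/\ 0 < K, 0 < l & contracting_with K l g X L E].

Definition hyperbolic g X (L : set V) : Prop :=
  compact_invariant X L /\
  exists (Es EX Eu : V -> 'M[R]_4) (K l : R),
    [/\ 0 < K /\ 0 < l,
        [/\ subbundle L Es, subbundle L EX & subbundle L Eu],
        [/\ flow_invariant X L Es, flow_invariant X L EX
          & flow_invariant X L Eu],
        forall x, L x -> (Es x + EX x + Eu x :=: tangent x)%MS /\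
                         mxdirect (Es x + EX x + Eu x)
      & [/\ contracting_with K l g X L Es,
            forall x, L x -> (EX x :=: X x)%MS
          & expanding_with K l g X L Eu]].

Definition dominated_splitting g X (L : set V) E F : Prop :=
  [/\ subbundle L E /\ subbundle L F,
      flow_invariant X L E /\ flow_invariant X L F,
      forall x, L x -> (E x + F x :=: tangent x)%MS /\ mxdirect (E x + F x)
    & exists K l : R, [/\ 0 < K, 0 < l
      & forall x t e f, L x -> 0 <= t -> (e <= E x)%MS -> (f <= F x)%MS ->
          rnorm g (flow X t x) (e *m flow_diff X t x) * rnorm g x f
            <= K * expR (- (l * t))
               * rnorm g (flow X t x) (f *m flow_diff X t x) * rnorm g x e]].

Definition partially_hyperbolic_splitting g X L E F : Prop :=
  dominated_splitting g X L E F /\ contracting g X L E.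

Definition sectionally_expanding g X (L : set V) F : Prop :=
  exists K l : R, [/\ 0 < K, 0 < l
    & forall x u v t, L x -> (u <= F x)%MS -> (v <= F x)%MS -> 0 <= t ->
        K^-1 * expR (l * t) * rarea g x u v
          <= rarea g (flow X t x) (u *m flow_diff X t x)
                                  (v *m flow_diff X t x)].

Definition sectional_hyperbolic_splitting g X L E F : Prop :=
  partially_hyperbolic_splitting g X L E F /\ sectionally_expanding g X L F.

Definition sectional_hyperbolic g X (L : set V) : Prop :=
  [/\ compact_invariant X L,
      forall x, L x -> singularity X x -> hyperbolic g X [set x]
    & exists E F, sectional_hyperbolic_splitting g X L E F].

Definition positively_sectional_hyperbolic g X (L : set V) : Prop :=
  sectional_hyperbolic g X L.

Definition negatively_sectional_hyperbolic g (X : V -> V) (L : set V) : Prop :=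
  sectional_hyperbolic g (fun x => - X x) L.

(* x is in the chain stable set of y *)
Definition chain_stable g X x y : Prop :=
  forall e : R, 0 < e ->
  exists (n : nat) (xs : nat -> V) (ts : nat -> R),
    [/\ (1 <= n)%N, xs 0%N = x /\ xs n = y,
        forall i, (i <= n)%N -> sphere3 (xs i)
      & forall i, (i < n)%N ->
          1 <= ts i /\ rdist g (flow X (ts i) (xs i)) (xs i.+1) < e].

Definition chain_related g X x y : Prop :=
  chain_stable g X x y /\ chain_stable g X y x.

Definition CR g X : set V := [set x | sphere3 x /\ chain_related g X x x].

Definition C1_close (e : R) (X Y : V -> V) : Prop :=
  forall x, sphere3 x ->
    `|Y x - X x| < e /\ `|sphere_diff Y x - sphere_diff X x| < e.

Definition C1_neighborhood (X : V -> V) (U : set (V -> V)) : Prop :=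
  U `<=` vector_field /\
  exists2 e : R, 0 < e &
    forall Y, vector_field Y -> C1_close e X Y -> U Y.

Definition star g (X : V -> V) : Prop :=
  vector_field X /\
  exists U : set (V -> V), C1_neighborhood X U /\
    forall Y, U Y ->
      (forall x, periodic_point Y x -> hyperbolic g Y (orbit Y x)) /\
      (forall x, singularity Y x -> hyperbolic g Y [set x]).

End Sphere.

(* Main.v *)
Require Import Defs.
From HB Require Import structures.
From mathcomp Require Import all_boot all_order all_algebra.
From mathcomp Require Import all_classical all_reals all_analysis.
From mathcomp Require Import ring lra.

(** The example is a polynomial field on R^4 that is tangent to S^3, with
    coordinates [x_i f_i(x_0^2, .., x_3^2)]; it leaves every coordinate
    subspace invariant. Its zeros on S^3 are the eight vertices [+-e_i], four
    sinks with [x_0 = x_2 = 0] and four sources with [x_1 = x_3 = 0]. On the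
    circle through [e_i] and [e_(i+1)] (indices modulo 4) the orbits go from
    [+-e_i] to [+-e_(i+1)], so the vertices and the arcs between them form a
    heteroclinic cycle [Gamma], the union of these four circles. At [e_0] and
    [e_2] the eigenvalues in the tangent space are -3, -1 and 2, at [e_1] and
    [e_3] they are -2, 1 and 3.

    It is star ([star_X]). The function [phi x = (x_1 x_3)^2] increases along
    [X] and [psi x = (x_0 x_2)^2] decreases, strictly unless they vanish or
    reach their maximum, which they do at the sinks and at the sources;
    [Gamma] is the set where both vanish. Let Y be C^1 close to X. A periodic
    orbit of Y on which [phi] is not always small would have to stay near the
    sinks, where the norm of Y decreases strictly along the orbits; this is
    impossible, and the same holds for [psi] and the sources, with time
    reversed ([periodic_barrier]). Hence the periodic orbits of Y lie near
    [Gamma]. There, represent a tangent vector v modulo Y by the cross product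
    p of v, Y and x in R^4, and consider [p_0^2 - p_1^2 + p_2^2 - p_3^2].
    Along the flow of X it increases strictly at the points of [Gamma]
    ([gamma_pos]), with an estimate that survives at the zeros and under
    perturbation, so it increases along the flow of Y near [Gamma]
    ([transverse_flow]). A linear map under which a quadratic form strictly
    increases is hyperbolic ([hyperbolic_splitting]): the vectors on which the
    form stays nonpositive under all iterates form a contracted subspace,
    those on which it stays nonnegative under all backward iterates an
    expanded one, and the dimensions add up. Applied to the return map on the
    tangent space modulo Y, this gives hyperbolicity of the periodic orbits
    ([periodic_hyperbolic]). Zeros of Y are treated in the same way, with the
    form [dot (v DX) v], which increases near the zeros of X
    ([singular_hyperbolic]).

    Its chain recurrent set admits no decomposition. Following the cycle shows
    that the arc from [e_0] to [e_1] is contained in the chain recurrent set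
    ([arc_CR]). Two disjoint compact sets that cover this connected arc do not
    cut it, so one of them contains it together with [e_0] and [e_1]. Suppose
    that it is positively sectional-hyperbolic, with splitting E + F. At the
    end of the arc, near [e_1], the components 2 and 3 of a tangent vector do
    not decrease, so that a vector of E has to be tangent to the arc; but X
    itself is bounded in the past and cannot lie in a contracted bundle. So E
    vanishes on the arc, and by continuity at [e_0]. Then F is the full
    tangent space at [e_0], although the area spanned by [e_2] and [e_3] is
    contracted there: their eigenvalues are -3 and -1. For -X the roles of
    [e_0] and [e_1] are exchanged. Both cases are instances of [no_sectional].

    The flow is given through its integral curves. That they exist for all
    times ([picard]), and that the flow has a differential, which solves the
    variational equation ([variation_flow_diff]), rests on Picard iteration
    and on Gronwall estimates. *)

Set Implicit Arguments.
Unset Strict Implicit.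
Unset Printing Implicit Defensive.

Import Order.TTheory GRing.Theory Num.Theory.
Import numFieldNormedType.Exports.

Local Open Scope classical_set_scope.
Local Open Scope ring_scope.

(** * Euclidean and supremum norms *)

Section Dot.
Variable R : realType.
Local Notation V := 'rV[R]_4.
Implicit Types u v w : V.

Lemma dotE u v : dot u v = \sum_i u 0 i * v 0 i.
Proof. by rewrite /dot mxE; apply: eq_bigr => i _; rewrite mxE. Qed.

Lemma sum_const4 (a : R) : \sum_(i < 4) a = 4 * a.
Proof. by rewrite sumr_const card_ord [RHS]mulr_natl. Qed.

Lemma dotC u v : dot u v = dot v u.
Proof. by rewrite !dotE; apply: eq_bigr => i _; rewrite mulrC. Qed.

Lemma dotDl u v w : dot (u + v) w = dot u w + dot v w.
Proof. by rewrite /dot mulmxDl mxE. Qed.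

Lemma dotDr u v w : dot u (v + w) = dot u v + dot u w.
Proof. by rewrite dotC dotDl !(dotC u). Qed.

Lemma dotZl (a : R) u v : dot (a *: u) v = a * dot u v.
Proof. by rewrite /dot -scalemxAl mxE. Qed.

Lemma dotZr (a : R) u v : dot u (a *: v) = a * dot u v.
Proof. by rewrite dotC dotZl dotC. Qed.

Lemma dotNl u v : dot (- u) v = - dot u v.
Proof. by rewrite -scaleN1r dotZl mulN1r. Qed.

Lemma dotNr u v : dot u (- v) = - dot u v.
Proof. by rewrite dotC dotNl dotC. Qed.

Lemma dot0l u : dot 0 u = 0.
Proof. by rewrite -(scale0r u) dotZl mul0r. Qed.

Lemma dot0r u : dot u 0 = 0.
Proof. by rewrite dotC dot0l. Qed.

Definition dotlin := (dotDl, dotDr, dotZl, dotZr, dotNl, dotNr, dot0l, dot0r).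

Lemma dot_ge0 u : 0 <= dot u u.
Proof. by rewrite dotE sumr_ge0// => i _; rewrite -expr2 sqr_ge0. Qed.

Lemma coord_le_dot u i : u 0 i ^+ 2 <= dot u u.
Proof.
rewrite dotE (bigD1 i)//= -expr2 lerDl sumr_ge0// => j _.
by rewrite -expr2 sqr_ge0.
Qed.

Lemma dot_eq0 u : (dot u u == 0) = (u == 0).
Proof.
apply/idP/idP => [/eqP u0|/eqP->]; last by rewrite dot0l.
apply/eqP/rowP => i; rewrite mxE; apply/eqP.
by rewrite -sqrf_eq0 eq_le sqr_ge0 andbT -u0 coord_le_dot.
Qed.

Lemma dot_gt0 u : (0 < dot u u) = (u != 0).
Proof. by rewrite lt_def dot_ge0 andbT dot_eq0. Qed.

(** The norm of a matrix is the largest absolute value of its entries, whence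
    the constants 4 and 16 in the comparisons with [dot]. *)
Lemma dot_norm u : `|u| ^+ 2 <= dot u u.
Proof.
have [->|u0] := eqVneq u 0; first by rewrite normr0 expr0n dot_ge0.
suff : `|u| <= Num.sqrt (dot u u).
  move=> h; rewrite -[leRHS](sqr_sqrtr (dot_ge0 u)).
  by rewrite lerXn2r// ?nnegrE ?sqrtr_ge0.
rewrite [leLHS]/Num.Def.normr/= mx_normrE (bigmax_le _ (sqrtr_ge0 _))//=.
move=> [i j] _ /=; rewrite ord1.
by rewrite -sqrtr_sqr ler_wsqrtr// coord_le_dot.
Qed.

Lemma norm_coord (m n : nat) (M : 'M[R]_(m, n)) i j : `|M i j| <= `|M|.
Proof.
rewrite [leRHS]/Num.Def.normr/= mx_normrE.
exact: (le_bigmax _ (fun ij => `|M ij.1 ij.2|) (i, j)).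
Qed.

Lemma norm_mx_le (m n : nat) (M : 'M[R]_(m, n)) (e : R) : 0 <= e ->
  (forall i j, `|M i j| <= e) -> `|M| <= e.
Proof.
by move=> e0 h; rewrite [leLHS]/Num.Def.normr/= mx_normrE (bigmax_le _ e0).
Qed.

Lemma dot_le_norm u : dot u u <= 4 * `|u| ^+ 2.
Proof.
rewrite dotE (le_trans (ler_sum _ (fun i _ => _ : _ <= `|u| ^+ 2)))//.
  move=> i _.
  by rewrite -expr2 -real_normK ?num_real// lerXn2r// ?nnegrE// norm_coord.
by rewrite sum_const4.
Qed.

Lemma dot_expand u v (a b : R) : dot (a *: u + b *: v) (a *: u + b *: v) =
  a ^+ 2 * dot u u + 2 * a * b * dot u v + b ^+ 2 * dot v v.
Proof. by rewrite !dotlin (dotC v u); ring. Qed.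

Lemma dot_CS u v : dot u v ^+ 2 <= dot u u * dot v v.
Proof.
have [->|v0] := eqVneq v 0; first by rewrite !dot0r expr0n mulr0.
have := dot_ge0 (dot v v *: u + (- dot u v) *: v).
rewrite dot_expand.
have -> : dot v v ^+ 2 * dot u u + 2 * dot v v * - dot u v * dot u v +
  (- dot u v) ^+ 2 * dot v v = dot v v * (dot u u * dot v v - dot u v ^+ 2) by ring.
by rewrite pmulr_rge0 ?dot_gt0// subr_ge0.
Qed.

Lemma dot_young u v : 2 * dot u v <= dot u u + dot v v.
Proof.
have := dot_ge0 (1 *: u + (-1) *: v).
by rewrite dot_expand => h; lra.
Qed.

Lemma dot_young_abs u v : 2 * `|dot u v| <= dot u u + dot v v.
Proof.
case: (ger0P (dot u v)) => _; first exact: dot_young.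
by have := dot_young (- u) v; rewrite !dotlin opprK.
Qed.

Lemma dot_mulmx u (A : 'M[R]_4) : dot (u *m A) (u *m A) <= 16 * `|A| ^+ 2 * dot u u.
Proof.
rewrite [leLHS]dotE.
have h i : (u *m A) 0 i * (u *m A) 0 i <= 4 * `|A| ^+ 2 * dot u u.
  have -> : (u *m A) 0 i = dot u (\row_j A j i).
    by rewrite dotE mxE; apply: eq_bigr => j _; rewrite mxE.
  rewrite -expr2 (le_trans (dot_CS _ _))// mulrC ler_wpM2r ?dot_ge0//.
  rewrite (le_trans (dot_le_norm _))// ler_wpM2l// lerXn2r// ?nnegrE//.
  by rewrite norm_mx_le// => k j; rewrite mxE norm_coord.
rewrite (le_trans (ler_sum _ (fun i _ => h i)))//.
by rewrite sum_const4 le_eqVlt; apply/orP; left; apply/eqP; ring.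
Qed.

Lemma norm_mulmx u (A : 'M[R]_4) : `|u *m A| <= 4 * `|u| * `|A|.
Proof.
apply: norm_mx_le => [|i j]; first by rewrite !mulr_ge0.
rewrite mxE (le_trans (ler_norm_sum _ _ _))//.
rewrite (le_trans (ler_sum _ (fun k _ => _ : _ <= `|u| * `|A|)))//.
  by move=> k _; rewrite normrM ler_pM// norm_coord.
by rewrite sum_const4 mulrA.
Qed.

Lemma tangentE (x u : V) : (u <= tangent x)%MS = (dot u x == 0).
Proof.
rewrite /tangent sub_kermx /dot; apply/eqP/eqP => [->|h]; first by rewrite mxE.
by apply/rowP => i; rewrite ord1 h mxE.
Qed.

End Dot.

(** * Derivatives of curves and global solutions of differential equations *)

Section Derivatives.
Variable R : realType.

Lemma is_derive_mx (m n : nat) (M : R -> 'M[R]_(m, n)) (dM : 'M[R]_(m, n)) (t : R) :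
  is_derive t 1 M dM <->
  (forall i j, is_derive t 1 (fun s => M s i j) (dM i j)).
Proof.
split => [h i j|h].
  have d : derivable M t 1 by exact: ex_derive.
  apply: DeriveDef; first by move/derivable_mxP : d; apply.
  by have := derive_mx d; rewrite derive_val => ->; rewrite mxE.
have d : derivable M t 1 by apply/derivable_mxP => i j; exact: ex_derive.
apply: DeriveDef => //; rewrite derive_mx//.
by apply/matrixP => i j; rewrite mxE derive_val.
Qed.

Lemma is_derive_dot (c d : R -> 'rV[R]_4) (dc dd : 'rV[R]_4) (t : R) :
  is_derive t 1 c dc -> is_derive t 1 d dd ->
  is_derive t 1 (fun s => dot (c s) (d s)) (dot dc (d t) + dot (c t) dd).
Proof.
move=> /is_derive_mx hc /is_derive_mx hd.
have -> : (fun s => dot (c s) (d s)) =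
  \sum_(i < 4) ((fun s => c s 0 i) * (fun s => d s 0 i)).
  apply/funext => s; rewrite dotE fct_sumE//.
rewrite !dotE -big_split/=.
apply: is_derive_eq.
apply: eq_bigr => i _.
by rewrite addrC /GRing.scale/=; congr (_ + _); rewrite mulrC.
Qed.

Lemma is_derive_cont (W : normedModType R) (f : R -> W) (df : R -> W) :
  (forall t : R, is_derive t 1 f (df t)) -> continuous f.
Proof.
move=> h t; apply: differentiable_continuous; apply/derivable1_diffP.
exact: ex_derive.
Qed.

Lemma nondecr_derive (f df : R -> R) (a b : R) : a <= b ->
  (forall t : R, is_derive t 1 f (df t)) ->
  (forall t, a <= t <= b -> 0 <= df t) -> f a <= f b.
Proof.
move=> ab hf h.
have [|c cab e] := MVT_segment ab (fun x _ => hf x).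
  by apply: continuous_subspaceT; exact: is_derive_cont hf.
by rewrite -subr_ge0 e mulr_ge0 ?subr_ge0 ?h// -in_itv.
Qed.

Lemma is_derive_chain (W : normedModType R) (f : R -> W) (g : R -> R) (df : W)
    (dg t : R) :
  is_derive (g t) 1 f df -> is_derive t 1 g dg ->
  is_derive t 1 (f \o g) (dg *: df).
Proof.
move=> hf hg.
have df1 : differentiable f (g t) by apply/derivable1_diffP; exact: ex_derive.
have dg1 : differentiable g t by apply/derivable1_diffP; exact: ex_derive.
have dc : differentiable (f \o g) t by apply: differentiable_comp.
apply: DeriveDef; first by apply/derivable1_diffP.
rewrite deriveE// diff_comp//=.
have -> : 'd g t 1 = dg *: (1 : R).
  by rewrite -deriveE// derive_val /GRing.scale/= mulr1.
by rewrite linearZ/= -deriveE// derive_val.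
Qed.

Lemma is_derive_reflect (W : normedModType R) (f : R -> W) (df : W) (t : R) :
  is_derive (- t) 1 f df -> is_derive t 1 (fun s => f (- s)) (- df).
Proof. by move=> h; rewrite -scaleN1r; exact: is_derive_chain. Qed.

Lemma is_derive_shiftr (W : normedModType R) (f : R -> W) (df : W) (t a : R) :
  is_derive (t + a) 1 f df -> is_derive t 1 (fun s => f (s + a)) df.
Proof.
move=> h; rewrite -[df]scale1r; apply: (is_derive_chain (g := fun s : R => s + a)) => //.
have -> : (fun s : R => s + a) = id + cst a by [].
by apply: is_derive_eq; rewrite addr0.
Qed.

Lemma is_derive_exp (L t : R) : is_derive t 1 (fun s => expR (L * s)) (L * expR (L * t)).
Proof.
have h : is_derive t 1 ( *%R L) L.
  have -> : *%R L = L *: (id : R -> R) by [].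
  by apply: is_derive_eq; rewrite /GRing.scale/= mulr1.
by have := is_derive1_comp (is_derive_expR (L * t)) h; rewrite mulrC.
Qed.

(** [e s] times [expR (- L s)] is nonincreasing. *)
Lemma gronwall (e de : R -> R) (L t : R) : 0 <= t ->
  (forall s : R, is_derive s 1 e (de s)) ->
  (forall s, 0 <= s <= t -> de s <= L * e s) -> e t <= e 0 * expR (L * t).
Proof.
move=> t0 he h.
pose f := (fun s => expR (- L * s)) * (- e).
have hf (s : R) : is_derive s 1 f (expR (- L * s) * (L * e s - de s)).
  rewrite /f; have := is_derive_exp (- L) s => hh.
  by apply: is_derive_eq; rewrite /GRing.scale/= !opprfctE; ring.
have : f 0 <= f t.
  apply: (nondecr_derive t0 hf) => s /h.
  by rewrite -subr_ge0 => ?; rewrite mulr_ge0 ?expR_ge0.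
have fE (s : R) : f s = - (expR (- L * s) * e s) by rewrite /f mulrfctE/= mulrN.
rewrite !fE lerN2 mulr0 expR0 mul1r => hh.
rewrite -(@ler_pM2l _ (expR (- L * t))) ?expR_gt0//.
have -> : expR (- L * t) * (e 0 * expR (L * t)) = e 0.
  by rewrite mulrCA -expRD mulNr addNr expR0 mulr1.
exact: hh.
Qed.

Lemma locally_eq_derive (W : normedModType R) (f g : R -> W) (df : W) (t e : R) : 0 < e ->
  (forall s, `|s - t| < e -> f s = g s) -> is_derive t 1 f df -> is_derive t 1 g df.
Proof.
move=> e0 h; apply: near_eq_is_derive.
apply/nbhs_ballP; exists e => //= s; rewrite /ball/= distrC => /h ->.
by [].
Qed.

Lemma const_derive0 (f : R -> R) (a b : R) :
  a <= b -> (forall t, a <= t <= b -> is_derive t 1 f 0) -> f a = f b.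
Proof.
move=> ab h.
have [||c _ /eqP] := @MVT_segment _ f (fun=> 0) a b ab.
- by move=> x; rewrite in_itv/= => /andP[/ltW ax /ltW xb]; apply: h; rewrite ax.
- apply: derivable_within_continuous => x; rewrite in_itv/= => xab.
  by have := h x xab => ?; exact: ex_derive.
by rewrite mul0r subr_eq0 => /eqP ->.
Qed.

Lemma primitive_half (f : R -> R) (a : R) : continuous f ->
  exists F : R -> R, F 0 = 0 /\ forall x : R, a < x -> is_derive x 1 F (f x).
Proof.
move=> cf.
pose F0 x := (\int[lebesgue_measure]_(t in [set` `[a, x]]) (f t))%R.
have h x : a < x -> is_derive x 1 F0 (f x).
  move=> ax.
  have xu : x < x + 1 by rewrite ltrDl.
  have fi : (lebesgue_measure : measure _ R).-integrable `[a, x + 1] (EFin \o f).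
    apply: continuous_compact_integrable; first exact: segment_compact.
    exact: continuous_subspaceT.
  have [d e] := continuous_FTC1_closed xu fi ax (cf x).
  apply: DeriveDef; first exact: d.
  by rewrite -derive1E; exact: e.
exists (F0 - cst (F0 0)); split; first by rewrite !fctE subrr.
by move=> x /h hx; apply: is_derive_eq; rewrite subr0.
Qed.

(** Primitives on the half-lines x > -n that vanish at 0 agree where they are
    both defined, and glue to a primitive on the whole line. *)
Lemma primitive_exists (f : R -> R) : continuous f ->
  exists F : R -> R, F 0 = 0 /\ forall x : R, is_derive x 1 F (f x).
Proof.
move=> cf.
have [F hF] := choice (fun n : nat => @primitive_half f (- n%:R) cf).
have eqF n m (x : R) : - n%:R < x -> - n%:R < 0 :> R -> (n <= m)%N -> F n x = F m x.
  move=> nx n0 nm.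
  have d (y : R) : - n%:R < y -> is_derive y 1 (F n - F m) 0.
    move=> ny; have h1 := (hF n).2 y ny.
    have h2 : is_derive y 1 (F m) (f y).
      by apply: (hF m).2; apply: le_lt_trans ny; rewrite lerN2 ler_nat.
    by apply: is_derive_eq; rewrite subrr.
  have e0 : (F n - F m) 0 = 0 by rewrite !fctE (hF n).1 (hF m).1 subrr.
  apply/eqP; rewrite -subr_eq0; apply/eqP.
  have -> : F n x - F m x = (F n - F m) x by rewrite !fctE.
  have [x0|x0] := leP 0 x.
    rewrite -e0; apply/esym/const_derive0 => // t /andP[t0 _].
    exact/d/(lt_le_trans n0).
  rewrite -e0; apply/const_derive0 => [|t /andP[xt _]]; first exact: ltW.
  exact/d/(lt_le_trans nx).
pose N x := (Num.truncn `|x : R|).+1.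
have hN x : `|x| < (N x)%:R by rewrite /N truncnS_gt.
have N0 n : - n.+1%:R < 0 :> R by rewrite ltrNl oppr0.
exists (fun x => F (N x) x); split; first exact: (hF _).1.
move=> x.
pose n := (N x).+1.
have hx : - n%:R < x.
  rewrite ltrNl (le_lt_trans (ler_norm _))// normrN (lt_trans (hN x))//.
  by rewrite ltr_nat.
apply: (@locally_eq_derive _ (F n) _ _ _ 1) => //; last exact: (hF n).2.
move=> s sx.
have hsn : `|s| < n%:R.
  rewrite -(subrK x s) (le_lt_trans (ler_normD _ _))// /n -natr1 addrC ltrD//.
have hs : - n%:R < s.
  by rewrite ltrNl (le_lt_trans (ler_norm _))// normrN.
have hs2 : - (N s)%:R < s.
  by rewrite ltrNl (le_lt_trans (ler_norm _))// normrN.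
have [nm|mn] := leqP n (N s); first by rewrite (eqF _ _ _ hs (N0 _) nm).
by rewrite -(eqF _ _ _ hs2 (N0 _) (ltnW mn)).
Qed.

Lemma primitive_rV n (f : R -> 'rV[R]_n) : continuous f ->
  exists F : R -> 'rV[R]_n, F 0 = 0 /\ forall x : R, is_derive x 1 F (f x).
Proof.
move=> cf.
have c i : continuous (fun t => f t 0 i).
  move=> t; apply: (@continuous_comp _ _ _ f (fun M : 'rV[R]_n => M 0 i)).
    exact: cf.
  exact: coord_continuous.
have [F hF] := choice (fun i => primitive_exists (c i)).
exists (fun t => \row_i F i t); split.
  by apply/rowP => i; rewrite !mxE (hF i).1.
move=> x; apply/is_derive_mx => i j; rewrite ord1.
have -> : (fun s : R => (\row_i F i s) 0 j) = F j by apply/funext => s; rewrite mxE.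
exact: (hF j).2.
Qed.

(** Integration gains a factor [1 / L] in the norm weighted by
    [expR (- L |t|)]. The Picard operator of a K-Lipschitz field therefore
    contracts this norm when L > K. *)
Lemma exp_mvi n (g dg : R -> 'rV[R]_n) (B L : R) : 0 < L -> 0 <= B ->
  (forall t : R, is_derive t 1 g (dg t)) ->
  (forall t, `|dg t| <= B * expR (L * `|t|)) ->
  forall t, `|g t - g 0| <= B / L * expR (L * `|t|).
Proof.
move=> L0 B0.
have key (f df : R -> R) : (forall t : R, is_derive t 1 f (df t)) ->
    (forall t, `|df t| <= B * expR (L * `|t|)) ->
    forall t, 0 <= t -> f t - f 0 <= B / L * expR (L * t).
  move=> hf hd t t0.
  have hh (s : R) : is_derive s 1 ((B / L) *: (fun r => expR (L * r)) - f)
      (B * expR (L * s) - df s).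
    have := is_derive_exp L s => hexp; have := hf s => hfs.
    apply: is_derive_eq; congr (_ - _).
    by rewrite /GRing.scale/= mulrA divfK// gt_eqF.
  have hp (s : R) : 0 <= s <= t -> 0 <= B * expR (L * s) - df s.
    move=> /andP[s0 _]; rewrite subr_ge0 (le_trans (ler_norm _))//.
    by rewrite -{2}(ger0_norm s0).
  have := nondecr_derive t0 hh hp.
  rewrite !fctE mulr0 expR0 /GRing.scale/=.
  have : 0 <= B / L by rewrite divr_ge0// ltW.
  lra.
move=> hg hd t; apply: norm_mx_le => [|i j].
  by rewrite mulr_ge0 ?expR_ge0// divr_ge0// ltW.
rewrite !mxE.
have hgi : forall s : R, is_derive s 1 (fun r => g r i j) (dg s i j).
  by move=> s; have /is_derive_mx := hg s.
have hdi s : `|dg s i j| <= B * expR (L * `|s|).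
  exact: le_trans (norm_coord _ _ _) (hd s).
have hgN (s : R) : is_derive s 1 (- (fun r => g r i j)) (- dg s i j).
  by have := hgi s => ?; apply: is_derive_eq.
have hdN s : `|- dg s i j| <= B * expR (L * `|s|) by rewrite normrN.
have [t0|t0] := leP 0 t.
  rewrite ler_norml; apply/andP; split; last first.
    by rewrite ger0_norm// (key _ _ hgi hdi).
  have := key _ _ hgN hdN t t0; rewrite !fctE ger0_norm//; lra.
have t0' : 0 <= - t by rewrite oppr_ge0 ltW.
have hr (s : R) : is_derive s 1 (fun r => g (- r) i j) (- dg (- s) i j).
  exact: (is_derive_reflect (hgi (- s))).
have hrd s : `|- dg (- s) i j| <= B * expR (L * `|s|).
  by rewrite normrN (le_trans (hdi _))// normrN.
have hrN (s : R) : is_derive s 1 (- (fun r => g (- r) i j)) (dg (- s) i j).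
  by have := hr s => ?; apply: is_derive_eq; rewrite opprK.
have hrdN s : `|dg (- s) i j| <= B * expR (L * `|s|).
  by rewrite -normrN.
have h1 := key _ _ hr hrd (- t) t0'.
have h2 := key _ _ hrN hrdN (- t) t0'.
rewrite !fctE opprK oppr0 in h1 h2.
rewrite (ltr0_norm t0) ler_norml; apply/andP; split; lra.
Qed.

Lemma geometric_small (a r e : R) : 0 <= r < 1 -> 0 < e ->
  exists N, forall n, (N <= n)%N -> a * r ^+ n < e.
Proof.
move=> /andP[r0 r1] e0.
have : geometric a r @ \oo --> (0 : R) by apply: cvg_geometric; rewrite ger0_norm.
move=> /cvgrPdist_lt /(_ _ e0)[N _ h]; exists N => n /h /=.
by rewrite sub0r normrN => /(le_lt_trans (ler_norm _)).
Qed.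

(** In the norm weighted by [expR (- 2 K |t|)] the Picard operator halves the
    distances, so that its iterates converge on the whole line and no
    continuation of local solutions is involved. *)
Lemma picard n (F : R -> 'rV[R]_n -> 'rV[R]_n) (K M : R) (x0 : 'rV[R]_n) :
  0 < K -> 0 <= M ->
  (forall c : R -> 'rV[R]_n, continuous c -> continuous (fun t => F t (c t))) ->
  (forall t x y, `|F t x - F t y| <= K * `|x - y|) ->
  (forall t, `|F t x0| <= M) ->
  exists c : R -> 'rV[R]_n, c 0 = x0 /\ forall t : R, is_derive t 1 c (F t (c t)).
Proof.
move=> K0 M0 Fc FK FM.
have hS0 (c : R -> 'rV[R]_n) : exists d : R -> 'rV[R]_n, continuous c -> d 0 = x0 /\
    forall t : R, is_derive t 1 d (F t (c t)).
  have [cc|ncc] := pselect (continuous c); last by exists (fun=> 0).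
  have [G [G0 hG]] := primitive_rV (Fc c cc).
  exists (G + cst x0) => _; split; first by rewrite !fctE G0 add0r.
  by move=> t; apply: is_derive_eq; rewrite addr0.
have [S hS] := choice hS0.
pose cs k := iter k S (cst x0).
have cc k : continuous (cs k).
  elim: k => [|k IH] /=; first by move=> t; exact: cvg_cst.
  exact: is_derive_cont (hS _ IH).2.
have cs0 k : cs k 0 = x0 by case: k => [//|k]; exact: (hS _ (cc k)).1.
have csd k (t : R) : is_derive t 1 (cs k.+1) (F t (cs k t)).
  exact: (hS _ (cc k)).2.
(* The exponent of the weight, twice the Lipschitz constant. *)
pose L := 2 * K; have L0 : 0 < L by rewrite mulr_gt0.
pose A := M / L; have A0 : 0 <= A by rewrite divr_ge0// ltW.
pose E t := expR (L * `|t : R|).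
have E1 t : 1 <= E t by rewrite -[leLHS]expR0 ler_expR mulr_ge0// ltW.
have E0 t : 0 <= E t by exact: expR_ge0.
have bnd k : forall t, `|cs k.+1 t - cs k t| <= A * 2^-1 ^+ k * E t.
  elim: k => [|k IH] t.
    have := @exp_mvi n (cs 1) (fun t => F t x0) M L L0 M0 (csd 0%N).
    move=> /(_ _ t); rewrite cs0 expr0 mulr1; apply => s.
    by rewrite (le_trans (FM s))// ler_peMr//; exact: (E1 s).
  have hd (s : R) : is_derive s 1 (cs k.+2 - cs k.+1)
      (F s (cs k.+1 s) - F s (cs k s)).
    by have h1 := csd k.+1 s; have h2 := csd k s; apply: is_derive_eq.
  have B0 : 0 <= K * (A * 2^-1 ^+ k).
    have A20 j : 0 <= A * 2^-1 ^+ j.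
      by apply: mulr_ge0; [exact: A0|rewrite exprn_ge0// invr_ge0].
    by apply: mulr_ge0; [exact: ltW|exact: A20].
  have hb s : `|F s (cs k.+1 s) - F s (cs k s)| <= K * (A * 2^-1 ^+ k) * expR (L * `|s|).
    by rewrite (le_trans (FK _ _ _))// -mulrA ler_wpM2l// ltW.
  have := exp_mvi L0 B0 hd hb t; rewrite !fctE !cs0 subrr subr0 => h.
  apply: (le_trans h).
  rewrite ler_wpM2r// le_eqVlt; apply/orP; left; apply/eqP.
  rewrite exprSr /L; field; exact: lt0r_neq0.
have bnd2 k j t : `|cs (k + j)%N t - cs k t| <= 2 * A * 2^-1 ^+ k * (1 - 2^-1 ^+ j) * E t.
  elim: j => [|j IH]; first by rewrite addn0 subrr normr0 expr0 subrr mulr0 mul0r.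
  rewrite -(subrK (cs (k + j)%N t) (cs _ _)) -addrA addnS.
  rewrite (le_trans (ler_normD _ _))// (le_trans (lerD (bnd _ _) IH))//.
  rewrite -mulrDl ler_wpM2r// le_eqVlt; apply/orP; left; apply/eqP.
  by rewrite exprD exprSr; field.
have bnd3 k m t : (k <= m)%N -> `|cs m t - cs k t| <= 2 * A * 2^-1 ^+ k * E t.
  move=> km; rewrite -(subnKC km) (le_trans (bnd2 _ _ _))// ler_wpM2r//.
  have k0 : 0 <= 2 * A * 2^-1 ^+ k.
    by apply: mulr_ge0; [exact: mulr_ge0|rewrite exprn_ge0// invr_ge0].
  by rewrite ler_piMr// gerBl exprn_ge0// invr_ge0.
have half01 : (0 : R) <= (2^-1 : R) < 1.
  by apply/andP; split; lra.
have small t e : 0 < e -> exists N, forall k, (N <= k)%N -> 2 * A * 2^-1 ^+ k * E t < e.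
  move=> e0; have [N hN] := geometric_small (2 * A * E t) half01 e0.
  by exists N => k /hN; rewrite mulrAC.
have cvgt t : cvg (cs ^~ t @ \oo).
  apply/cauchy_cvgP; apply: cauchy_exP => e e0.
  have [N hN] := small t e e0; exists (cs N t).
  exists N => // m /= Nm; rewrite -ball_normE/= distrC.
  exact: le_lt_trans (bnd3 _ _ _ Nm) (hN _ (leqnn N)).
pose c t := lim (cs ^~ t @ \oo).
have cE k t : `|c t - cs k t| <= 2 * A * 2^-1 ^+ k * E t.
  apply/ler_addgt0Pl => e e0.
  have /cvgrPdist_lt /(_ _ e0)[N _ hN] := cvgt t.
  pose m := maxn N k.
  rewrite -(subrK (cs m t) (c t)) -addrA (le_trans (ler_normD _ _))// lerD//.
    by apply/ltW/hN => /=; exact: leq_maxl.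
  by apply: bnd3; exact: leq_maxr.
have ccont : continuous c.
  move=> t; apply/cvgrPdist_lt => e e0.
  have e30 : 0 < e / 3 by rewrite divr_gt0.
  have [N /(_ _ (leqnn N)) hN] := small (`|t| + 1) _ e30.
  have /cvgrPdist_lt /(_ _ e30) h := cc N t.
  have hball : \forall s \near t, `|t - s| < 1.
    by move: (@cvg_id _ (nbhs t)) => /cvgrPdist_lt; apply.
  near=> s.
  have hs : `|s| <= `|t| + 1.
    have -> : s = t - (t - s) by rewrite opprB addrC subrK.
    rewrite (le_trans (ler_normB _ _))// lerD//.
  have ES (u : R) : `|u| <= `|t| + 1 -> `|c u - cs N u| < e / 3.
    move=> hu; apply: le_lt_trans hN; apply: (le_trans (cE _ _)).
    rewrite ler_wpM2l//.
      by apply: mulr_ge0; [exact: mulr_ge0|rewrite exprn_ge0// invr_ge0].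
    by rewrite /E ler_expR ler_pM2l// (ger0_norm (addr_ge0 _ _)).
  have -> : c t - c s = (c t - cs N t) + ((cs N t - cs N s) - (c s - cs N s)).
    by apply/rowP => i; rewrite !mxE; ring.
  rewrite (le_lt_trans (ler_normD _ _))//.
  rewrite (le_lt_trans (lerD (lexx _) (ler_normB _ _)))//.
  have h1 : `|c t - cs N t| < e / 3 by apply: ES; rewrite lerDl.
  have h2 := ES _ hs.
  have h3 : `|cs N t - cs N s| < e / 3 by near: s.
  lra.
(* The limit is a fixed point of the Picard operator, hence a solution. *)
have [d0 dd] := hS _ ccont.
have dN k t : `|S c t - cs k.+1 t| <= A * 2^-1 ^+ k * E t.
  have hd (s : R) : is_derive s 1 (S c - cs k.+1) (F s (c s) - F s (cs k s)).
    by have h1 := dd s; have h2 := csd k s; apply: is_derive_eq.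
  have B0 : 0 <= K * (2 * A * 2^-1 ^+ k).
    have A20 j : 0 <= A * 2^-1 ^+ j.
      by apply: mulr_ge0; [exact: A0|rewrite exprn_ge0// invr_ge0].
    by rewrite -mulrA; apply: mulr_ge0; [exact: ltW|exact: mulr_ge0].
  have hb s : `|F s (c s) - F s (cs k s)| <= K * (2 * A * 2^-1 ^+ k) * expR (L * `|s|).
    by rewrite (le_trans (FK _ _ _))// -mulrA ler_wpM2l ?cE// ltW.
  have := exp_mvi L0 B0 hd hb t; rewrite !fctE d0 !cs0 subrr subr0 => h.
  apply: (le_trans h).
  rewrite ler_wpM2r// le_eqVlt; apply/orP; left; apply/eqP.
  rewrite /L; field; exact: lt0r_neq0.
have Sc : S c = c.
  apply/funext => t; apply/eqP; rewrite -subr_eq0 -normr_le0.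
  apply/ler_addgt0Pl => e e0; rewrite addr0.
  have [N /(_ _ (leqnn N)) hN] := small t _ e0.
  rewrite -(subrK (cs N.+1 t) (S c t)) -addrA (le_trans (ler_normD _ _))//.
  rewrite [X in _ + X]distrC (le_trans (lerD (dN _ _) (cE _ _)))//.
  apply/ltW/(le_lt_trans _ hN); rewrite -mulrDl ler_wpM2r//.
  rewrite le_eqVlt; apply/orP; left; apply/eqP.
  by rewrite exprSr; field.
by exists c; split => [|t]; rewrite -Sc// {2}Sc.
Unshelve. all: by end_near. Qed.

End Derivatives.

(** * Differentials on R^4 and the radial retraction onto the sphere *)

Section Calculus.
Variable R : realType.
Local Notation V := 'rV[R]_4.

Lemma cvg_mx (T : Type) (F : set_system T) (m n : nat) (M : T -> 'M[R]_(m, n)) (l : 'M[R]_(m, n)) :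
  Filter F -> (forall i j, (fun t => M t i j) @ F --> (l i j : R)) -> M @ F --> l.
Proof.
move=> FF h; apply/cvgrPdist_le => e e0.
have hh : \forall t \near F, forall ij : 'I_m * 'I_n, `|l ij.1 ij.2 - M t ij.1 ij.2| <= e.
  by apply: filter_forall => -[i j] /=; have /cvgrPdist_le := h i j; apply.
apply: filterS hh => t ht; apply: norm_mx_le => [|i j]; first exact: ltW.
by rewrite !mxE; exact: ht (i, j).
Qed.

Lemma continuous_mx (T : topologicalType) (m n : nat) (M : T -> 'M[R]_(m, n)) x :
  (forall i j, {for x, continuous (fun t => M t i j)}) -> {for x, continuous M}.
Proof. by move=> h; apply: cvg_mx => i j; exact: h. Qed.

Lemma continuous_entry (T : topologicalType) (m n : nat) (M : T -> 'M[R]_(m, n)) x i j :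
  {for x, continuous M} -> {for x, continuous (fun t => M t i j)}.
Proof.
move=> h; apply: (@continuous_comp _ _ _ M (fun N : 'M[R]_(m, n) => N i j)) => //.
exact: coord_continuous.
Qed.

(** With [diff_intro], differentiability as an estimate on increments: for the
    flow, such an estimate is what a Gronwall argument provides. *)
Lemma diff_elim (f : V -> V) (x : V) : differentiable f x -> forall e, 0 < e ->
  exists2 d, 0 < d & forall y, `|y - x| < d ->
    `|f y - f x - (y - x) *m 'J f x| <= e * `|y - x|.
Proof.
move=> df e e0.
have /diff_locallyP[_ /eqaddoP /(_ e e0)] := df.
move=> /nbhs_ballP[d /= d0 h]; exists d => // y yx.
have := h (y - x); rewrite -ball_normE /ball_/= sub0r normrN => /(_ yx).
rewrite !fctE /= subrK /jacobian mul_rV_lin1 opprD addrA.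
by rewrite /cst.
Qed.

Lemma diff_intro_lin (V' W' : normedModType R) (f : V' -> W') (x : V')
    (L : {linear V' -> W'}) :
  continuous L ->
  (forall e, 0 < e -> exists2 d, 0 < d & forall y, `|y - x| < d ->
    `|f y - f x - L (y - x)| <= e * `|y - x|) ->
  differentiable f x /\ 'd f x = L :> (V' -> W').
Proof.
move=> c h.
have o : f \o shift x = cst (f x) + L +o_ 0 id.
  apply/eqaddoP => e e0; have [d d0 hd] := h e e0.
  apply/nbhs_ballP; exists d => //= k; rewrite -ball_normE /ball_/= sub0r normrN => kd.
  rewrite !fctE /= opprD addrA.
  by have := hd (k + x); rewrite addrK => /(_ kd).
have e : 'd f x = L :> (V' -> W') by exact: diff_unique.
by split=> //; apply/diff_locallyP; rewrite e.
Qed.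

Lemma diff_intro (f : V -> V) (x : V) (A : 'M[R]_4) :
  (forall e, 0 < e -> exists2 d, 0 < d & forall y, `|y - x| < d ->
    `|f y - f x - (y - x) *m A| <= e * `|y - x|) ->
  differentiable f x /\ 'J f x = A.
Proof.
move=> h.
have c : continuous (mulmxr A : V -> V).
  have := @linear_bounded_continuous R V V (mulmxr A); move=> [hc _].
  apply: hc; apply/linear_boundedP; near=> r => u.
  have hr : 4 * `|A| <= r by near: r; exact: nbhs_pinfty_ge.
  by rewrite /= (le_trans (norm_mulmx _ _))// mulrAC ler_wpM2r.
have [d e] := @diff_intro_lin V V f x (mulmxr A) c h.
split=> //.
by apply/row_matrixP => i; rewrite !rowE /jacobian mul_rV_lin1 e.
Unshelve. all: by end_near. Qed.

Lemma derive_comp_jacobian (f : V -> V) (c : R -> V) (dc : V) (t : R) :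
  differentiable f (c t) -> is_derive t 1 c dc ->
  is_derive t 1 (f \o c) (dc *m 'J f (c t)).
Proof.
move=> df hc.
have dc1 : differentiable c t by apply/derivable1_diffP; exact: ex_derive.
have d : differentiable (f \o c) t by apply: differentiable_comp.
apply: DeriveDef; first by apply/derivable1_diffP.
rewrite deriveE// diff_comp//= /jacobian mul_rV_lin1.
by rewrite -[in 'd c t 1]deriveE// derive_val.
Qed.

(** Only the first point lies in [K]: the chord between two points of the
    sphere leaves the sphere. *)
Lemma heine (W : normedModType R) (K : set V) (h : V -> W) :
  compact K -> (forall x, K x -> {for x, continuous h}) ->
  forall e, 0 < e -> exists2 d, 0 < d &
    forall z y, K z -> `|y - z| < d -> `|h y - h z| < e.
Proof.
move=> cK ch e e0.
have /compact_near_coveringP/(_ R (0 : R)^'+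
  (fun d z => forall y, `|y - z| < d -> `|h y - h z| < e)) cov := cK.
have {}cov := cov _ _.
have [|d [d0 hd]] := filter_ex (filterI (nbhs_right_gt (0 : R)) (cov _ _)).
  move=> x Kx.
  have e20 : 0 < e / 2 by rewrite divr_gt0.
  have /cvgrPdist_lt /(_ _ e20) /nbhs_ballP[r /= r0 hr] := ch x Kx.
  have hr' y : `|y - x| < r -> `|h y - h x| < e / 2.
    by move=> yx; rewrite distrC; apply: hr; rewrite -ball_normE /ball_/= distrC.
  have r20 : 0 < r / 2 by rewrite divr_gt0.
  near=> x' d => y yx'.
  have x'x : `|x' - x| < r / 2.
    by near: x'; have /cvgrPdist_lt/(_ _ r20) := @cvg_id _ (nbhs x);
      apply: filterS => z; rewrite distrC.
  have dr : d < r / 2 by near: d; exact: nbhs_right_lt.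
  have h1 : `|h y - h x| < e / 2.
    apply: hr'; have -> : y - x = (y - x') + (x' - x) by rewrite addrA subrK.
    by rewrite (le_lt_trans (ler_normD _ _))// [ltRHS]splitr ltrD// (lt_trans yx').
  have h2 : `|h x' - h x| < e / 2.
    by apply: hr'; apply: lt_trans x'x _; rewrite ltr_pdivrMr// ltr_pMr// ltr1n.
  have -> : h y - h x' = (h y - h x) - (h x' - h x) by rewrite opprB addrA subrK.
  by rewrite (le_lt_trans (ler_normB _ _))// [ltRHS]splitr ltrD.
exists d => // z y Kz; exact: hd.
Unshelve. all: by end_near. Qed.

Lemma differentiable_rV (f : V -> V) x :
  (forall i, differentiable (fun y => f y 0 i : R) x) -> differentiable f x.
Proof.
move=> h.
have -> : f = \sum_(i < 4) (fun y => f y 0 i *: (delta_mx 0 i : V)).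
  apply/funext => y; rewrite fct_sumE {1}[f y]row_sum_delta//.
by apply: differentiable_sum => i; exact: differentiableZl.
Qed.

Lemma is_derive_comp_scalar (h : R -> R) (q : V -> R) (dh : R) (y v : V) :
  is_derive (q y) 1 h dh -> differentiable q y ->
  is_derive y v (h \o q) (dh * 'D_v q y).
Proof.
move=> hh dq.
have dh1 : differentiable h (q y) by apply/derivable1_diffP; exact: ex_derive.
have d : differentiable (h \o q) y by apply: differentiable_comp.
apply: DeriveDef; first exact: diff_derivable.
rewrite deriveE// diff_comp//=.
have -> : 'd q y v = ('D_v q y) *: (1 : R) by rewrite deriveE// /GRing.scale/= mulr1.
by rewrite linearZ/= -[in 'd h _ 1]deriveE// derive_val mulrC.
Qed.

Lemma is_derive_coord (y v : V) i : is_derive y v (fun x : V => x 0 i) (v 0 i).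
Proof.
have d := differentiable_coord y 0 i.
apply: DeriveDef; first exact: diff_derivable.
have @f : {linear V -> R}.
  by exists (fun N : 'M[R]_(_, _) => N 0 i); do 2![eexists]; do ?[constructor];
     rewrite ?mxE// => ? *; rewrite ?mxE//; move=> ?; rewrite !mxE.
rewrite deriveE// (_ : (fun _ => _) = f) // diff_lin//.
exact: coord_continuous.
Qed.

Lemma is_derive_rV (f : V -> V) (y v df : V) :
  (forall i, is_derive y v (fun x => f x 0 i) (df 0 i)) -> is_derive y v f df.
Proof.
move=> h.
have d : derivable f y v.
  by apply/derivable_mxP => i j; rewrite ord1; have := h j => ?; exact: ex_derive.
apply: DeriveDef => //; rewrite derive_mx//; apply/rowP => i.
by rewrite mxE; have := h i => ?; rewrite derive_val.
Qed.

Definition sqd (x : V) : R := dot x x.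

Lemma sqdE : sqd = \sum_(i < 4) ((fun x : V => x 0 i) * (fun x : V => x 0 i)).
Proof. by apply/funext => x; rewrite /sqd dotE fct_sumE. Qed.

Lemma differentiable_sqd x : differentiable sqd x.
Proof.
rewrite sqdE; apply: differentiable_sum => i.
by apply: differentiableM; exact: differentiable_coord.
Qed.

Lemma derive_sqd x v : 'D_v sqd x = 2 * dot x v.
Proof.
rewrite sqdE; have h := is_derive_coord x v.
rewrite derive_val dotE mulr_sumr; apply: eq_bigr => i _.
by rewrite /GRing.scale/= mulrDl mul1r.
Qed.

(** The scalar factor of [normalize]. *)
Definition rho (x : V) : R := (Num.sqrt (dot x x))^-1.

Lemma sqd_gt0 (x : V) : x != 0 -> 0 < Num.sqrt (dot x x).
Proof. by move=> x0; rewrite sqrtr_gt0 dot_gt0. Qed.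

Lemma rho_gt0 (x : V) : x != 0 -> 0 < rho x.
Proof. by move=> x0; rewrite invr_gt0 sqd_gt0. Qed.

Lemma rho_sqr (x : V) : x != 0 -> rho x ^+ 2 * dot x x = 1.
Proof.
move=> x0; rewrite /rho exprVn sqr_sqrtr ?dot_ge0// mulVf//.
by rewrite dot_eq0.
Qed.

Lemma is_derive_rho x v : x != 0 -> is_derive x v rho (- (rho x ^+ 3 * dot x v)).
Proof.
move=> x0; have s0 := sqd_gt0 x0.
have q0 : 0 < dot x x by rewrite dot_gt0.
pose h (r : R) := (Num.sqrt r)^-1.
have hh : is_derive (sqd x) 1 h (- (Num.sqrt (dot x x)) ^- 2 * (2 * Num.sqrt (dot x x))^-1).
  have h1 : is_derive (sqd x) 1 Num.sqrt (2 * Num.sqrt (sqd x))^-1 by exact: is_derive1_sqrt.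
  rewrite /h; apply: is_derive_eq.
    by apply: is_deriveV; rewrite gt_eqF.
  by rewrite /GRing.scale/= mulNr.
have := is_derive_comp_scalar v hh (differentiable_sqd x).
rewrite derive_sqd; congr is_derive.
by rewrite /rho; field; rewrite gt_eqF.
Qed.

Lemma differentiable_rho x : x != 0 -> differentiable rho x.
Proof.
move=> x0; have s0 := sqd_gt0 x0.
apply: differentiableV => //; last by rewrite gt_eqF.
apply: differentiable_comp; first exact: differentiable_sqd.
apply/derivable1_diffP; have q0 : 0 < sqd x by rewrite /sqd dot_gt0.
have := is_derive1_sqrt q0 => ?; exact: ex_derive.
Qed.

Lemma normalizeE (x : V) : normalize x = rho x *: x. Proof. by []. Qed.

Lemma normalize_sphere (x : V) : x != 0 -> sphere3 (normalize x).
Proof.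
by move=> x0; rewrite /sphere3/= normalizeE !dotlin mulrA -expr2 rho_sqr.
Qed.

Lemma sphere_neq0 (x : V) : sphere3 x -> x != 0.
Proof. by move=> hx; rewrite -dot_eq0 hx oner_eq0. Qed.

Lemma rho_sphere (x : V) : sphere3 x -> rho x = 1.
Proof. by rewrite /rho => ->; rewrite sqrtr1 invr1. Qed.

Lemma normalize_id (x : V) : sphere3 x -> normalize x = x.
Proof. by move=> hx; rewrite normalizeE rho_sphere// scale1r. Qed.

Lemma differentiable_normalize x : x != 0 -> differentiable (@normalize R) x.
Proof.
move=> x0; apply: differentiable_rV => i.
have -> : (fun y => normalize y 0 i) = rho * (fun y : V => y 0 i).
  by apply/funext => y; rewrite normalizeE mxE.
apply: differentiableM; first exact: differentiable_rho.
exact: differentiable_coord.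
Qed.

Lemma is_derive_normalize x v : x != 0 -> is_derive x v (@normalize R)
  (rho x *: v - (rho x ^+ 3 * dot x v) *: x).
Proof.
move=> x0; apply: is_derive_rV => i.
have -> : (fun y => normalize y 0 i) = rho * (fun y : V => y 0 i).
  by apply/funext => y; rewrite normalizeE mxE.
have h1 := is_derive_rho v x0; have h2 := is_derive_coord x v i.
apply: is_derive_eq; rewrite !mxE /GRing.scale/=; ring.
Qed.

Lemma continuous_rho x : x != 0 -> {for x, continuous rho}.
Proof. by move=> x0; apply: differentiable_continuous; exact: differentiable_rho. Qed.

Lemma continuous_dot (T : topologicalType) (f g : T -> V) x :
  {for x, continuous f} -> {for x, continuous g} ->
  {for x, continuous (fun y => dot (f y) (g y))}.
Proof.
move=> cf cg.
have -> : (fun y => dot (f y) (g y)) = (fun y => f y 0 0 * g y 0 0 +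
   (f y 0 1 * g y 0 1 + (f y 0 2 * g y 0 2 + f y 0 3 * g y 0 3))).
  apply/funext => y; rewrite dotE !big_ord_recl big_ord0 addr0.
  by do !congr (_ + _); congr (_ * _); congr (_ _ _); apply: val_inj.
by do ![apply: cvgD]; apply: cvgM; apply: continuous_entry.
Qed.

Lemma sphere_compact : compact (@sphere3 R).
Proof.
apply: bounded_closed_compact.
  exists 1; split => // M M1 x hx; apply: le_trans (ltW M1).
  rewrite -(@ler_pXn2r _ 2)// ?nnegrE// expr1n.
  by rewrite (le_trans (dot_norm _))// hx.
have -> : @sphere3 R = (fun x => dot x x) @^-1` [set 1] by [].
apply: closed_comp; last exact: closed_eq.
by move=> x _; apply: continuous_dot.
Qed.

Lemma compact_gt0_lb (T : topologicalType) (K : set T) (f : T -> R) : compact K ->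
  (forall x, {for x, continuous f}) -> (forall x, K x -> 0 < f x) ->
  exists2 k, 0 < k & forall x, K x -> k <= f x.
Proof.
move=> cK cf f0; have [[x0 Kx0]|K0] := pselect (K !=set0).
  have [|c cK' h] := @compact_EVT_min T R f K (ex_intro _ x0 Kx0) cK.
    by apply: continuous_subspaceT => x; exact: cf.
  exists (f c); first by apply: f0; rewrite inE in cK'.
  by move=> x Kx; apply: h; rewrite inE.
by exists 1 => // x Kx; exfalso; apply: K0; exists x.
Qed.

Lemma compact_ub (T : topologicalType) (K : set T) (f : T -> R) : compact K ->
  {within K, continuous f} -> exists2 k, 0 < k & forall x, K x -> f x <= k.
Proof.
move=> cK cf; have [[x0 Kx0]|K0] := pselect (K !=set0).
  have [c cK' h] := @compact_EVT_max T R f K (ex_intro _ x0 Kx0) cK cf.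
  exists (`|f c| + 1); first by rewrite ltr_wpDl.
  move=> x Kx; rewrite (le_trans (h x _)) ?inE//.
  by rewrite (le_trans (ler_norm _))// lerDl.
by exists 1 => // x Kx; exfalso; apply: K0; exists x.
Qed.

End Calculus.

(** * Estimates on curves *)

Section Norm.
Variable R : realType.
Local Notation V := 'rV[R]_4.

(** The Euclidean norm; [`|x|] is the supremum norm. *)
Definition nrm (x : V) : R := Num.sqrt (dot x x).

Lemma nrm_ge0 x : 0 <= nrm x. Proof. exact: sqrtr_ge0. Qed.

Lemma nrm_sqr x : nrm x ^+ 2 = dot x x. Proof. by rewrite sqr_sqrtr ?dot_ge0. Qed.

Lemma norm_le_nrm x : `|x| <= nrm x.
Proof. by rewrite -(@ler_pXn2r _ 2)// ?nnegrE ?nrm_ge0// nrm_sqr dot_norm. Qed.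

Lemma nrm_le_norm x : nrm x <= 2 * `|x|.
Proof.
rewrite -(@ler_pXn2r _ 2)// ?nnegrE ?nrm_ge0 ?mulr_ge0// nrm_sqr exprMn.
by rewrite (le_trans (dot_le_norm _))// -natrX.
Qed.

Lemma nrm_triangle x y : nrm (x + y) <= nrm x + nrm y.
Proof.
rewrite -(@ler_pXn2r _ 2)// ?nnegrE ?nrm_ge0 ?addr_ge0 ?nrm_ge0// sqrrD !nrm_sqr.
have h : dot x y <= nrm x * nrm y.
  rewrite (le_trans (ler_norm _))// -(@ler_pXn2r _ 2)// ?nnegrE ?mulr_ge0 ?nrm_ge0//.
  by rewrite exprMn !nrm_sqr real_normK ?num_real// dot_CS.
by rewrite !dotlin (dotC y x) -mulr_natl; lra.
Qed.

Lemma nrmB_le x y : `|nrm x - nrm y| <= nrm (x - y).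
Proof.
have h u v : nrm u - nrm v <= nrm (u - v).
  by rewrite lerBlDr -{1}(subrK v u) nrm_triangle.
have hs u v : nrm (u - v) = nrm (v - u).
  by rewrite /nrm -opprB dotNl dotNr opprK.
by rewrite ler_norml h lerNl opprB hs h.
Qed.

Lemma nrm_gt0 x : x != 0 -> 0 < nrm x.
Proof. exact: sqd_gt0. Qed.

Lemma sphere_norm_ge x : sphere3 x -> 2^-1 <= `|x| :> R.
Proof.
move=> hx; have := nrm_le_norm x.
by rewrite /nrm hx sqrtr1 => h; lra.
Qed.

Lemma sphere_norm_le x : sphere3 x -> `|x| <= 1 :> R.
Proof. by move=> hx; have := norm_le_nrm x; rewrite /nrm hx sqrtr1. Qed.

Lemma gronwall2 (e de : R -> R) (L t : R) :
  (forall s : R, is_derive s 1 e (de s)) ->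
  (forall s, `|s| <= `|t| -> `|de s| <= L * e s) -> e t <= e 0 * expR (L * `|t|).
Proof.
move=> he h; have [t0|t0] := leP 0 t.
  rewrite (ger0_norm t0); apply: (gronwall t0 he) => s /andP[s0 st].
  by rewrite (le_trans (ler_norm _))// h// !ger0_norm.
have t0' : 0 <= - t by rewrite oppr_ge0 ltW.
have := @gronwall R (fun s => e (- s)) (fun s => - de (- s)) L (- t) t0'.
rewrite !opprK oppr0 (ltr0_norm t0); apply=> [s|s /andP[s0 st]].
  exact: is_derive_reflect.
rewrite (le_trans (ler_norm _))// normrN h// normrN (ltr0_norm t0).
by rewrite ger0_norm.
Qed.

Lemma continuous_near_eq (T : topologicalType) (W : topologicalType) (g h : T -> W) x :
  {for x, continuous h} -> (\forall y \near x, g y = h y) -> {for x, continuous g}.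
Proof.
move=> ch e; rewrite /prop_for /continuous_at (nbhs_singleton e).
by apply: cvg_trans ch; apply: near_eq_cvg; apply: filterS e => y ->.
Qed.

Lemma is_derive_subf (W : normedModType R) (u v : R -> W) (du dv : W) (s : R) :
  is_derive s 1 u du -> is_derive s 1 v dv ->
  is_derive s 1 (fun r => u r - v r) (du - dv).
Proof. by move=> hu hv; apply: is_deriveB. Qed.

Lemma is_derive_addf (W : normedModType R) (u v : R -> W) (du dv : W) (s : R) :
  is_derive s 1 u du -> is_derive s 1 v dv ->
  is_derive s 1 (fun r => u r + v r) (du + dv).
Proof. by move=> hu hv; apply: is_deriveD. Qed.

Lemma is_derive_mulf (u v : R -> R) (du dv : R) (s : R) :
  is_derive s 1 u du -> is_derive s 1 v dv ->
  is_derive s 1 (fun r => u r * v r) (du * v s + u s * dv).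
Proof.
move=> hu hv.
have h : is_derive s 1 (u * v) (u s *: dv + v s *: du) by apply: is_deriveM.
by apply: is_derive_eq; rewrite /GRing.scale/= addrC (mulrC (v s)).
Qed.

Lemma is_derive_affine (a b s : R) : is_derive s 1 (fun r : R => a + r * b) b.
Proof.
have h : is_derive s 1 ( *%R b) b.
  have -> : *%R b = b *: (id : R -> R) by [].
  by apply: is_derive_eq; rewrite /GRing.scale/= mulr1.
have -> : (fun r : R => a + r * b) = cst a + *%R b.
  by apply/funext => r; rewrite !fctE mulrC.
by apply: is_derive_eq; rewrite add0r.
Qed.

End Norm.

(** * Vector fields on the sphere *)

Section Field.
Variables (R : realType).
Local Notation V := 'rV[R]_4.
Variable Y : V -> V.
Hypothesis hY : vector_field Y.
Local Notation f := (Y \o @normalize R).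
Local Notation D := (sphere_diff Y).

Lemma field_tangent x : sphere3 x -> dot (Y x) x = 0.
Proof. by move=> /(hY.1); rewrite tangentE => /eqP. Qed.

Lemma field_diff x : x != 0 -> differentiable f x.
Proof. by have [_ [h _]] := hY; exact: h. Qed.

Lemma near_neq0 (x : V) : x != 0 -> \forall y \near x, y != 0.
Proof.
move=> x0; have x0' : 0 < `|x| by rewrite normr_gt0.
have /cvgrPdist_lt /(_ _ x0') := @cvg_id _ (nbhs x).
by apply: filterS => y; apply: contraTN => /eqP ->; rewrite subr0 ltxx.
Qed.

(** The entries of the differential are the directional derivatives that
    [sphere_Ck 1] makes continuous. *)
Lemma sphere_diff_cont x : x != 0 -> {for x, continuous D}.
Proof.
move=> x0; apply: continuous_mx => i j.
have [_ [_ /(_ (delta_mx 0 i)) /(_ x x0) h]] := hY.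
have c : {for x, continuous (fun y => ('D_(delta_mx 0 i) f y) 0 j : R)}.
  exact: continuous_entry.
have e y : y != 0 -> D y i j = 'D_(delta_mx 0 i) f y 0 j.
  by move=> y0; rewrite deriveE ?mxE//; exact: field_diff.
apply: (continuous_near_eq c); apply: filterS (near_neq0 x0) => y y0.
exact: e.
Qed.

Lemma field_curve (c : R -> V) (dc : V) (t : R) : c t != 0 ->
  is_derive t 1 c dc -> is_derive t 1 (f \o c) (dc *m D (c t)).
Proof. by move=> c0; apply: derive_comp_jacobian; exact: field_diff. Qed.

Lemma is_derive_segment (x v : V) (s : R) : is_derive s 1 (fun r : R => x + r *: v) v.
Proof.
apply/is_derive_mx => i j; rewrite ord1.
have -> : (fun r : R => (x + r *: v) 0 j) = (fun r : R => x 0 j + r * v 0 j).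
  by apply/funext => r; rewrite !mxE.
exact: is_derive_affine.
Qed.

Lemma near_sphere_neq0 (z y : V) : sphere3 z -> `|y - z| < 2^-1 -> y != 0.
Proof.
move=> hz h; apply: contraTneq h => ->; rewrite sub0r normrN -leNgt.
exact: sphere_norm_ge.
Qed.

Lemma normalize_scale (a : R) (x : V) : 0 < a -> sphere3 x -> normalize (a *: x) = x.
Proof.
move=> a0 hx; rewrite /normalize !dotlin hx mulr1 -expr2 sqrtr_sqr gtr0_norm//.
by rewrite scalerA mulVf ?scale1r// gt_eqF.
Qed.

(** [Y \o normalize] is constant on rays. *)
Lemma sphere_diff_radial x : sphere3 x -> x *m D x = 0.
Proof.
move=> hx.
have h1 : is_derive (0 : R) 1 (fun r : R => x + r *: x) x by exact: is_derive_segment.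
have x0 : x + (0 : R) *: x != 0 by rewrite scale0r addr0 sphere_neq0.
have h2 := field_curve x0 h1.
rewrite scale0r addr0 in h2.
have h3 : is_derive (0 : R) 1 (f \o (fun r : R => x + r *: x)) 0.
  apply: (@locally_eq_derive _ _ (cst (Y x)) _ _ _ 1) => //.
  move=> s; rewrite subr0 => hs /=.
  rewrite -{2}[x]scale1r -scalerDl normalize_scale//.
  by move: hs; rewrite ltr_norml => /andP[]; lra.
have <- := @derive_val _ _ _ _ _ _ _ h2.
by rewrite derive_val.
Qed.

(** The derivative at [z], in the direction [u], of the scalar product of
    [Y \o normalize] with [normalize], which vanishes identically. *)
Lemma sphere_diff_tangency (u z : V) : sphere3 z ->
  dot (u *m D z) z + dot (Y z) u = 0.
Proof.
move=> hz.
have h1 : is_derive (0 : R) 1 (fun r : R => z + r *: u) u by exact: is_derive_segment.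
have z0 : z + (0 : R) *: u != 0 by rewrite scale0r addr0 sphere_neq0.
have hf := field_curve z0 h1.
have hn : is_derive (0 : R) 1 (@normalize R \o (fun r : R => z + r *: u))
    (u *m 'J (@normalize R) z).
  have := @derive_comp_jacobian _ (@normalize R) (fun r : R => z + r *: u) u 0.
  rewrite scale0r addr0; apply => //.
  by apply: differentiable_normalize; exact: sphere_neq0.
have hj : u *m 'J (@normalize R) z = u - dot z u *: z.
  rewrite -deriveEjacobian; last by apply: differentiable_normalize; exact: sphere_neq0.
  have := is_derive_normalize u (sphere_neq0 hz) => h; rewrite derive_val.
  by rewrite rho_sphere// expr1n mul1r scale1r.
rewrite hj in hn.
have hd := is_derive_dot hf hn.
rewrite /= scale0r addr0 normalize_id// in hd.
have h0 : is_derive (0 : R) 1 (fun s : R =>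
    dot ((f \o (fun r : R => z + r *: u)) s)
    ((@normalize R \o (fun r : R => z + r *: u)) s)) 0.
  pose e := 2^-1 / (`|u| + 1) : R.
  have u1 : 0 < `|u| + 1 by rewrite ltr_wpDl.
  have e0 : 0 < e by rewrite divr_gt0.
  apply: (@locally_eq_derive _ _ (cst 0) _ _ _ e) => //.
  move=> s; rewrite subr0 => hs /=.
  rewrite field_tangent//; apply: normalize_sphere; apply: (near_sphere_neq0 hz).
  rewrite addrC addKr normrZ.
  apply: (@le_lt_trans _ _ (`|s| * (`|u| + 1))); first by rewrite ler_wpM2l// lerDl.
  by rewrite -ltr_pdivlMr.
have := @derive_val _ _ _ _ _ _ _ hd; rewrite derive_val.
rewrite dotDr dotNr dotZr field_tangent// mulr0 subr0.
by move=> <-.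
Qed.

Lemma field_bounded : exists2 B : R, 0 < B & forall z, sphere3 z -> `|Y z| <= B /\ `|D z| <= B.
Proof.
have c1 : {within @sphere3 R, continuous (fun z => `|f z|)}.
  apply: continuous_in_subspaceT => z; rewrite inE => hz.
  apply: (@continuous_comp _ _ _ f Num.norm); last exact: norm_continuous.
  by apply: differentiable_continuous; apply: field_diff; exact: sphere_neq0.
have c2 : {within @sphere3 R, continuous (fun z => `|D z|)}.
  apply: continuous_in_subspaceT => z; rewrite inE => hz.
  apply: (@continuous_comp _ _ _ D Num.norm); last exact: norm_continuous.
  by apply: sphere_diff_cont; exact: sphere_neq0.
have [B1 B10 h1] := compact_ub (@sphere_compact R) c1.
have [B2 B20 h2] := compact_ub (@sphere_compact R) c2.
exists (B1 + B2) => [|z hz]; first by rewrite addr_gt0.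
have := h1 z hz; have := h2 z hz; rewrite /= normalize_id//; lra.
Qed.

(** The mean value theorem on the chord from [z] to [w], where the
    differential is close to its value at [z] by uniform continuity. *)
Lemma field_unif_diff (e : R) : 0 < e -> exists2 d, 0 < d & forall z w, sphere3 z ->
  sphere3 w -> `|w - z| < d -> `|Y w - Y z - (w - z) *m D z| <= e * `|w - z|.
Proof.
move=> e0; have e40 : 0 < e / 4 by rewrite divr_gt0.
have [d d0 hd] := heine (@sphere_compact R)
  (fun x hx => sphere_diff_cont (sphere_neq0 hx)) e40.
exists (Num.min d 2^-1) => [|z w hz hw]; first by rewrite lt_min d0 invr_gt0/=.
rewrite lt_min => /andP[wzd wz2].
pose c (r : R) : V := z + r *: (w - z).
have cz (r : R) : 0 <= r <= 1 -> `|c r - z| <= `|w - z|.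
  move=> /andP[r0 r1]; rewrite /c addrC addKr normrZ ger0_norm//.
  by rewrite ler_piMl.
have c0 (r : R) : 0 <= r <= 1 -> c r != 0.
  by move=> /cz h; apply: (near_sphere_neq0 hz); exact: le_lt_trans h _.
have hc (r : R) : 0 <= r <= 1 -> is_derive r 1 (f \o c) ((w - z) *m D (c r)).
  by move=> hr; apply: field_curve; [exact: c0|exact: is_derive_segment].
apply: norm_mx_le => [|i j]; first by rewrite mulr_ge0// ltW.
rewrite ord1.
pose q := ((w - z) *m D z) 0 j.
pose phi (s : R) : R := (f \o c) s 0 j - (0 + s * q).
have hj (r : R) : 0 <= r <= 1 -> is_derive r 1 phi (((w - z) *m D (c r)) 0 j - q).
  move=> hr; have /is_derive_mx /(_ 0 j) h := hc r hr.
  have h2 := is_derive_affine 0 q r.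
  exact: (is_derive_subf h h2).
have [||r] := @MVT_segment _ phi (fun r => ((w - z) *m D (c r)) 0 j - q) 0 1 ler01.
- by move=> r; rewrite in_itv/= => /andP[/ltW r0 /ltW r1]; apply: hj; rewrite r0.
- apply: derivable_within_continuous => r; rewrite in_itv/= => hr.
  by have := hj r hr => ?; exact: ex_derive.
rewrite in_itv/= => hr; rewrite /phi /= /c scale0r scale1r addr0 mul0r mul1r !add0r !subr0.
rewrite [z + _]addrC subrK !normalize_id// mulr1 => E.
have -> : (Y w - Y z - (w - z) *m D z) 0 j =
    ((w - z) *m (D (z + r *: (w - z)) - D z)) 0 j.
  have e1 : (Y w - Y z - (w - z) *m D z) 0 j = Y w 0 j - q - Y z 0 j.
    by rewrite /q; move: (_ *m _) => u; rewrite !mxE; ring.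
  by rewrite e1 E mulmxBr /q [in RHS]mxE; congr (_ + _); rewrite [in RHS]mxE.
rewrite (le_trans (norm_coord _ _ _))// (le_trans (norm_mulmx _ _))//.
have hb : `|D (c r) - D z| < e / 4 by apply: hd => //; exact: le_lt_trans (cz r hr) wzd.
have := ler_wpM2l (normr_ge0 (w - z)) (ltW hb).
rewrite /c; lra.
Qed.

(** Nearby points are covered by [field_unif_diff], the others by the
    boundedness of [Y]. *)
Lemma field_lipschitz : exists2 K : R, 0 < K & forall z w, sphere3 z -> sphere3 w ->
  `|Y w - Y z| <= K * `|w - z|.
Proof.
have [B B0 hB] := field_bounded.
have [d d0 hd] := field_unif_diff ltr01.
exists (1 + 4 * B + 2 * B / d) => [|z w hz hw].
  by rewrite !addr_gt0 ?divr_gt0 ?mulr_gt0.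
have p : 0 <= 2 * B / d by rewrite divr_ge0 ?mulr_ge0 ?ltW.
have [wzd|dwz] := ltP `|w - z| d.
  have -> : Y w - Y z = (Y w - Y z - (w - z) *m D z) + (w - z) *m D z by rewrite subrK.
  rewrite (le_trans (ler_normD _ _))// (le_trans (lerD (hd _ _ hz hw wzd) (norm_mulmx _ _)))//.
  have := ler_wpM2l (normr_ge0 (w - z)) (hB z hz).2.
  have := mulr_ge0 p (normr_ge0 (w - z)); lra.
rewrite (le_trans (ler_normB _ _))//.
have h : 2 * B <= 2 * B / d * `|w - z|.
  have := ler_wpM2l p dwz.
  by rewrite divfK// gt_eqF.
have := (hB w hw).1; have := (hB z hz).1.
have : 0 <= (1 + 4 * B) * `|w - z| by rewrite mulr_ge0// addr_ge0// mulr_ge0// ltW.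
lra.
Qed.

End Field.

(** * The flow of a vector field and its differential *)

Lemma sub_split (W : zmodType) (a b c : W) : a - c = (a - b) + (b - c).
Proof. by rewrite addrA subrK. Qed.

Lemma sqr_le (K : realDomainType) (a b : K) : 0 <= a -> a <= b -> a ^+ 2 <= b ^+ 2.
Proof. by move=> a0 ab; rewrite lerXn2r// nnegrE (le_trans a0). Qed.

Section Flow.
Variables (R : realType).
Local Notation V := 'rV[R]_4.
Variable Y : V -> V.
Hypothesis hY : vector_field Y.
Local Notation D := (sphere_diff Y).

(** The cutoff is 1 on the sphere, and 0 at the origin so that [ext_field] is
    continuous there. *)
Definition cutoff (x : V) : R := Num.min (nrm x) 1.

(** A globally Lipschitz extension of [Y] to R^4, tangent to every sphere
    centred at the origin. *)
Definition ext_field (x : V) : V := cutoff x *: Y (normalize x).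

Lemma cutoff_ge0 x : 0 <= cutoff x.
Proof. by rewrite /cutoff le_min nrm_ge0 ler01. Qed.

Lemma cutoff_lip x y : `|cutoff x - cutoff y| <= `|nrm x - nrm y|.
Proof.
rewrite /cutoff; case: (leP (nrm x) 1) => hx; case: (leP (nrm y) 1) => hy//.
- by rewrite !ler0_norm ?subr_le0//; lra.
- by rewrite !ger0_norm ?subr_ge0//; lra.
- by rewrite subrr normr0.
Qed.

Lemma normalize_nrm x : nrm x *: normalize x = x :> V.
Proof.
have [->|x0] := eqVneq x 0; first by rewrite /normalize !scaler0.
by rewrite /normalize scalerA mulfV ?scale1r// gt_eqF// nrm_gt0.
Qed.

Lemma ext_field_lip : exists2 K : R, 0 < K &
  forall x y, `|ext_field x - ext_field y| <= K * `|x - y|.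
Proof.
have [B B0 hB] := field_bounded hY.
have [K K0 hK] := field_lipschitz hY.
exists (3 * K + 2 * B) => [|x y]; first by rewrite addr_gt0// mulr_gt0.
have bnd u : u != 0 -> `|ext_field u| <= 2 * B * `|u|.
  move=> u0; rewrite /ext_field normrZ (ger0_norm (cutoff_ge0 u)).
  have h1 : cutoff u <= 2 * `|u|.
    by rewrite (le_trans _ (nrm_le_norm u))// /cutoff ge_min lexx.
  have h2 := (hB _ (normalize_sphere u0)).1.
  by have := ler_pM (cutoff_ge0 u) (normr_ge0 _) h1 h2; lra.
have e0 : ext_field 0 = 0.
  by rewrite /ext_field /cutoff /nrm dot0l sqrtr0 min_l// scale0r.
have K30 : 0 <= 3 * K by rewrite mulr_ge0// ltW.
have [->|x0] := eqVneq x 0.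
  have [->|y0] := eqVneq y 0; first by rewrite subrr normr0 mulr_ge0// addr_ge0// mulr_ge0// ltW.
  rewrite e0 !sub0r !normrN (le_trans (bnd _ y0))// ler_wpM2r//; lra.
have [->|y0] := eqVneq y 0.
  rewrite e0 !subr0 (le_trans (bnd _ x0))// ler_wpM2r//; lra.
have key u v : u != 0 -> v != 0 -> nrm u <= nrm v ->
    `|ext_field u - ext_field v| <= (3 * K + 2 * B) * `|u - v|.
  move=> u0 v0 uv.
  have -> : ext_field u - ext_field v = cutoff u *: (Y (normalize u) - Y (normalize v))
      + (cutoff u - cutoff v) *: Y (normalize v).
    by rewrite /ext_field scalerBr scalerBl addrA subrK.
  rewrite (le_trans (ler_normD _ _))// !normrZ mulrDl lerD//.
    rewrite (ger0_norm (cutoff_ge0 u)).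
    have h1 := hK _ _ (normalize_sphere v0) (normalize_sphere u0).
    have h2 : nrm u * `|normalize u - normalize v| <= 3 * `|u - v|.
      rewrite -{1}(ger0_norm (nrm_ge0 u)) -normrZ scalerBr normalize_nrm.
      have -> : u - nrm u *: normalize v = (u - v) + (nrm v - nrm u) *: normalize v.
        by rewrite scalerBl normalize_nrm addrA subrK.
      rewrite (le_trans (ler_normD _ _))// normrZ.
      have a1 : `|nrm v - nrm u| <= 2 * `|u - v|.
        by rewrite distrC (le_trans (nrmB_le _ _))// nrm_le_norm.
      have a2 := sphere_norm_le (normalize_sphere v0).
      have := ler_pM (normr_ge0 _) (normr_ge0 _) a1 a2; lra.
    have cu : cutoff u <= nrm u by rewrite /cutoff ge_min lexx.
    have h3 := ler_pM (cutoff_ge0 u) (normr_ge0 _) cu h1.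
    have := ler_wpM2l (ltW K0) h2; lra.
  have h1 := (hB _ (normalize_sphere v0)).1.
  have h2 : `|cutoff u - cutoff v| <= 2 * `|u - v|.
    by rewrite (le_trans (cutoff_lip _ _))// (le_trans (nrmB_le _ _))// nrm_le_norm.
  have := ler_pM (normr_ge0 _) (normr_ge0 _) h2 h1; lra.
have [xy|/ltW yx] := leP (nrm x) (nrm y); first exact: key.
by rewrite distrC [`|x - y|]distrC; apply: key.
Qed.

(** The norm is constant along the integral curves of [ext_field], so those
    that start on the sphere remain there and are integral curves of [Y]. *)
Lemma integral_curve_ex x : sphere3 x -> exists c, integral_curve Y x c.
Proof.
move=> hx; have [K K0 hK] := ext_field_lip.
have ce : continuous ext_field.
  move=> y; apply/(@cvgrPdist_lt _ _ _ (nbhs y)) => e e0.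
  have /cvgrPdist_lt /(_ (e / K)) := @cvg_id _ (nbhs y).
  rewrite divr_gt0// => /(_ isT); apply: filterS => z hz.
  by rewrite (le_lt_trans (hK _ _))// mulrC -ltr_pdivlMr.
have [c [c0 hc]] := @picard R 4 (fun _ => ext_field) K `|ext_field x| x K0
  (normr_ge0 _) (fun c cc => fun t => continuous_comp (cc t) (ce _))
  (fun _ => hK) (fun _ => lexx _).
have hz y : dot y (ext_field y) = 0.
  have [->|y0] := eqVneq y 0; first by rewrite dot0l.
  rewrite /ext_field dotZr.
  have -> : dot y (Y (normalize y)) = dot (nrm y *: normalize y) (Y (normalize y)).
    by rewrite normalize_nrm.
  rewrite dotZl dotC (field_tangent hY) ?mulr0//; exact: normalize_sphere.
have hd (s : R) : is_derive s 1 (fun t => dot (c t) (c t)) 0.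
  have := is_derive_dot (hc s) (hc s).
  by rewrite dotC !hz addr0.
have hs t : sphere3 (c t).
  rewrite /sphere3/=.
  have [t0|t0] := leP 0 t.
    have := @const_derive0 _ (fun t => dot (c t) (c t)) 0 t t0 (fun s _ => hd s).
    by rewrite /= c0 => <-.
  have := @const_derive0 _ (fun t => dot (c t) (c t)) t 0 (ltW t0) (fun s _ => hd s).
  by rewrite /= c0 => ->.
exists c; split => // t.
have := hc t; rewrite /ext_field normalize_id// /cutoff /nrm hs sqrtr1.
by rewrite min_l// scale1r.
Qed.

(** Gronwall for the squared distance of two integral curves. *)
Lemma curve_dist : exists2 L, 0 < L & forall (c d : R -> V) x y,
  integral_curve Y x c -> integral_curve Y y d -> forall t, dot (c t - d t) (c t - d t) <= dot (x - y) (x - y) * expR (L * `|t|).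
Proof.
have [K K0 hK] := field_lipschitz hY.
exists (1 + 4 * K ^+ 2) => [|c d x y [c0 cS hc] [d0 dS hd] t]; first by rewrite addr_gt0// mulr_gt0// exprn_gt0.
rewrite -c0 -d0.
apply: (@gronwall2 R (fun s => dot (c s - d s) (c s - d s))
  (fun s => dot (Y (c s) - Y (d s)) (c s - d s) + dot (c s - d s) (Y (c s) - Y (d s)))).
  by move=> s; apply: is_derive_dot; exact: is_derive_subf.
move=> s _; set u := c s - d s; set v := Y _ - Y _.
have -> : dot v u + dot u v = 2 * dot u v by rewrite (dotC v); ring.
rewrite normrM gtr0_norm// (le_trans (dot_young_abs _ _))// mulrDl mul1r lerD2l.
rewrite (le_trans (dot_le_norm _))// -mulrA ler_wpM2l//.
rewrite (@le_trans _ _ ((K * `|u|) ^+ 2))//.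
  by rewrite lerXn2r ?nnegrE ?mulr_ge0 ?(ltW K0)//; exact: hK.
by rewrite exprMn ler_wpM2l ?sqr_ge0// dot_norm.
Qed.

Lemma integral_curve_unique c d x : integral_curve Y x c -> integral_curve Y x d -> c = d.
Proof.
move=> hc hd; have [L _ hL] := curve_dist.
apply/funext => t; apply/eqP; rewrite -subr_eq0 -dot_eq0 eq_le dot_ge0 andbT.
by rewrite (le_trans (hL _ _ _ _ hc hd t))// subrr dot0l mul0r.
Qed.

Lemma flow_curve x : sphere3 x -> integral_curve Y x (fun t => flow Y t x).
Proof.
move=> /integral_curve_ex[c hc].
exact: (@xgetPex _ (fun=> x) _ (ex_intro _ c hc)).
Qed.

Lemma flow_unique c x : integral_curve Y x c -> forall t, flow Y t x = c t.
Proof.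
move=> hc t; have hx : sphere3 x by have [<- h _] := hc; exact: h.
by rewrite -(integral_curve_unique (flow_curve hx) hc).
Qed.

Lemma flow0 x : sphere3 x -> flow Y 0 x = x.
Proof. by move=> /flow_curve[]. Qed.

Lemma flow_sphere t x : sphere3 x -> sphere3 (flow Y t x).
Proof. by move=> /flow_curve[_ h _]; exact: h. Qed.

Lemma flow_derive t x : sphere3 x -> is_derive (t : R) 1 (fun s => flow Y s x) (Y (flow Y t x)).
Proof. by move=> /flow_curve[_ _ h]; exact: h. Qed.

Lemma flow_cont x : sphere3 x -> continuous (fun s => flow Y s x).
Proof. by move=> hx; apply: is_derive_cont => t; exact: flow_derive. Qed.

Lemma flowD s t x : sphere3 x -> flow Y (s + t) x = flow Y s (flow Y t x).
Proof.
move=> hx; apply/esym/(@flow_unique (fun s => flow Y (s + t) x)); split.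
- by rewrite add0r.
- by move=> r; exact: flow_sphere.
- by move=> r; apply: (@is_derive_shiftr _ _ (fun s => flow Y s x)); exact: flow_derive.
Qed.

Lemma flowNK t x : sphere3 x -> flow Y (- t) (flow Y t x) = x.
Proof. by move=> hx; rewrite -flowD// addNr flow0. Qed.

(** The variational equation of [Y] along the curve [c]. *)
Definition variation (c : R -> V) (w : R -> V) :=
  forall t : R, is_derive t 1 w (w t *m D (c t)).

Lemma variation_ex x v : sphere3 x ->
  exists w, w 0 = v /\ variation (fun t => flow Y t x) w.
Proof.
move=> hx; have [B B0 hB] := field_bounded hY.
pose c t := flow Y t x.
have hBt t : `|D (c t)| <= B by exact: (hB _ (flow_sphere t hx)).2.
have Dc : continuous (fun t => D (c t)).
  move=> t; apply: (@continuous_comp _ _ _ c D); first exact: flow_cont.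
  by apply: (sphere_diff_cont hY); apply: sphere_neq0; exact: flow_sphere.
have B40 : 0 < 4 * B by rewrite mulr_gt0.
have M0 : 0 <= 4 * `|v| * B by rewrite !mulr_ge0// ltW.
apply: (@picard R 4 (fun t w => w *m D (c t)) (4 * B) (4 * `|v| * B) v B40 M0).
- move=> w cw t; apply: continuous_mx => i j.
  have -> : (fun s => (w s *m D (c s)) i j) =
      (fun s => dot (w s) (\row_k D (c s) k j)).
    apply/funext => s; rewrite dotE mxE ord1; apply: eq_bigr => k _.
    by rewrite mxE.
  apply: continuous_dot; first exact: cw.
  apply: continuous_mx => i' k.
  have -> : (fun s => (\row_k0 D (c s) k0 j) i' k) = (fun s => D (c s) k j).
    by apply/funext => s; rewrite mxE.
  by apply: continuous_entry; exact: Dc.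
- move=> t u w; rewrite -mulmxBl (le_trans (norm_mulmx _ _))// mulrAC.
  by rewrite ler_wpM2r// ler_wpM2l.
- by move=> t; rewrite (le_trans (norm_mulmx _ _))// ler_wpM2l// mulr_ge0.
Qed.

(** The second inequality is the first one for the time-reversed curve that
    starts at [flow Y t x]. *)
Lemma variation_growth : exists2 L, 0 < L & forall x w, sphere3 x ->
  variation (fun t => flow Y t x) w -> forall t,
  dot (w t) (w t) <= dot (w 0) (w 0) * expR (L * `|t|) /\
  dot (w 0) (w 0) <= dot (w t) (w t) * expR (L * `|t|).
Proof.
have [B B0 hB] := field_bounded hY.
exists (1 + 16 * B ^+ 2) => [|x w hx hw]; first by rewrite addr_gt0// mulr_gt0// exprn_gt0.
have hd (s : R) := is_derive_dot (hw s) (hw s).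
have bd s : `|dot (w s *m D (flow Y s x)) (w s) + dot (w s) (w s *m D (flow Y s x))|
    <= (1 + 16 * B ^+ 2) * dot (w s) (w s).
  set v := _ *m _.
  have -> : dot v (w s) + dot (w s) v = 2 * dot (w s) v by rewrite (dotC v); ring.
  rewrite normrM gtr0_norm// (le_trans (dot_young_abs _ _))// mulrDl mul1r lerD2l.
  rewrite (le_trans (dot_mulmx _ _))// ler_wpM2r ?dot_ge0// ler_wpM2l//.
  by rewrite lerXn2r ?nnegrE ?(ltW B0)//; exact: (hB _ (flow_sphere s hx)).2.
move=> t; split; first exact: (gronwall2 hd (fun s _ => bd s)).
have hd2 (s : R) : is_derive s 1 (fun r => dot (w (t - r)) (w (t - r)))
   (- (dot (w (t - s) *m D (flow Y (t - s) x)) (w (t - s)) +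
    dot (w (t - s)) (w (t - s) *m D (flow Y (t - s) x)))).
  rewrite -scaleN1r.
  apply: (@is_derive_chain _ _ (fun r => dot (w r) (w r)) (fun r => t - r)) => //.
  have -> : (fun r => t - r) = (fun r : R => t + r * -1).
    by apply/funext => r; rewrite mulrN1.
  exact: is_derive_affine.
have := @gronwall2 _ _ _ (1 + 16 * B ^+ 2) t hd2.
rewrite subrr subr0; apply => s _.
by rewrite normrN; exact: bd.
Qed.

Lemma variation_unique x w w' : sphere3 x -> variation (fun t => flow Y t x) w ->
  variation (fun t => flow Y t x) w' -> w 0 = w' 0 -> w = w'.
Proof.
move=> hx hw hw' e0; have [L L0 hL] := variation_growth.
have h : variation (fun t => flow Y t x) (fun t => w t - w' t).
  by move=> t; rewrite mulmxBl; exact: is_derive_subf.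
apply/funext => t; apply/eqP; rewrite -subr_eq0 -dot_eq0 eq_le dot_ge0 andbT.
have [+ _] := hL _ _ hx h t.
by rewrite e0 subrr dot0l mul0r.
Qed.

(** By [sphere_diff_tangency] the derivative of this scalar product is 0. *)
Lemma variation_tangent x w : sphere3 x -> variation (fun t => flow Y t x) w ->
  forall t, dot (w t) (flow Y t x) = dot (w 0) x.
Proof.
move=> hx hw.
have hd (s : R) : is_derive s 1 (fun t => dot (w t) (flow Y t x)) 0.
  have := is_derive_dot (hw s) (flow_derive s hx).
  by rewrite [dot (w s) _]dotC (sphere_diff_tangency hY)//; exact: flow_sphere.
move=> t; have [t0|t0] := leP 0 t.
  have := @const_derive0 _ (fun t => dot (w t) (flow Y t x)) 0 t t0 (fun s _ => hd s).
  by rewrite /= flow0.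
have := @const_derive0 _ (fun t => dot (w t) (flow Y t x)) t 0 (ltW t0) (fun s _ => hd s).
by rewrite /= flow0.
Qed.

Lemma variation_field x : sphere3 x -> variation (fun t => flow Y t x)
  (fun t => Y (flow Y t x)).
Proof.
move=> hx t.
have h := field_curve hY (sphere_neq0 (flow_sphere t hx)) (flow_derive t hx).
suff -> : (fun t => Y (flow Y t x)) = (Y \o @normalize R) \o (fun t => flow Y t x) by [].
by apply/funext => s /=; rewrite normalize_id//; exact: flow_sphere.
Qed.

(** The difference of two orbits satisfies the variational equation up to a
    remainder controlled by [field_unif_diff], so it stays close to a solution
    of that equation. The constant [E] depends only on [t]. *)
Lemma flow_approx (t : R) : exists2 E, 0 < E & forall x, sphere3 x -> forall e, 0 < e ->
  exists2 d, 0 < d & forall z w, sphere3 z -> `|z - x| < d ->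
  variation (fun s => flow Y s x) w ->
  dot (flow Y t z - flow Y t x - w t) (flow Y t z - flow Y t x - w t) <=
  (dot (z - x - w 0) (z - x - w 0) + e * dot (z - x) (z - x)) * E.
Proof.
have [B B0 hB] := field_bounded hY.
have [L2 L20 hL2] := curve_dist.
pose L := 2 + 16 * B ^+ 2.
have L1 : 1 <= L by rewrite /L; have := sqr_ge0 B; lra.
pose E2 := expR (L2 * `|t|).
have E20 : 0 < E2 by exact: expR_gt0.
exists (expR (L * `|t|)) => [|x hx e e0]; first exact: expR_gt0.
(* By [curve_dist] the squared distance of the orbits of z and x is at most E2
   dot (z - x) (z - x); this e1 makes the square of the remainder at most e
   times dot (z - x) (z - x). *)
pose e1 := Num.min 1 (e / (4 * E2)).
have e10 : 0 < e1 by rewrite lt_min ltr01/= divr_gt0// mulr_gt0.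
have he1 : 4 * e1 ^+ 2 * E2 <= e.
  have h1 : e1 <= 1 by rewrite ge_min lexx.
  have h2 : e1 * (4 * E2) <= e by rewrite -ler_pdivlMr ?mulr_gt0// ge_min lexx orbT.
  have h3 := ler_wpM2r (ltW e10) h1; have := ler_wpM2r (ltW E20) h3.
  by rewrite mul1r expr2; lra.
have [d1 d10 hd1] := field_unif_diff hY e10.
exists (d1 / (2 * (E2 + 1))) => [|z w hz zx hw].
  by rewrite divr_gt0// mulr_gt0// addr_gt0.
pose Del s := flow Y s z - flow Y s x.
have hDel s : `|s| <= `|t| -> dot (Del s) (Del s) <= dot (z - x) (z - x) * E2.
  move=> st; rewrite (le_trans (hL2 _ _ _ _ (flow_curve hz) (flow_curve hx) s))//.
  by rewrite ler_wpM2l ?dot_ge0// ler_expR ler_pM2l.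
have Deld s : `|s| <= `|t| -> `|Del s| < d1.
  move=> st; rewrite -(@ltr_pXn2r _ 2)// ?nnegrE ?normr_ge0 ?(ltW d10)//.
  rewrite (le_lt_trans (dot_norm _))// (le_lt_trans (hDel s st))//.
  have h1 := dot_le_norm (z - x).
  move: zx; rewrite ltr_pdivlMr ?mulr_gt0 ?addr_gt0// => zx.
  have h2 : (`|z - x| * (2 * (E2 + 1))) ^+ 2 < d1 ^+ 2.
    by rewrite ltr_pXn2r// nnegrE ?mulr_ge0// ?ltW// addr_gt0.
  apply: le_lt_trans h2; apply: (@le_trans _ _ (4 * `|z - x| ^+ 2 * E2)).
    by rewrite ler_wpM2r// ltW.
  have : 0 <= `|z - x| ^+ 2 * (E2 ^+ 2 + E2 + 1).
    by rewrite mulr_ge0 ?sqr_ge0// !addr_ge0 ?sqr_ge0// ltW.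
  rewrite exprMn; lra.
(* Adding the constant k to the squared error turns the inhomogeneous
   inequality into one to which Gronwall applies. *)
pose k := e * dot (z - x) (z - x).
have k0 : 0 <= k by rewrite mulr_ge0 ?dot_ge0// ltW.
pose g s := Del s - w s.
have hg (s : R) : is_derive s 1 g ((Y (flow Y s z) - Y (flow Y s x)) - w s *m D (flow Y s x)).
  by apply: is_derive_subf => //; apply: is_derive_subf; exact: flow_derive.
have hd (s : R) := is_derive_dot (hg s) (hg s).
have hdk (s : R) : is_derive s 1 (fun r => dot (g r) (g r) + k) _ :=
  is_derive_addf (hd s) (is_derive_cst k s 1).
have := @gronwall2 _ _ _ L t hdk.
rewrite /= /g /Del !flow0// => h.
rewrite (@le_trans _ _ (dot (Del t - w t) (Del t - w t) + k))//; first by rewrite lerDl.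
apply: h => s st; rewrite addr0.
rewrite -/(Del s) -/(g s).
have -> : Y (flow Y s z) - Y (flow Y s x) - w s *m D (flow Y s x) =
   (Y (flow Y s z) - Y (flow Y s x) - Del s *m D (flow Y s x)) + g s *m D (flow Y s x).
  have -> : g s *m D (flow Y s x) = Del s *m D (flow Y s x) - w s *m D (flow Y s x).
    exact: mulmxBl.
  exact: sub_split.
set rem := _ - Del s *m _; set gD := g s *m _.
have hrem : dot rem rem <= k.
  rewrite (le_trans (dot_le_norm _))//.
  have h1 := hd1 _ _ (flow_sphere s hx) (flow_sphere s hz) (Deld s st).
  have h2 : `|rem| ^+ 2 <= (e1 * `|Del s|) ^+ 2.
    exact: sqr_le.
  have h3 := le_trans (dot_norm (Del s)) (hDel s st).
  rewrite exprMn in h2.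
  have h4 := ler_wpM2l (sqr_ge0 e1) h3.
  have h5 := ler_wpM2r (dot_ge0 (z - x)) he1.
  rewrite /k; lra.
have hgD : dot gD gD <= 16 * B ^+ 2 * dot (g s) (g s).
  rewrite (le_trans (dot_mulmx _ _))// ler_wpM2r ?dot_ge0// ler_wpM2l//.
  by rewrite lerXn2r ?nnegrE ?(ltW B0)//; exact: (hB _ (flow_sphere s hx)).2.
have -> : dot (rem + gD) (g s) + dot (g s) (rem + gD) = 2 * dot (g s) rem + 2 * dot (g s) gD.
  by rewrite (dotDl rem gD) (dotDr (g s) rem gD) (dotC rem) (dotC gD); ring.
rewrite (le_trans (ler_normD _ _))// !normrM gtr0_norm//.
have h1 := dot_young_abs (g s) rem; have h2 := dot_young_abs (g s) gD.
have h3 := ler_wpM2r k0 L1.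
rewrite /L in h3 *; lra.
Qed.

(** The candidate for the differential sends [v] to the value at time t of the
    solution of the variational equation that starts at the tangential part of
    [v]; [flow_approx], composed with the differential of [normalize], shows
    that it is the differential. *)
Lemma variation_flow_diff x : sphere3 x -> forall t,
  differentiable (flow Y t \o @normalize R) x /\
  forall v w, variation (fun t => flow Y t x) w -> w 0 = v - dot v x *: x ->
    v *m flow_diff Y t x = w t.
Proof.
move=> hx t.
have [W hW] := choice (fun v => @variation_ex x (v - dot v x *: x) hx).
have Wlin a u v : W (a *: u + v) = (fun t => a *: W u t + W v t).
  apply: (variation_unique hx (hW _).2).
    move=> s; rewrite mulmxDl -scalemxAl; apply: is_derive_addf; last exact: (hW v).2.
    have h := (hW u).2 s.
    have -> : (fun r => a *: W u r) = a *: W u by [].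
    exact: is_deriveZ.
  by rewrite !(hW _).1 dotDl dotZl scalerDl scalerBr -scalerA opprD addrACA.
pose A : 'M[R]_4 := \matrix_i W (delta_mx 0 i) t.
have AE v : v *m A = W v t.
  have WZ a u : W (a *: u) t = a *: W u t.
    have W0 : W 0 t = 0.
      have := Wlin 1 0 0; rewrite scaler0 addr0 => /(congr1 (fun g => g t)) /=.
      by rewrite scale1r => /eqP; rewrite -subr_eq subrr eq_sym => /eqP.
    by rewrite -[a *: u]addr0 Wlin W0 addr0.
  have WD u v' : W (u + v') t = W u t + W v' t.
    by have := Wlin 1 u v'; rewrite scale1r => ->; rewrite scale1r.
  have W0 : W 0 t = 0 by have := WZ 0 0; rewrite !scale0r.
  rewrite mulmx_sum_row [in RHS](row_sum_delta v).
  rewrite (big_morph (fun u => W u t) WD W0).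
  by apply: eq_bigr => i _; rewrite rowK WZ.
suff [d e] : differentiable (flow Y t \o @normalize R) x /\
    'J (flow Y t \o @normalize R) x = A.
  split=> // v w hw w0; rewrite /flow_diff /sphere_diff e AE.
  by rewrite (variation_unique hx hw (hW v).2)// (hW v).1.
have [E E0 hE] := flow_approx t.
have dn := differentiable_normalize (sphere_neq0 hx).
have jn u : u *m 'J (@normalize R) x = u - dot u x *: x.
  rewrite -deriveEjacobian//.
  have := is_derive_normalize u (sphere_neq0 hx) => h; rewrite derive_val.
  by rewrite rho_sphere// expr1n mul1r scale1r dotC.
pose C := 4 * `|'J (@normalize R) x|.
have C0 : 0 <= C by rewrite mulr_ge0.
apply: diff_intro => e e0.
have e20 : 0 < e ^+ 2 by rewrite exprn_gt0.
pose e2 := Num.min 1 (e ^+ 2 / (8 * E)).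
have e2_gt0 : 0 < e2 by rewrite lt_min ltr01/= divr_gt0// mulr_gt0.
have he2 : 8 * e2 ^+ 2 * E <= e ^+ 2.
  have h1 : e2 <= 1 by rewrite ge_min lexx.
  have h2 : e2 * (8 * E) <= e ^+ 2 by rewrite -ler_pdivlMr ?mulr_gt0// ge_min lexx orbT.
  have h3 := ler_wpM2r (ltW e2_gt0) h1; have := ler_wpM2r (ltW E0) h3.
  by rewrite mul1r expr2; lra.
pose e3 := e ^+ 2 / (8 * (1 + C) ^+ 2 * E).
have C1 : 0 < (1 + C) ^+ 2 by rewrite exprn_gt0// ltr_wpDr.
have hp : 0 < 8 * (1 + C) ^+ 2 * E by apply: mulr_gt0 => //; exact: mulr_gt0.
have e30 : 0 < e3 by rewrite divr_gt0.
have he3 : e3 * (8 * (1 + C) ^+ 2 * E) = e ^+ 2.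
  by rewrite /e3 divfK// gt_eqF.
have [d1 d10 hd1] := hE x hx e3 e30.
have [d2 d20 hd2] := diff_elim dn e2_gt0.
exists (Num.min 2^-1 (Num.min d2 (d1 / (1 + C)))) => [|y].
  by rewrite !lt_min invr_gt0 ltr0n d20 divr_gt0// ltr_wpDr.
rewrite !lt_min => /and3P[y2 yd2]; rewrite ltr_pdivlMr ?ltr_wpDr// => yd1.
have y0 := near_sphere_neq0 hx y2.
have hz := normalize_sphere y0.
have hn := hd2 y yd2.
rewrite /= (normalize_id hx) in hn *.
set z := normalize y in hz hn *.
have zx : `|z - x| <= (1 + C) * `|y - x|.
  rewrite -(subrK ((y - x) *m 'J (@normalize R) x) (z - x)) (le_trans (ler_normD _ _))//.
  rewrite mulrDl mul1r lerD//.
    by rewrite (le_trans hn)// ler_piMl// ge_min lexx.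
  by rewrite (le_trans (norm_mulmx _ _))// mulrAC.
have [hw0 hw] := hW (y - x).
have := hd1 z _ hz _ hw; rewrite AE hw0 -jn => hh.
have {}hh := hh _.
rewrite -(@ler_pXn2r _ 2)// ?nnegrE ?mulr_ge0// ?(ltW e0)//.
rewrite (le_trans (dot_norm _))// (le_trans (hh _))//.
  by rewrite (le_lt_trans zx)// mulrC.
set a := z - x - _ in hn *.
have h1 : dot a a <= 4 * e2 ^+ 2 * `|y - x| ^+ 2.
  rewrite (le_trans (dot_le_norm _))// -mulrA ler_wpM2l// -exprMn.
  exact: sqr_le.
have h2 : dot (z - x) (z - x) <= 4 * (1 + C) ^+ 2 * `|y - x| ^+ 2.
  rewrite (le_trans (dot_le_norm _))// -mulrA ler_wpM2l// -exprMn.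
  exact: sqr_le.
have h3 := ler_wpM2l (ltW e30) h2.
have h4 := ler_wpM2r (ltW E0) h1; have h5 := ler_wpM2r (ltW E0) h3.
have h6 := ler_wpM2r (sqr_ge0 `|y - x|) he2.
have h7 := congr1 (fun r => r * `|y - x| ^+ 2) he3.
rewrite exprMn mulrDl; rewrite /= in h7; lra.
Qed.

(** On tangent vectors, [flow_diff] is the fundamental solution of the
    variational equation. *)
Lemma flow_diff_variation x v : sphere3 x -> dot v x = 0 ->
  variation (fun t => flow Y t x) (fun t => v *m flow_diff Y t x) /\ v *m flow_diff Y 0 x = v.
Proof.
move=> hx vx; have [w [w0 hw]] := variation_ex v hx.
have e : (fun t => v *m flow_diff Y t x) = w.
  apply/funext => t; have [_ h] := variation_flow_diff hx t.
  by apply: h => //; rewrite w0 vx scale0r subr0.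
by rewrite e; split => //; rewrite -{2}w0 -e.
Qed.

Lemma flow_diff_unique x w : sphere3 x -> dot (w 0) x = 0 ->
  variation (fun t => flow Y t x) w -> forall t, w 0 *m flow_diff Y t x = w t.
Proof.
move=> hx wx hw t; have [_ h] := variation_flow_diff hx t.
by apply: h => //; rewrite wx scale0r subr0.
Qed.

Lemma flow_diff_tangent x v t : sphere3 x -> dot v x = 0 ->
  dot (v *m flow_diff Y t x) (flow Y t x) = 0.
Proof.
move=> hx vx; have [hv v0] := flow_diff_variation hx vx.
by rewrite (variation_tangent hx hv) v0.
Qed.

Lemma flow_diffD x v s t : sphere3 x -> dot v x = 0 ->
  v *m flow_diff Y (s + t) x = v *m flow_diff Y t x *m flow_diff Y s (flow Y t x).
Proof.
move=> hx vx; have [hv v0] := flow_diff_variation hx vx.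
have hy := flow_sphere t hx.
pose w r := v *m flow_diff Y (r + t) x.
have w0 : w 0 = v *m flow_diff Y t x by rewrite /w add0r.
have hw : variation (fun r => flow Y r (flow Y t x)) w.
  move=> r; rewrite -(flowD r t hx) /w.
  exact: (@is_derive_shiftr _ _ (fun r => v *m flow_diff Y r x) _ r t (hv (r + t))).
have hw0 : dot (w 0) (flow Y t x) = 0 by rewrite w0; exact: flow_diff_tangent.
have h := flow_diff_unique hy hw0 hw s.
apply: (etrans _ (congr1 (fun u => u *m flow_diff Y s (flow Y t x)) w0)).
exact: esym h.
Qed.

(** Both sides solve the variational equation, by [variation_field]. *)
Lemma flow_diff_field x t : sphere3 x -> Y x *m flow_diff Y t x = Y (flow Y t x).
Proof.
move=> hx; have := @flow_diff_unique x (fun t => Y (flow Y t x)) hx.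
rewrite flow0//; apply; first by rewrite field_tangent.
exact: variation_field.
Qed.

Lemma flow_diffNK x v t : sphere3 x -> dot v x = 0 ->
  v *m flow_diff Y t x *m flow_diff Y (- t) (flow Y t x) = v.
Proof.
by move=> hx vx; rewrite -flow_diffD// addNr; have [] := flow_diff_variation hx vx.
Qed.

End Flow.

(** * Linear maps that increase a quadratic form *)

Section Linear.
Variable R : realType.
Local Notation V := 'rV[R]_4.
Implicit Types (u v w x : V) (B P W : 'M[R]_4).

(** A matrix of maximal rank among those whose rows lie in [S] spans [S]. *)
Lemma subspace_mx (S : V -> Prop) : S 0 ->
  (forall a u v, S u -> S v -> S (a *: u + v)) ->
  exists E : 'M[R]_4, forall v, (v <= E)%MS <-> S v.
Proof.
move=> S0 Slin.
pose Pr r := `[< exists E : 'M[R]_4, (forall v, (v <= E)%MS -> S v) /\ \rank E = r >].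
have ex : exists r, Pr r.
  exists 0%N; apply/asboolP; exists 0; split; last exact: mxrank0.
  by move=> v; rewrite submx0 => /eqP ->.
have ub r : Pr r -> (r <= 4)%N by move=> /asboolP[E [_ <-]]; exact: rank_leq_row.
case: (ex_maxnP ex ub) => r /asboolP[E [hE rE]] maxr.
exists E => v; split=> [/hE//|Sv].
have hEv u : (u <= E + v)%MS -> S u.
  move=> /sub_addsmxP[[a b] /= ->].
  rewrite addrC [b]mx11_scalar mul_scalar_mx; apply: Slin => //.
  by apply: hE; exact: submxMl.
have : (\rank (E + v)%MS <= r)%N by apply: maxr; apply/asboolP; exists (E + v)%MS.
rewrite -rE => h.
have := mxrank_leqif_sup (addsmxSl E v) => /geq_leqif; rewrite h => /esym.
by rewrite addsmx_sub => /andP[].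
Qed.

Lemma submx_lin m (W : 'M[R]_(m, 4)) a u v :
  (u <= W)%MS -> (v <= W)%MS -> ((a *: u + v)%R <= W)%MS.
Proof.
by rewrite !submxE => /eqP uW /eqP vW; rewrite mulmxDl -scalemxAl uW vW scaler0 addr0.
Qed.

Lemma continuous_subf (T : topologicalType) (K : numFieldType) (U : normedModType K)
    (f g : T -> U) (x : T) :
  {for x, continuous f} -> {for x, continuous g} ->
  {for x, continuous (fun y => f y - g y)}.
Proof. by move=> cf cg; apply: cvgB. Qed.

Lemma continuous_id_at (T : topologicalType) (x : T) : {for x, continuous (@id T)}.
Proof. exact: cvg_id. Qed.

Lemma continuous_cst_at (T U : topologicalType) (a : U) (x : T) :
  {for x, continuous (fun _ : T => a)}.
Proof. exact: cvg_cst. Qed.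

Lemma continuous_sub_cst (x : V) : continuous (fun v : V => v - x).
Proof.
by move=> y; apply: (@continuous_subf V _ _ id (cst x));
  [exact: continuous_id_at|exact: continuous_cst_at].
Qed.

Definition qf B v : R := dot (v *m B) v.
Definition bf B u v : R := dot (u *m B) v + dot (v *m B) u.

Lemma qfD B u v : qf B (u + v) = qf B u + bf B u v + qf B v.
Proof. by rewrite /qf /bf mulmxDl !dotlin; ring. Qed.

Lemma qfZ B a v : qf B (a *: v) = a ^+ 2 * qf B v.
Proof. by rewrite /qf -scalemxAl !dotlin; ring. Qed.

Lemma qfN B v : qf (- B) v = - qf B v.
Proof. by rewrite /qf mulmxN dotNl. Qed.

Lemma qf0 B : qf B 0 = 0.
Proof. by rewrite /qf dot0r. Qed.

Lemma bf_diag B v : bf B v v = 2 * qf B v.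
Proof. by rewrite /bf /qf; ring. Qed.

Lemma bfC B u v : bf B u v = bf B v u.
Proof. by rewrite /bf addrC. Qed.

Lemma dot_mulmxr u v (A : 'M[R]_4) : dot (u *m A) v = dot u (v *m A^T).
Proof. by rewrite /dot trmx_mul trmxK mulmxA. Qed.

Lemma bfE B u v : bf B u v = dot (u *m (B + B^T)) v.
Proof. by rewrite /bf mulmxDr dotDl [dot (v *m B) u]dotC [dot (u *m B^T) v]dot_mulmxr trmxK. Qed.

Lemma qf_bound B : exists2 b, 0 < b & forall v, `|qf B v| <= b * dot v v.
Proof.
exists (16 * `|B| ^+ 2 + 1) => [|v]; first by rewrite ltr_wpDl// mulr_ge0// exprn_ge0.
have := dot_young_abs (v *m B) v; have := dot_mulmx v B; rewrite /qf.
have : 0 <= `|B| ^+ 2 * dot v v by rewrite mulr_ge0 ?dot_ge0// sqr_ge0.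
have := dot_ge0 v; lra.
Qed.

Lemma continuous_mulmxr (m : nat) (A : 'M[R]_(4, m)) : continuous (fun v : V => v *m A).
Proof.
move=> x; apply: continuous_mx => i j.
have -> : (fun t : V => (t *m A) i j) = (fun t => dot t (\row_k A k j)).
  by apply/funext => y; rewrite dotE mxE ord1; apply: eq_bigr => k _; rewrite mxE.
apply: continuous_dot; [exact: continuous_id_at|exact: continuous_cst_at].
Qed.

Lemma continuous_qf B : continuous (qf B).
Proof.
move=> x; apply: (@continuous_dot _ _ (fun v : V => v *m B) id); last exact: cvg_id.
exact: continuous_mulmxr.
Qed.

Lemma continuous_qf_mul B P : continuous (fun v : V => qf B (v *m P)).
Proof.
move=> x; apply: (@continuous_comp _ _ _ (fun v : V => v *m P) (qf B)).
  exact: continuous_mulmxr.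
exact: continuous_qf.
Qed.

Lemma closed_submx W : closed [set v : V | (v <= W)%MS].
Proof.
have -> : [set v : V | (v <= W)%MS] = (fun v => dot (v *m cokermx W) (v *m cokermx W)) @^-1` [set 0].
  apply/seteqP; split => v /=; first by rewrite submxE => /eqP ->; rewrite dot0l.
  by move=> /eqP; rewrite dot_eq0 submxE.
apply: closed_comp; last exact: closed_eq.
move=> x _; apply: (@continuous_dot _ _ (fun v : V => v *m cokermx W) (fun v => v *m cokermx W));
  exact: continuous_mulmxr.
Qed.

(** By compactness the gain is bounded below on the unit vectors of [W]; by
    homogeneity this extends to all of [W]. *)
Lemma strict_growth W P B :
  (forall v, (v <= W)%MS -> v != 0 -> qf B v < qf B (v *m P)) ->
  exists2 k, 0 < k & forall v, (v <= W)%MS -> k * dot v v <= qf B (v *m P) - qf B v.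
Proof.
move=> h.
pose K := @sphere3 R `&` [set v : V | (v <= W)%MS].
have cK : compact K.
  rewrite /K setIC; apply: (subclosed_compact _ (@sphere_compact R)); last by move=> v [].
  apply: closedI; first exact: closed_submx.
  by apply: compact_closed; [exact: norm_hausdorff|exact: sphere_compact].
have [||k k0 hk] := @compact_gt0_lb R _ K (fun v => qf B (v *m P) - qf B v) cK.
- by move=> x; apply: continuous_subf; [exact: continuous_qf_mul|exact: continuous_qf].
- by move=> v [vS vW]; rewrite subr_gt0; apply: h => //; exact: sphere_neq0.
exists k => // v vW.
have [->|v0] := eqVneq v 0; first by rewrite mul0mx dot0l mulr0 subrr.
have := hk (normalize v); rewrite /K => /(_ _) /=.
have hK : sphere3 (normalize v) /\ (normalize v <= W)%MS.
  by split; [exact: normalize_sphere|rewrite scalemx_sub].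
move=> /(_ hK).
rewrite normalizeE -scalemxAl !qfZ -mulrBr => h1.
have q0 : 0 < dot v v by rewrite dot_gt0.
have := ler_wpM2r (ltW q0) h1.
by rewrite mulrAC rho_sqr// mul1r.
Qed.

Lemma sub_iter W P k v : (W *m P <= W)%MS -> (v <= W)%MS -> (v *m P ^+ k <= W)%MS.
Proof.
move=> WP; elim: k v => [|k IH] v vW; first by rewrite expr0 mulmx1.
rewrite exprS mulmxA; apply: IH.
exact: submx_trans (submxMr _ vW) WP.
Qed.

Lemma mx_iterK W P P' k v : (W *m P' <= W)%MS ->
  (forall v, (v <= W)%MS -> v *m P' *m P = v) -> (v <= W)%MS ->
  v *m P' ^+ k *m P ^+ k = v.
Proof.
move=> WP' h; elim: k v => [|k IH] v vW; first by rewrite !expr0 !mulmx1.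
rewrite exprSr exprS !mulmxA -[_ *m P' *m P]mulmxA.
rewrite [v *m _ *m (P' *m P)]mulmxA h ?IH//.
exact: sub_iter.
Qed.

Lemma mx_iterS (P : 'M[R]_4) v k : v *m P *m P ^+ k = v *m P ^+ k.+1.
Proof. by rewrite exprS mulmxA. Qed.

Lemma mx_iterSr (P : 'M[R]_4) v k : v *m P ^+ k *m P = v *m P ^+ k.+1.
Proof. by rewrite exprSr mulmxA. Qed.

Section Half.
Variables (W P P' B : 'M[R]_4).
Hypotheses (WP : (W *m P <= W)%MS) (WP' : (W *m P' <= W)%MS).
Hypothesis PK : forall v, (v <= W)%MS -> v *m P' *m P = v.
Hypothesis inc : forall v, (v <= W)%MS -> v != 0 -> qf B v < qf B (v *m P).
Variables (N M : 'M[R]_4).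
Hypotheses (NW : (N <= W)%MS) (MW : (M <= W)%MS) (NM : (W <= N + M)%MS).
Hypothesis NM0 : (N :&: M = 0)%MS.
Hypothesis qN : forall v, (v <= N)%MS -> qf B v <= 0.
Hypothesis qM : forall v, (v <= M)%MS -> 0 <= qf B v.

Lemma q_le_iter k v : (v <= W)%MS -> qf B v <= qf B (v *m P ^+ k).
Proof.
move=> vW; elim: k => [|k IH]; first by rewrite expr0 mulmx1.
rewrite exprSr mulmxA (le_trans IH)//.
have [->|v0] := eqVneq (v *m P ^+ k) 0; first by rewrite mul0mx.
by apply/ltW/inc => //; exact: sub_iter.
Qed.

Lemma q_ge_iter k v : (v <= W)%MS -> qf B (v *m P' ^+ k) <= qf B v.
Proof.
move=> vW; rewrite -[X in _ <= qf B X](mx_iterK k WP' PK vW).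
by apply: q_le_iter; exact: sub_iter.
Qed.

(** The vectors on which the form is nonpositive at all future iterates. Since
    the form increases, it is then negative along the whole orbit of a nonzero
    vector. They form a subspace on which [P] contracts, and its dimension is
    at least that of [N]. *)
Definition stable_set v := (v <= W)%MS /\ forall k, qf B (v *m P ^+ k) <= 0.

(** Along a stable orbit the form gains at each step a fixed multiple of the
    squared norm, hence of its own absolute value; staying nonpositive, it
    tends to 0 geometrically, and with it the squared norm, which is at most
    its absolute value divided by [k]. *)
Lemma stable_contract : exists K r : R, [/\ 0 < K, 0 < r < 1 &
  forall v, stable_set v -> (v != 0 -> qf B v < 0) /\
   forall k, dot (v *m P ^+ k) (v *m P ^+ k) <= K * r ^+ k * dot v v].
Proof.
have [b1 b10 hb1] := qf_bound B.
have [k k0 hk] := strict_growth inc.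
pose b := b1 + k.
have b0 : 0 < b by rewrite addr_gt0.
have kb : k / b < 1 by rewrite ltr_pdivrMr// mul1r ltrDr.
exists (b / k), (1 - k / b); split; first by rewrite divr_gt0.
  by rewrite subr_gt0 kb gtrBl divr_gt0.
move=> v [vW hv].
have s j : k * dot (v *m P ^+ j) (v *m P ^+ j) <= - qf B (v *m P ^+ j).
  have := hk _ (sub_iter j WP vW); rewrite mx_iterSr.
  by have := hv j.+1; lra.
have s2 j : - qf B (v *m P ^+ j.+1) <= (1 - k / b) * - qf B (v *m P ^+ j).
  have h1 := hk _ (sub_iter j WP vW); rewrite mx_iterSr in h1.
  have h2 : - qf B (v *m P ^+ j) <= b * dot (v *m P ^+ j) (v *m P ^+ j).
    have := hb1 (v *m P ^+ j); rewrite ler_norml => /andP[+ _].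
    have := mulr_ge0 (ltW k0) (dot_ge0 (v *m P ^+ j)); rewrite /b; lra.
  have h3 : k / b * - qf B (v *m P ^+ j) <= k * dot (v *m P ^+ j) (v *m P ^+ j).
    have := ler_wpM2l (ltW (divr_gt0 k0 b0)) h2.
    by rewrite mulrA divfK// gt_eqF.
  lra.
split=> [v0|j].
  have := s 0%N; rewrite expr0 mulmx1.
  have : 0 < k * dot v v by rewrite mulr_gt0// dot_gt0.
  lra.
have h : - qf B (v *m P ^+ j) <= (1 - k / b) ^+ j * (b * dot v v).
  elim: j => [|j IH].
    rewrite expr0 mul1r mulmx1; have := hb1 v; rewrite ler_norml => /andP[+ _].
    have := mulr_ge0 (ltW k0) (dot_ge0 v); rewrite /b; lra.
  rewrite (le_trans (s2 j))// [leRHS]mulrC exprS mulrC -[leRHS]mulrA ler_wpM2l//.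
  by rewrite subr_ge0 ltW.
rewrite -(@ler_pM2l _ k)//.
rewrite (le_trans (s j))// (le_trans h)//.
by rewrite le_eqVlt; apply/orP; left; apply/eqP; field; rewrite gt_eqF.
Qed.

(** For a combination of stable vectors the form increases along the iterates
    and tends to 0 by [stable_contract], so it is never positive. *)
Lemma stable_sub : exists E : 'M[R]_4, forall v, (v <= E)%MS <-> stable_set v.
Proof.
have [K [r [K0 r01 hc]]] := stable_contract.
have [b b0 hb] := qf_bound B.
apply: subspace_mx.
  by split=> [|k]; rewrite ?sub0mx// mul0mx qf0.
move=> a u v [uW hu] [vW hv].
have xW : ((a *: u + v)%R <= W)%MS by exact: submx_lin.
split=> [//|j]; rewrite leNgt; apply/negP => pos.
pose C := b * (2 * (a ^+ 2 * (K * dot u u) + K * dot v v)).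
have r01' : 0 <= r < 1 by case/andP: r01 => /ltW -> ->.
have [n hn] := geometric_small C r01' pos.
have := hn (n + j)%N (leq_addr _ _).
rewrite ltNge => /negP; apply.
apply: (le_trans (y := qf B ((a *: u + v) *m P ^+ (n + j)))).
  by rewrite addnC exprD mulmxA; apply: q_le_iter; exact: sub_iter.
rewrite (le_trans (ler_norm _))// (le_trans (hb _))// /C -mulrA ler_wpM2l ?(ltW b0)//.
rewrite mulmxDl -scalemxAl.
have [_ /(_ (n + j)%N) h1] := hc u (conj uW hu).
have [_ /(_ (n + j)%N) h2] := hc v (conj vW hv).
set x := u *m _ in h1 *; set y := v *m _ in h2 *.
have h3 := dot_ge0 (a *: x - y).
have h4 := ler_wpM2l (sqr_ge0 a) h1.
rewrite !dotlin (dotC y x) in h3 *; lra.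
Qed.

(** The image of [N] under [P' ^+ k.+1] projects onto [N] along [M]: otherwise
    a nonzero vector of [N] would be the image under [P ^+ k.+1] of a vector
    of [M], and the form would have passed from a nonnegative to a nonpositive
    value. The vectors of this image reach [N] after k + 1 steps, with a
    nonpositive form until then. *)
Lemma approx_stable k (n : V) : (n <= N)%MS -> exists z, [/\ (z <= W)%MS, (z - n <= M)%MS
  & forall j, (j <= k.+1)%N -> qf B (z *m P ^+ j) <= 0].
Proof.
move=> nN; pose f := P' ^+ k.+1 *m proj_mx N M.
have ker0 : (N :&: kermx f = 0)%MS.
  apply/eqP; rewrite -submx0; apply/rV_subP => u.
  rewrite sub_capmx sub_kermx => /andP[uN /eqP uf].
  have uW := submx_trans uN NW.
  have vW : (u *m P' ^+ k.+1 <= W)%MS by exact: sub_iter.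
  have vM : (u *m P' ^+ k.+1 <= M)%MS.
    rewrite -(add_proj_mx NM0 (submx_trans vW NM)).
    by rewrite -mulmxA -/f uf add0r proj_mx_sub.
  have [->|u0] := eqVneq u 0; first exact: sub0mx.
  have h1 := qM vM; have h2 := qN uN.
  have P'0 : u *m P' != 0.
    by apply: contraNneq u0 => e; rewrite -(PK uW) e mul0mx.
  have P'W : (u *m P' <= W)%MS by exact: submx_trans (submxMr _ uW) WP'.
  have h3 := inc P'W P'0; rewrite PK// in h3.
  have := q_ge_iter k P'W; rewrite mx_iterS => h4.
  by have := le_lt_trans (le_trans h1 h4) (lt_le_trans h3 h2); rewrite ltxx.
have rk : \rank (N *m f) = \rank N by rewrite -(mxrank_mul_ker N f) ker0 mxrank0 addn0.
have NfN : (N *m f <= N)%MS by rewrite /f mulmxA proj_mx_sub.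
have := mxrank_leqif_sup NfN => -[_]; rewrite rk eqxx => /esym NNf.
have /submxP[c ec] := submx_trans nN NNf.
pose v := c *m N.
have vN : (v <= N)%MS by exact: submxMl.
have vW := submx_trans vN NW.
have zW : (v *m P' ^+ k.+1 <= W)%MS by exact: sub_iter.
have en : n = v *m P' ^+ k.+1 *m proj_mx N M by rewrite ec /v /f !mulmxA.
exists (v *m P' ^+ k.+1); split => // [|j jk].
  have e := add_proj_mx NM0 (submx_trans zW NM).
  by rewrite -{1}e -en addrC addKr proj_mx_sub.
rewrite -(subnK jk) exprD mulmxA (mx_iterK j WP' PK); last exact: sub_iter.
by rewrite (le_trans (q_ge_iter _ vW))// qN.
Qed.

(** The vectors over [n] given by [approx_stable] remain bounded, because the
    form gains at the first step a multiple of the squared norm of their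
    component in [M] and is still nonpositive afterwards. A cluster point is
    stable. *)
Lemma stable_over (n : V) : (n <= N)%MS -> exists2 z, stable_set z & (z - n <= M)%MS.
Proof.
move=> nN.
have [z hz] := choice (fun k => @approx_stable k n nN).
have [k k0 hk] := strict_growth inc.
have [b b0 hb] := qf_bound B.
pose p := 16 * `|P| ^+ 2 + 1.
have p0 : 0 < p by rewrite ltr_wpDl// mulr_ge0// exprn_ge0.
(* dot x' is the linear part of the form at n *m P. *)
pose x' := (n *m P) *m (B + B^T).
pose C := 2 / k * (b * dot (n *m P) (n *m P) + p / (2 * k) * dot x' x').
have bnd i : dot (z i - n) (z i - n) <= C.
  have [zW sM hq] := hz i; set s := z i - n in sM *.
  have h1 := hq 1%N isT; rewrite expr1 in h1.
  have ez : z i = n + s by rewrite /s addrC subrK.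
  rewrite ez mulmxDl qfD bfE -/x' in h1.
  have h2 := hk s (submx_trans sM MW); have h3 := qM sM.
  have h4 : - (b * dot (n *m P) (n *m P)) <= qf B (n *m P).
    by have := hb (n *m P); rewrite ler_norml => /andP[].
  have h5 : dot (s *m P) (s *m P) <= p * dot s s.
    by have := dot_mulmx s P; have := dot_ge0 s; rewrite /p; lra.
  (* Young's inequality, weighted so that the term in s *m P is at most half
     of the gain k dot s s. *)
  have h6 : - dot x' (s *m P) <= p / (2 * k) * dot x' x' + k / (2 * p) * dot (s *m P) (s *m P).
    have := dot_ge0 (p *: x' + k *: (s *m P)); rewrite dot_expand => h7.
    have pk : 0 < 2 * p * k by rewrite !mulr_gt0.
    rewrite -(@ler_pM2l _ (2 * p * k))//.
    have -> : 2 * p * k * (p / (2 * k) * dot x' x' + k / (2 * p) * dot (s *m P) (s *m P)) =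
        p ^+ 2 * dot x' x' + k ^+ 2 * dot (s *m P) (s *m P).
      by field; rewrite !gt_eqF.
    lra.
  have h7 : k / (2 * p) * dot (s *m P) (s *m P) <= k / 2 * dot s s.
    have kp : 0 <= k / (2 * p) by rewrite ltW// divr_gt0// mulr_gt0.
    have := ler_wpM2l kp h5.
    have -> : k / (2 * p) * (p * dot s s) = k / 2 * dot s s by field; rewrite gt_eqF.
    by [].
  rewrite -(@ler_pM2l _ (k / 2)) ?divr_gt0// /C.
  have -> : k / 2 * (2 / k * (b * dot (n *m P) (n *m P) + p / (2 * k) * dot x' x')) =
     b * dot (n *m P) (n *m P) + p / (2 * k) * dot x' x' by field; rewrite gt_eqF.
  lra.
pose K := [set y : V | dot (y - n) (y - n) <= C].
have cK : compact K.
  apply: bounded_closed_compact.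
    exists (`|C| + 1 + `|n|); split; first exact: num_real.
    move=> r hr y hy; apply: le_trans (ltW hr).
    rewrite -(subrK n y) (le_trans (ler_normD _ _))// lerD2r.
    have h1 := dot_norm (y - n); have h2 : dot (y - n) (y - n) <= C by [].
    have h3 := ler_norm C; have h4 := normr_ge0 C.
    rewrite -(@ler_pXn2r _ 2)// ?nnegrE ?addr_ge0//.
    have := sqr_ge0 `|C|; rewrite sqrrD; lra.
  have -> : K = (fun y : V => dot (y - n) (y - n)) @^-1` [set r | r <= C] by [].
  apply: closed_comp; last exact: closed_le.
  by move=> y _; apply: (@continuous_dot R V (fun y => y - n) (fun y => y - n));
    exact: continuous_sub_cst.
have FK : (z @ \oo) K by exists 0%N => // i _; exact: bnd.
have [y [Ky cy]] := cK (z @ \oo) _ FK.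
have cl (A : set V) i : closed A -> (forall j, (i <= j)%N -> A (z j)) -> A y.
  move=> cA hA; rewrite (closure_id A).1// => U nU.
  apply: cy nU.
  by exists i => // j /= ij; exact: hA.
exists y; last first.
  apply: (cl [set v | (v - n <= M)%MS] 0%N) => [|j _]; last by have [] := hz j.
  apply: (@closed_comp _ _ (fun v : V => v - n) [set v | (v <= M)%MS]).
    by move=> v _; exact: continuous_sub_cst.
  exact: closed_submx.
split=> [|j].
  apply: (cl [set v | (v <= W)%MS] 0%N) => [|j _]; last by have [] := hz j.
  exact: closed_submx.
apply: (cl [set v | qf B (v *m P ^+ j) <= 0] j) => [|i ij].
  apply: (@closed_comp _ _ (fun v : V => qf B (v *m P ^+ j)) [set r | r <= 0]).
    by move=> v _; exact: continuous_qf_mul.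
  exact: closed_le.
by have [_ _] := hz i; apply; rewrite ltnW.
Qed.

(** By [stable_over] the projection of the stable subspace to [N] along [M] is
    onto. *)
Lemma half_splitting : exists E : 'M[R]_4, exists K r : R, [/\ 0 < K, 0 < r < 1,
  (E <= W)%MS /\ (E *m P' <= E)%MS, (\rank N <= \rank E)%N & forall v, (v <= E)%MS ->
   (v != 0 -> qf B v < 0) /\
   forall k, dot (v *m P ^+ k) (v *m P ^+ k) <= K * r ^+ k * dot v v].
Proof.
have [K [r [K0 r01 hc]]] := stable_contract.
have [E hE] := stable_sub.
exists E, K, r; split => // [||v /hE]; last exact: hc.
  split; first by apply/rV_subP => v /hE[].
  apply/rV_subP => v /submxP[c ->]; rewrite mulmxA.
  have : (c *m E <= E)%MS by exact: submxMl.
  move: (c *m E) => u /hE[uW hu]; apply/hE.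
  have uP'W : (u *m P' <= W)%MS by exact: submx_trans (submxMr _ uW) WP'.
  split=> // -[|k]; last by rewrite -mx_iterS PK.
  have := q_le_iter 1 uP'W; rewrite expr1 PK// expr0 mulmx1 => h.
  by have := hu 0%N; rewrite expr0 mulmx1; exact: le_trans.
apply: leq_trans (mxrankM_maxl E (proj_mx N M)).
apply: mxrankS; apply/rV_subP => n nN.
have [z sz zM] := stable_over nN.
have -> : n = z *m proj_mx N M.
  have -> : z = n + (z - n) by rewrite addrC subrK.
  by rewrite mulmxDl proj_mx_id// proj_mx_0// addr0.
by apply: submxMr; apply/hE.
Qed.

End Half.

(** [N] is a maximal subspace on which the form is negative definite, and [M]
    its orthogonal for the polar form: a vector of [M] with a negative value
    could be added to [N]. They span [W] because the Gram matrix of a basis of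
    [N] is invertible. *)
Lemma signature_split (W B : 'M[R]_4) : exists N M : 'M[R]_4,
  [/\ (N <= W)%MS, (M <= W)%MS, (W <= N + M)%MS, (N :&: M)%MS = 0 &
   (forall v, (v <= N)%MS -> qf B v <= 0) /\ (forall v, (v <= M)%MS -> 0 <= qf B v)].
Proof.
pose neg (N : 'M[R]_4) := (N <= W)%MS /\ forall v, (v <= N)%MS -> v != 0 -> qf B v < 0.
pose Pr r := `[< exists N, neg N /\ \rank N = r >].
have ex : exists r, Pr r.
  exists 0%N; apply/asboolP; exists 0; split; last exact: mxrank0.
  by split=> [|v]; rewrite ?sub0mx// submx0 => /eqP ->; rewrite eqxx.
have ub r : Pr r -> (r <= 4)%N by move=> /asboolP[E [_ <-]]; exact: rank_leq_row.
case: (ex_maxnP ex ub) => r /asboolP[N [[NW hN] rN]] maxr.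
have [M hM] : exists M : 'M[R]_4, forall v, (v <= M)%MS <->
    (v <= W)%MS /\ forall n : V, (n <= N)%MS -> bf B n v = 0.
  apply: subspace_mx.
    by split=> [|n nN]; rewrite ?sub0mx// bfE dot0r.
  move=> a u v [uW hu] [vW hv]; split=> [|n nN]; first exact: submx_lin.
  by rewrite bfE !dotlin -!bfE hu// hv// mulr0 addr0.
have MW : (M <= W)%MS by apply/rV_subP => v /hM[].
have qM v : (v <= M)%MS -> 0 <= qf B v.
  move=> vM; rewrite leNgt; apply/negP => qv.
  have [vW hv] := (hM v).1 vM.
  have vN : ~~ (v <= N)%MS.
    by apply/negP => /hv; rewrite bf_diag; lra.
  have negNv : neg (N + v)%MS.
    split; first by rewrite addsmx_sub NW.
    move=> u /sub_addsmxP[[a b] /= ->].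
    rewrite [b]mx11_scalar mul_scalar_mx; set x := a *m N; set be := b 0 0.
    have xN : (x <= N)%MS by exact: submxMl.
    move=> u0; rewrite qfD qfZ.
    have -> : bf B x (be *: v) = 0 by rewrite bfE dotZr -bfE hv// mulr0.
    rewrite addr0.
    have h1 : be ^+ 2 * qf B v <= 0 by rewrite mulr_ge0_le0 ?sqr_ge0// ltW.
    have [x0|x0] := eqVneq x 0; last by have := hN x xN x0; lra.
    rewrite x0 add0r scaler_eq0 negb_or in u0; case/andP: u0 => b0 _.
    rewrite x0 qf0 add0r nmulr_llt0//.
    by rewrite lt_def sqr_ge0 sqrf_eq0 b0.
  have : (\rank (N + v)%MS <= r)%N by apply: maxr; apply/asboolP; exists (N + v)%MS.
  rewrite -rN => h.
  have := mxrank_leqif_sup (addsmxSl N v) => /geq_leqif; rewrite h => /esym.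
  by rewrite addsmx_sub (negbTE vN) andbF.
pose k := \rank N; pose Nb := row_base N.
pose S := B + B^T.
pose G := Nb *m S *m Nb^T.
have bfM (c : 'rV[R]_k) v : bf B (c *m Nb) v = dot (v *m S) (c *m Nb).
  by rewrite bfC bfE.
have Gfree : G \in unitmx.
  rewrite -row_free_unit; apply/row_freeP.
  apply/row_freeP; rewrite -kermx_eq0; apply/eqP/row_matrixP => i; rewrite row0.
  have : row i (kermx G) *m G = 0 by rewrite -row_mul mulmx_ker row0.
  set c := row i _ => cG.
  have cN : (c *m Nb <= N)%MS.
    by apply: (submx_trans (submxMl _ _)); rewrite eq_row_base.
  have q0 : qf B (c *m Nb) = 0.
    have : bf B (c *m Nb) (c *m Nb) = 0.
      rewrite bfM /dot trmx_mul mulmxA.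
      have -> : c *m Nb *m S *m Nb^T = c *m G by rewrite /G !mulmxA.
      by rewrite cG mul0mx mxE.
    by rewrite bf_diag => /eqP; rewrite mulf_eq0 pnatr_eq0 /= => /eqP.
  have [c0|c0] := eqVneq (c *m Nb) 0; last by have := hN _ cN c0; rewrite q0 ltxx.
  have := row_base_free N; rewrite -kermx_eq0 => /eqP ker0.
  apply/eqP; rewrite -submx0 -ker0; apply/sub_kermxP; exact: c0.
exists N, M; split => //.
- apply/rV_subP => v vW.
  pose n := v *m S *m Nb^T *m invmx G *m Nb.
  have nN : (n <= N)%MS.
    by apply: (submx_trans (submxMl _ _)); rewrite eq_row_base.
  have vnM : (v - n <= M)%MS.
    apply/hM; split=> [|n' n'N].
      have -> : v - n = (-1) *: n + v by rewrite scaleN1r addrC.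
      by apply: submx_lin => //; exact: submx_trans nN NW.
    have /submxP[c ->] : (n' <= Nb)%MS by rewrite eq_row_base.
    rewrite bfM mulmxBl /dot trmx_mul mulmxBl.
    have -> : n *m S *m (Nb^T *m c^T) = v *m S *m (Nb^T *m c^T).
      transitivity (v *m S *m Nb^T *m (invmx G *m G) *m c^T).
        by rewrite /n /G; move: (invmx _) => I; clearbody Nb; rewrite !mulmxA.
      by rewrite mulVmx// mulmx1; clearbody Nb; rewrite !mulmxA.
    by rewrite subrr mxE.
  rewrite -(subrK n v) addrC.
  by apply: addmx_sub_adds.
- apply/eqP; rewrite -submx0; apply/rV_subP => v; rewrite sub_capmx => /andP[vN vM].
  have [->|v0] := eqVneq v 0; first exact: sub0mx.
  by have := hN v vN v0; have := qM v vM; lra.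
split=> // v vN; have [->|v0] := eqVneq v 0; first by rewrite qf0.
exact/ltW/hN.
Qed.

(** The stable subspaces of [P] for the form and of its inverse for the
    opposite form are independent, as the form is negative on one and positive
    on the other, and they span [W] because their dimensions are at least
    those of the two terms of [signature_split]. *)
Theorem hyperbolic_splitting (W P P' B : 'M[R]_4) :
  (W *m P <= W)%MS -> (W *m P' <= W)%MS ->
  (forall v, (v <= W)%MS -> v *m P' *m P = v) ->
  (forall v, (v <= W)%MS -> v *m P *m P' = v) ->
  (forall v, (v <= W)%MS -> v != 0 -> qf B v < qf B (v *m P)) ->
  exists Es Eu : 'M[R]_4, exists K r : R, [/\ 0 < K, 0 < r < 1,
    (Es + Eu :=: W)%MS /\ mxdirect (Es + Eu), (Es *m P' <= Es)%MS /\ (Eu *m P <= Eu)%MS &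
    (forall v, (v <= Es)%MS -> forall k,
      dot (v *m P ^+ k) (v *m P ^+ k) <= K * r ^+ k * dot v v) /\
    (forall v, (v <= Eu)%MS -> forall k,
      dot (v *m P' ^+ k) (v *m P' ^+ k) <= K * r ^+ k * dot v v)].
Proof.
move=> WP WP' PK PK' inc.
have [N [M [NW MW NM NM0 [qN qM]]]] := signature_split W B.
have [Es [K1 [r1 [K10 r11 [EsW EsP] rkN hEs]]]] :=
  half_splitting WP WP' PK inc NW MW NM NM0 qN qM.
have inc' v : (v <= W)%MS -> v != 0 -> qf (- B) v < qf (- B) (v *m P').
  move=> vW v0; rewrite !qfN ltrN2.
  have v'W : (v *m P' <= W)%MS by exact: submx_trans (submxMr _ vW) WP'.
  have v'0 : v *m P' != 0 by apply: contraNneq v0 => e; rewrite -(PK v vW) e mul0mx.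
  by have := inc _ v'W v'0; rewrite PK.
have MN : (W <= M + N)%MS by rewrite addsmxC.
have MN0 : (M :&: N)%MS = 0 by rewrite capmxC.
have qM' v : (v <= M)%MS -> qf (- B) v <= 0 by move=> /qM; rewrite qfN oppr_le0.
have qN' v : (v <= N)%MS -> 0 <= qf (- B) v by move=> /qN; rewrite qfN oppr_ge0.
have [Eu [K2 [r2 [K20 r21 [EuW EuP] rkM hEu]]]] :=
  half_splitting WP' WP PK' inc' MW NW MN MN0 qM' qN'.
have EsEu0 : (Es :&: Eu)%MS = 0.
  apply/eqP; rewrite -submx0; apply/rV_subP => v; rewrite sub_capmx => /andP[vs vu].
  have [->|v0] := eqVneq v 0; first exact: sub0mx.
  have := (hEs v vs).1 v0; have := (hEu v vu).1 v0; rewrite qfN; lra.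
have sW : (Es + Eu <= W)%MS by rewrite addsmx_sub EsW.
have rkE : (\rank W <= \rank (Es + Eu)%MS)%N.
  rewrite (leq_trans (mxrankS NM))// mxrank_disjoint_sum// mxrank_disjoint_sum//.
  exact: leq_add.
exists Es, Eu, (K1 + K2), (Num.max r1 r2); split.
- by rewrite addr_gt0.
- case/andP: r11 => r10 r11; case/andP: r21 => r20 r21.
  by rewrite lt_max r10/= gt_max r11.
- split; last by apply/mxdirect_addsP.
  by apply/eqmxP; rewrite sW/= -(geq_leqif (mxrank_leqif_sup sW)).
- by [].
case/andP: r11 => /ltW r10 r11; case/andP: r21 => /ltW r20 r21.
split=> v ve k.
  apply: (le_trans ((hEs v ve).2 k)); rewrite ler_wpM2r ?dot_ge0//.
  apply: ler_pM => //; [exact: ltW|exact: exprn_ge0| |].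
    by rewrite lerDl ltW.
  by rewrite lerXn2r ?nnegrE ?le_max ?r10// lexx.
apply: (le_trans ((hEu v ve).2 k)); rewrite ler_wpM2r ?dot_ge0//.
apply: ler_pM => //; [exact: ltW|exact: exprn_ge0| |].
  by rewrite lerDr ltW.
by rewrite lerXn2r ?nnegrE ?le_max ?r10// lexx orbT.
Qed.

End Linear.

(** * Continuous families of matrices and of subspaces *)

Section MatrixContinuity.
Variables (R : realType) (T : topologicalType).

Lemma continuous_sum (I : Type) (r : seq I) (f : I -> T -> R) (x : T) :
  (forall i, {for x, continuous (f i)}) ->
  {for x, continuous (fun t => \sum_(i <- r) f i t)}.
Proof.
by move=> h; apply: cvg_big => [|i _]; [exact: add_continuous|exact: h].
Qed.

Lemma continuous_prod (I : Type) (r : seq I) (f : I -> T -> R) (x : T) :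
  (forall i, {for x, continuous (f i)}) ->
  {for x, continuous (fun t => \prod_(i <- r) f i t)}.
Proof.
by move=> h; apply: cvg_big => [|i _]; [exact: mul_continuous|exact: h].
Qed.

Lemma continuous_mulf (f g : T -> R) (x : T) :
  {for x, continuous f} -> {for x, continuous g} ->
  {for x, continuous (fun y => f y * g y)}.
Proof. by move=> cf cg; apply: cvgM. Qed.

Lemma continuous_invf (f : T -> R) (x : T) : f x != 0 ->
  {for x, continuous f} -> {for x, continuous (fun y => (f y)^-1)}.
Proof. by move=> f0 cf; apply: cvgV. Qed.

Lemma continuous_mulmx (m n p : nat) (A : T -> 'M[R]_(m, n)) (B : T -> 'M[R]_(n, p)) (x : T) :
  {for x, continuous A} -> {for x, continuous B} ->
  {for x, continuous (fun t => A t *m B t)}.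
Proof.
move=> cA cB; apply: continuous_mx => i j.
have -> : (fun t => (A t *m B t) i j) = (fun t => \sum_k A t i k * B t k j).
  by apply/funext => t; rewrite mxE.
apply: continuous_sum => k; apply: continuous_mulf; exact: continuous_entry.
Qed.

Lemma continuous_trmx (m n : nat) (A : T -> 'M[R]_(m, n)) (x : T) :
  {for x, continuous A} -> {for x, continuous (fun t => (A t)^T)}.
Proof.
move=> cA; apply: continuous_mx => i j.
have -> : (fun t => (A t)^T i j) = (fun t => A t j i) by apply/funext => t; rewrite mxE.
exact: continuous_entry.
Qed.

Lemma continuous_det (n : nat) (A : T -> 'M[R]_n) (x : T) :
  {for x, continuous A} -> {for x, continuous (fun t => \det (A t))}.
Proof.
move=> cA; rewrite /determinant; apply: continuous_sum => s.
apply: continuous_mulf; first exact: continuous_cst_at.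
by apply: continuous_prod => i; exact: continuous_entry.
Qed.

Lemma continuous_invmx (n : nat) (A : T -> 'M[R]_n) (x : T) :
  (forall t, A t \in unitmx) ->
  {for x, continuous A} -> {for x, continuous (fun t => invmx (A t))}.
Proof.
move=> uA cA; apply: continuous_mx => i j.
have -> : (fun t => invmx (A t) i j) = (fun t => (\det (A t))^-1 *
    ((-1) ^+ (j + i) * \det (row' j (col' i (A t))))).
  by apply/funext => t; rewrite /invmx uA !mxE.
apply: continuous_mulf.
  by apply: continuous_invf; [have := uA x; rewrite unitmxE unitfE|exact: continuous_det].
apply: continuous_mulf; first exact: continuous_cst_at.
apply: continuous_det; apply: continuous_mx => k l.
have -> : (fun t => row' j (col' i (A t)) k l) = (fun t => A t (lift j k) (lift i l)).
  by apply/funext => t; rewrite !mxE.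
exact: continuous_entry.
Qed.

Lemma continuous_rows (m : nat) (A : 'M[R]_(m, 4)) (F : T -> 'M[R]_4) (x : T) :
  (forall i, {for x, continuous (fun t => row i A *m F t)}) ->
  {for x, continuous (fun t => A *m F t)}.
Proof.
move=> h; apply: continuous_mx => i j.
have -> : (fun t => (A *m F t) i j) = (fun t => (row i A *m F t) 0 j).
  by apply/funext => s; rewrite -row_mul [RHS]mxE.
exact: continuous_entry.
Qed.

End MatrixContinuity.

Section Projector.
Variables (R : realType) (k : nat).
Implicit Types C : 'M[R]_(k, 4).

(** The orthogonal projection onto the row space of [C]. It depends on this
    space only, unlike the frames transported along a periodic orbit, which do
    not close up after one period. *)
Definition projector C : 'M[R]_4 := C^T *m invmx (C *m C^T) *m C.

(** A vector of the kernel of the Gram matrix gives a combination of the rows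
    of [C] with squared norm 0. *)
Lemma gram_unit C : row_free C -> C *m C^T \in unitmx.
Proof.
move=> fC; rewrite -row_free_unit -kermx_eq0; apply/eqP/row_matrixP => i; rewrite row0.
have : row i (kermx (C *m C^T)) *m (C *m C^T) = 0 by rewrite -row_mul mulmx_ker row0.
set c := row i _ => cG.
have c0 : c *m C = 0.
  apply/eqP; rewrite -dot_eq0 /dot trmx_mul mulmxA.
  have -> : c *m C *m C^T = c *m (C *m C^T) by rewrite mulmxA.
  by rewrite cG mul0mx mxE.
by move: fC => /row_freeP[D CD]; rewrite -[c]mulmx1 -CD mulmxA c0 mul0mx.
Qed.

Lemma projector_sub C : (projector C <= C)%MS.
Proof. exact: submxMl. Qed.

Lemma projector_id C m (v : 'M[R]_(m, 4)) : row_free C -> (v <= C)%MS -> v *m projector C = v.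
Proof.
move=> fC /submxP[c ->].
rewrite /projector !mulmxA -[c *m C *m C^T]mulmxA -(mulmxA c).
by rewrite mulmxV ?mulmx1//; exact: gram_unit.
Qed.

Lemma projector_trmx C : (projector C)^T = projector C.
Proof.
rewrite /projector !trmx_mul trmxK trmx_inv trmx_mul trmxK.
by rewrite mulmxA.
Qed.

Lemma projector_eq C C' : row_free C -> row_free C' -> (C :=: C')%MS ->
  projector C = projector C'.
Proof.
move=> fC fC' e.
have h1 : projector C *m projector C' = projector C.
  by apply: projector_id => //; rewrite -e projector_sub.
have h2 : projector C' *m projector C = projector C'.
  by apply: projector_id => //; rewrite e projector_sub.
by rewrite -h1 -(projector_trmx C) -(projector_trmx C') -trmx_mul h2.
Qed.

Lemma continuous_projector (T : topologicalType) (C : T -> 'M[R]_(k, 4)) (x : T) :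
  (forall t, row_free (C t)) -> {for x, continuous C} ->
  {for x, continuous (fun t => projector (C t))}.
Proof.
move=> fC cC.
have cG : {for x, continuous (fun t => C t *m (C t)^T)}.
  exact: (continuous_mulmx cC (continuous_trmx cC)).
have cI := continuous_invmx (fun t => gram_unit (fC t)) cG.
exact: (continuous_mulmx (continuous_mulmx (continuous_trmx cC) cI) cC).
Qed.

Lemma within_comp (S U W : topologicalType) (A : set S) (P : S -> U) (h : U -> W) :
  {within A, continuous P} -> continuous h -> {within A, continuous (h \o P)}.
Proof.
move=> /subspace_continuousP cP ch; apply/subspace_continuousP => x Ax.
exact: (cvg_comp _ _ (cP x Ax) (ch (P x))).
Qed.

Lemma continuous_mulmxl (B : 'M[R]_(k, 4)) : continuous (fun P : 'M[R]_4 => B *m P).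
Proof.
move=> P; apply: continuous_mulmx; [exact: continuous_cst_at|exact: continuous_id_at].
Qed.

Lemma continuous_gram_det (B : 'M[R]_(k, 4)) :
  continuous (fun C : 'M[R]_(k, 4) => \det (C *m B^T)).
Proof.
move=> C; apply: (@continuous_det _ _ _ (fun C : 'M[R]_(k, 4) => C *m B^T) C).
apply: (@continuous_mulmx R _ k 4 k (fun C : 'M[R]_(k, 4) => C) (fun=> B^T) C).
  exact: continuous_id_at.
exact: continuous_cst_at.
Qed.

End Projector.

(** * Comparison of the Riemannian and the Euclidean norms *)

Section Metric.
Variable R : realType.
Local Notation V := 'rV[R]_4.
Variable g : V -> 'M[R]_4.
Hypothesis hg : riemannian_metric g.

(** The unit tangent bundle, as pairs of a point and a vector. *)
Definition unit_tangent : set (V * V) :=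
  [set zv | [/\ sphere3 zv.1, sphere3 zv.2 & dot zv.2 zv.1 = 0]].

Lemma continuous_fst_at (zv : V * V) : {for zv, continuous (fun w : V * V => w.1)}.
Proof. exact: cvg_fst. Qed.

Lemma continuous_snd_at (zv : V * V) : {for zv, continuous (fun w : V * V => w.2)}.
Proof. exact: cvg_snd. Qed.

Lemma unit_tangent_compact : compact unit_tangent.
Proof.
have cS := compact_setX (@sphere_compact R) (@sphere_compact R).
have -> : unit_tangent = (@sphere3 R `*` @sphere3 R) `&`
    ((fun zv : V * V => dot zv.2 zv.1) @^-1` [set 0]).
  by apply/seteqP; split => [zv [h1 h2 h3]|zv [[h1 h2] h3]].
rewrite setIC; apply: (subclosed_compact _ cS); last by move=> zv [].
apply: closedI; last by apply: compact_closed => //; exact: norm_hausdorff.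
apply: closed_comp; last exact: closed_eq.
move=> zv _; apply: continuous_dot; [exact: continuous_snd_at|exact: continuous_fst_at].
Qed.

Lemma unit_tangent_lb (f : V * V -> R) :
  (forall zv, unit_tangent zv -> {for zv, continuous f}) ->
  (forall zv, unit_tangent zv -> 0 < f zv) ->
  exists2 m, 0 < m & forall zv, unit_tangent zv -> m <= f zv.
Proof.
move=> cf fpos; have [[zv0 Kzv0]|K0] := pselect (unit_tangent !=set0); last first.
  by exists 1 => // zv Kzv; exfalso; apply: K0; exists zv.
have cK : {within unit_tangent, continuous f}.
  by apply: continuous_in_subspaceT => zv; rewrite inE; exact: cf.
have [c cK' h] := compact_EVT_min (ex_intro _ zv0 Kzv0) unit_tangent_compact cK.
exists (f c); first by apply: fpos; rewrite inE in cK'.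
by move=> zv Kzv; apply: h; rewrite inE.
Qed.

Lemma metric_bounds : exists m M : R, [/\ 0 < m, 0 < M & forall z v, sphere3 z ->
  dot v z = 0 -> m * dot v v <= metric_form g z v v <= M * dot v v].
Proof.
have [gC _ gpos] := hg.
pose K := unit_tangent.
pose f (zv : V * V) := dot (zv.2 *m g (normalize zv.1)) zv.2.
have c1 := continuous_fst_at; have c2 := continuous_snd_at.
have cK : compact K by exact: unit_tangent_compact.
have cf' zv : K zv -> {for zv, continuous f}.
  move=> [hz _ _].
  have cg : {for zv, continuous (fun w : V * V => g (normalize w.1))}.
    apply: (@continuous_comp _ _ _ (fun w : V * V => w.1) (fun z => g (normalize z))).
      exact: c1.
    by have /= := gC 0%N; apply; exact: sphere_neq0.
  exact: (continuous_dot (continuous_mulmx (c2 zv) cg) (c2 zv)).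
have cf : {within K, continuous f}.
  by apply: continuous_in_subspaceT => zv; rewrite inE; exact: cf'.
have fE z v : sphere3 z -> f (z, v) = metric_form g z v v.
  by move=> hz; rewrite /f /= normalize_id.
have fpos zv : K zv -> 0 < f zv.
  case: zv => z v [hz hv /= vz]; rewrite fE//; apply: gpos => //.
    by rewrite tangentE vz.
  exact: sphere_neq0.
have [M M0 hM] := compact_ub cK cf.
have [m m0 hm] := unit_tangent_lb cf' fpos.
exists m, M; split => // z v hz vz.
have [->|v0] := eqVneq v 0.
  by rewrite /metric_form mul0mx mul0mx mxE dot0l !mulr0 lexx.
have hK : K (z, normalize v).
  by split => //=; [exact: normalize_sphere|rewrite dotZl vz mulr0].
have := hm _ hK; have := hM _ hK; rewrite fE//.
have -> : metric_form g z (normalize v) (normalize v) = rho v ^+ 2 * metric_form g z v v.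
  rewrite /metric_form normalizeE -scalemxAl linearZ/= -scalemxAl -scalemxAr.
  by rewrite scalerA mxE expr2.
have d0 : 0 < dot v v by rewrite dot_gt0.
move=> h1 h2; have := ler_wpM2r (ltW d0) h1; have := ler_wpM2r (ltW d0) h2.
by rewrite mulrAC rho_sqr// mul1r => -> ->.
Qed.

Lemma rnorm_sqr z v : sphere3 z -> dot v z = 0 -> rnorm g z v ^+ 2 = metric_form g z v v.
Proof.
move=> hz vz; rewrite sqr_sqrtr//.
have [m [M [m0 M0 h]]] := metric_bounds.
by have /andP[+ _] := h z v hz vz; apply: le_trans; rewrite mulr_ge0 ?dot_ge0// ltW.
Qed.

(** Turns a Euclidean estimate on squared norms into a Riemannian one; the
    factor [a] stands for an exponential in time, and [K] does not depend on
    it. *)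
Lemma rnorm_le (C : R) : 0 < C -> exists2 K, 0 < K & forall z z' v v' a,
  sphere3 z -> sphere3 z' -> dot v z = 0 -> dot v' z' = 0 -> 0 <= a ->
  dot v v <= C * a ^+ 2 * dot v' v' -> rnorm g z v <= K * a * rnorm g z' v'.
Proof.
move=> C0; have [m [M [m0 M0 h]]] := metric_bounds.
exists (Num.sqrt (M * C / m)) => [|z z' v v' a hz hz' vz vz' a0 hv].
  by rewrite sqrtr_gt0 divr_gt0// mulr_gt0.
have n0 w y : 0 <= rnorm g w y by exact: sqrtr_ge0.
rewrite -(@ler_pXn2r _ 2)// ?nnegrE ?mulr_ge0 ?sqrtr_ge0//.
rewrite !exprMn !rnorm_sqr// sqr_sqrtr; last by rewrite divr_ge0 ?mulr_ge0 ?ltW.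
have /andP[_ h1] := h z v hz vz; have /andP[h2 _] := h z' v' hz' vz'.
rewrite (le_trans h1)//.
have h3 := ler_wpM2l (ltW M0) hv.
have Ca : 0 <= M * C / m * a ^+ 2.
  by rewrite mulr_ge0 ?sqr_ge0// divr_ge0 ?mulr_ge0 ?ltW.
have := ler_wpM2l Ca h2.
have -> : M * C / m * a ^+ 2 * (m * dot v' v') = M * (C * a ^+ 2 * dot v' v').
  by field; rewrite gt_eqF.
exact: le_trans.
Qed.

End Metric.

(** Geometric decay at the multiples of [T], with bounded growth in between,
    is exponential decay. *)
Lemma exp_decay (R : realType) (h : R -> R) (T K r L a : R) :
  0 < T -> 0 < K -> 0 < r < 1 -> 0 <= L -> 0 <= a ->
  (forall k : nat, h (k%:R * T) <= K * r ^+ k * a) ->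
  (forall s p, h (s + p) <= expR (L * `|p|) * h s) ->
  forall s, 0 <= s -> h s <= K * expR (L * T) / r * expR (ln r / T * s) * a.
Proof.
move=> T0 K0 /andP[r0 r1] L0 a0 h1 h2 s s0.
pose k := Num.truncn (s / T).
have sT : 0 <= s / T by rewrite divr_ge0// ltW.
have /andP[ks sk] := truncn_itv sT.
have p0 : 0 <= s - k%:R * T by rewrite subr_ge0 -ler_pdivlMr.
have pT : s - k%:R * T <= T.
  have hs : s < k.+1%:R * T by rewrite -ltr_pdivrMr.
  by rewrite -natr1 mulrDl mul1r in hs; lra.
have es : s = k%:R * T + (s - k%:R * T) by rewrite addrC subrK.
rewrite {1}es (le_trans (h2 _ _))//.
have e1 : expR (L * `|s - k%:R * T|) <= expR (L * T).
  by rewrite ler_expR ger0_norm// ler_wpM2l.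
have hk := h1 k.
have rk : r ^+ k <= r^-1 * expR (ln r / T * s).
  rewrite -ler_pdivrMl ?invr_gt0// invrK -exprS.
  rewrite -[X in X ^+ _]lnK ?posrE// -expRM_natl ler_expR.
  have lr : ln r <= 0 by rewrite -ln1 ler_ln ?posrE// ltW.
  rewrite mulrC -mulrA; apply: ler_wnM2l => //.
  by rewrite mulrC ltW.
have hk2 : h (k%:R * T) <= K * (r^-1 * expR (ln r / T * s)) * a.
  by rewrite (le_trans hk)// ler_wpM2r// ler_wpM2l// ltW.
have E0 : 0 <= expR (L * `|s - k%:R * T|) by exact: expR_ge0.
have q0 : 0 <= K * (r^-1 * expR (ln r / T * s)) * a.
  apply: mulr_ge0 => //; apply: mulr_ge0; first exact: ltW.
  by apply: mulr_ge0; [rewrite invr_ge0 ltW|exact: expR_ge0].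
rewrite (le_trans (ler_wpM2l E0 hk2))//.
rewrite (le_trans (ler_wpM2r q0 e1))//.
by rewrite le_eqVlt; apply/orP; left; apply/eqP; ring.
Qed.

(** * Periodic orbits *)

Opaque flow_diff sphere_diff flow.

Section Orbit.
Variables (R : realType).
Local Notation V := 'rV[R]_4.
Variables (Y : V -> V) (hY : vector_field Y).
Variables (x : V) (hx : sphere3 x).
Local Notation G t := (flow_diff Y t x).

Lemma tangent_row (z v : V) m (A : 'M[R]_(m, 4)) : (A <= tangent z)%MS ->
  (v <= A)%MS -> dot v z = 0.
Proof. by move=> Az vA; apply/eqP; rewrite -tangentE; exact: submx_trans vA Az. Qed.

Lemma flow_diffD_mx m (A : 'M[R]_(m, 4)) (s t : R) : (A <= tangent x)%MS ->
  A *m G (s + t) = A *m G t *m flow_diff Y s (flow Y t x).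
Proof.
move=> Ax; apply/row_matrixP => i.
rewrite [LHS]row_mul [RHS]row_mul [in RHS]row_mul.
apply: flow_diffD => //; apply: (tangent_row Ax); exact: row_sub.
Qed.

Lemma flow_diff0_mx m (A : 'M[R]_(m, 4)) : (A <= tangent x)%MS -> A *m G 0 = A.
Proof.
move=> Ax; apply/row_matrixP => i; rewrite [LHS]row_mul.
apply: (flow_diff_variation hY hx _).2; apply: (tangent_row Ax); exact: row_sub.
Qed.

Lemma flow_diff_tangent_mx m (A : 'M[R]_(m, 4)) t : (A <= tangent x)%MS ->
  (A *m G t <= tangent (flow Y t x))%MS.
Proof.
move=> Ax; apply/row_subP => i; rewrite row_mul tangentE.
by rewrite flow_diff_tangent//; apply: (tangent_row Ax); exact: row_sub.
Qed.

Lemma flow_diff_rank m (A : 'M[R]_(m, 4)) t : (A <= tangent x)%MS ->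
  \rank (A *m G t) = \rank A.
Proof.
move=> Ax; apply/eqP; rewrite eqn_leq mxrankM_maxl/=.
have e : A = A *m G t *m flow_diff Y (- t) (flow Y t x).
  by rewrite -flow_diffD_mx// addNr flow_diff0_mx.
by rewrite {1}e mxrankM_maxl.
Qed.

Lemma flow_diff_cont m (A : 'M[R]_(m, 4)) : (A <= tangent x)%MS ->
  continuous (fun t => A *m G t).
Proof.
move=> Ax t; apply: (continuous_rows (A := A) (F := fun s : R => G s) (x := t)) => i.
have Ai : dot (row i A) x = 0 by apply: (tangent_row Ax); exact: row_sub.
have [hv _] := flow_diff_variation hY hx Ai.
exact: (is_derive_cont hv).
Qed.

Variables (T : R) (T0 : 0 < T) (xT : flow Y T x = x).

Lemma flow_period_nat (k : nat) : flow Y (k%:R * T) x = x.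
Proof.
elim: k => [|k IH]; first by rewrite mul0r flow0.
by rewrite -natr1 mulrDl mul1r flowD// xT.
Qed.

Lemma flow_period_nat_add (k : nat) t : flow Y (t + k%:R * T) x = flow Y t x.
Proof. by rewrite flowD// flow_period_nat. Qed.

Lemma flow_period_opp (k : nat) : flow Y (- (k%:R * T)) x = x.
Proof. by rewrite -{1}(flow_period_nat k) flowNK. Qed.

Lemma flow_periodN : flow Y (- T) x = x.
Proof. by rewrite -{1}xT flowNK. Qed.

Lemma flow_mod t : exists2 s, 0 <= s <= T & flow Y s x = flow Y t x.
Proof.
have nonneg u : 0 <= u -> exists2 s, 0 <= s <= T & flow Y s x = flow Y u x.
  move=> u0; pose k := Num.truncn (u / T).
  have uT : 0 <= u / T by rewrite divr_ge0// ltW.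
  have /andP[ku uk] := truncn_itv uT.
  exists (u - k%:R * T); last by rewrite -{2}(subrK (k%:R * T) u) flow_period_nat_add.
  rewrite subr_ge0 -ler_pdivlMr// ku/=.
  have h : u < k.+1%:R * T by rewrite -ltr_pdivrMr.
  by rewrite -natr1 mulrDl mul1r in h; lra.
have [t0|t0] := leP 0 t; first exact: nonneg.
pose k := (Num.truncn (- t / T)).+1.
have h : - t / T < k%:R by exact: truncnS_gt.
have h2 : 0 <= t + k%:R * T by move: h; rewrite ltr_pdivrMr//; lra.
by have [s hs e] := nonneg _ h2; exists s => //; rewrite e flow_period_nat_add.
Qed.

Lemma orbit_compact : compact (Defs.orbit Y x).
Proof.
have -> : Defs.orbit Y x = (fun t => flow Y t x) @` [set` `[0, T]].
  apply/seteqP; split => [y [t _ <-]|y [t _ <-]]; last by exists t.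
  have [s hs e] := flow_mod t; exists s => //.
apply: continuous_compact; last exact: segment_compact.
by apply: continuous_subspaceT; exact: flow_cont.
Qed.

Lemma orbit_sphere y : Defs.orbit Y x y -> sphere3 y.
Proof. by move=> [t _ <-]; exact: flow_sphere. Qed.

Lemma orbit_invariant t : flow Y t @` Defs.orbit Y x = Defs.orbit Y x.
Proof.
apply/seteqP; split=> [y [z [s _ <-] <-]|y [s _ <-]].
  by exists (t + s) => //; rewrite flowD.
exists (flow Y (s - t) x); first by exists (s - t).
by rewrite -flowD// addrC subrK.
Qed.

(** The orbit has the quotient topology of the interval from 0 to T: the times
    in that interval at which [f] is at distance at least [e] from its value
    at [y0] form a compact set, whose image in the orbit is closed and avoids
    [y0]. *)
Lemma continuous_on_orbit (W : normedModType R) (f : V -> W) :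
  continuous (fun t => f (flow Y t x)) -> {within Defs.orbit Y x, continuous f}.
Proof.
move=> cf; apply/subspace_continuousP => y0 oy0; apply/cvgrPdist_lt => e e0.
pose C := [set t | e <= `|f y0 - f (flow Y t x)|] `&` [set` `[0, T]].
have cC : compact C.
  apply: (subclosed_compact _ (@segment_compact _ 0 T)); last by move=> t [].
  apply: closedI; last exact: itv_closed.
  apply: (@closed_comp _ _ (fun t => `|f y0 - f (flow Y t x)|) [set r | e <= r]).
    move=> t _; apply: (@continuous_comp _ _ _ (fun t => f y0 - f (flow Y t x)) Num.norm).
      by apply: continuous_subf; [exact: continuous_cst_at|exact: cf].
    exact: norm_continuous.
  exact: closed_ge.
have cI : compact ((fun t => flow Y t x) @` C).
  apply: continuous_compact => //.
  by apply: continuous_subspaceT; exact: flow_cont.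
have oI : open (~` ((fun t => flow Y t x) @` C)).
  by rewrite openC; apply: compact_closed => //; exact: norm_hausdorff.
have y0I : (~` ((fun t => flow Y t x) @` C)) y0.
  by move=> [t [+ _] e1]; rewrite /= -e1 subrr normr0 leNgt e0.
have nb := open_nbhs_nbhs (conj oI y0I).
rewrite /prop_near1 /within/=; apply: filterS nb => y hy [t _ ty].
have [s hs e1] := flow_mod t; rewrite ltNge; apply/negP => he.
apply: hy; exists s; last by rewrite e1.
by split; rewrite /= ?e1 ?ty// in_itv.
Qed.

(** Near a point, the projections of a fixed frame to the spaces of the bundle
    form a continuous frame, as long as their Gram determinant against the
    fixed frame does not vanish. *)
Lemma bundle_on_orbit m (E0 : 'M[R]_(m, 4)) (E : V -> 'M[R]_4) : (E0 <= tangent x)%MS ->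
  (forall t, (E (flow Y t x) :=: E0 *m G t)%MS) -> subbundle (Defs.orbit Y x) E.
Proof.
move=> E0x hE y0 oy0.
pose k := \rank E0; pose C0 := row_base E0.
have C0x : (C0 <= tangent x)%MS by rewrite /C0 eq_row_base.
have Cfree t : row_free (C0 *m G t).
  by rewrite /row_free flow_diff_rank//; exact: row_base_free.
have CE t : (E (flow Y t x) :=: C0 *m G t)%MS.
  apply: eqmx_trans (hE t) _; apply/eqmxP.
  by rewrite !submxMr// ?eq_row_base//.
pose P y := if pselect (exists t, flow Y t x = y) is left h
  then projector (C0 *m G (projT1 (cid h))) else 0.
have PE t : P (flow Y t x) = projector (C0 *m G t).
  rewrite /P; case: pselect => [h|[]]; last by exists t.
  apply: projector_eq; [exact: Cfree|exact: Cfree|].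
  case: (cid h) => s /= e.
  by apply: eqmx_trans (eqmx_sym (CE s)) _; rewrite e; exact: CE.
have Pc : {within Defs.orbit Y x, continuous P}.
  apply: continuous_on_orbit => t.
  have -> : (fun s => P (flow Y s x)) = (fun s => projector (C0 *m G s)).
    by apply/funext => s; exact: PE.
  apply: (continuous_projector (C := fun s : R => C0 *m G s) (x := t)); first exact: Cfree.
  exact: flow_diff_cont.
have [t0 _ ty0] := oy0.
pose B0 := C0 *m G t0; pose B y := B0 *m P y.
have Bc : {within Defs.orbit Y x, continuous B}.
  apply: (@within_comp V 'M[R]_4 'M[R]_(k, 4) _ P (fun M => B0 *m M) Pc).
  exact: continuous_mulmxl.
have Dc : {within Defs.orbit Y x, continuous (fun y => \det (B y *m B0^T))}.
  apply: (@within_comp V 'M[R]_(k, 4) R _ B (fun M => \det (M *m B0^T)) Bc).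
  exact: continuous_gram_det.
have By0 : B y0 = B0.
  by rewrite /B -ty0 PE projector_id.
have D0 : \det (B y0 *m B0^T) != 0.
  by rewrite By0 -unitfE -unitmxE; apply: gram_unit; exact: Cfree.
have /subspace_continuousP/(_ y0 oy0)/cvgrPdist_lt/(_ `|\det (B y0 *m B0^T)|) := Dc.
rewrite normr_gt0 => /(_ D0); rewrite /prop_near1 /within/= => nb.
have [U [oU Uy0 hU]] : exists U : set V, [/\ open U, U y0 & forall y, U y -> Defs.orbit Y x y ->
    `|\det (B y0 *m B0^T) - \det (B y *m B0^T)| < `|\det (B y0 *m B0^T)|].
  have := nb; rewrite nbhsE => -[U [oU Uy0] hU].
  by exists U; split => // y Uy oy; exact: hU.
exists U, k, B; split => //.
  apply: continuous_subspaceW Bc; exact: subIsetl.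
move=> y oy Uy.
have Dy : B y *m B0^T \in unitmx.
  rewrite unitmxE unitfE; apply/eqP => e.
  by have := hU y Uy oy; rewrite e subr0 ltxx.
have fB : row_free (B y).
  rewrite /row_free eqn_leq rank_leq_row/=.
  have : row_free (B y *m B0^T) by rewrite row_free_unit.
  by rewrite /row_free => /eqP {1}<-; exact: mxrankM_maxl.
split=> //.
have [t _ ty] := oy.
have sub : (B y <= C0 *m G t)%MS.
  by rewrite /B -ty PE; apply: submx_trans (submxMl _ _) (projector_sub _).
apply: eqmx_sym; rewrite -ty; apply: (eqmx_trans _ (eqmx_sym (CE t))); rewrite ty.
apply/eqmxP; rewrite sub/= -(geq_leqif (mxrank_leqif_sup sub)).
have /eqP -> := fB; have /eqP -> := Cfree t.
by [].
Qed.

End Orbit.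

Transparent flow_diff sphere_diff flow.

(** * Hyperbolicity of an orbit from the growth of a quadratic form *)

Opaque flow_diff sphere_diff flow mulmx dot.

Section Criterion.
Variables (R : realType).
Local Notation V := 'rV[R]_4.

Lemma tangent_rank (x : V) : sphere3 x -> \rank (tangent x) = 3%N.
Proof.
move=> /sphere_neq0 x0; rewrite /tangent mxrank_ker mxrank_tr rank_rV x0//.
Qed.

(** If the orbit of [u] under [Q] is bounded, so is that of its component in
    [E2]; this component is the image of its n-th iterate under [Q' ^+ n],
    which contracts [E2], so it is 0. As a consequence, every map that
    commutes with [Q] preserves [E1]. *)
Lemma bounded_in_stable (W Q Q' E1 E2 : 'M[R]_4) (K r C : R) (u : V) :
  (W *m Q <= W)%MS -> (forall v : V, (v <= W)%MS -> v *m Q *m Q' = v) ->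
  (W <= E1 + E2)%MS -> (E2 <= W)%MS -> (E2 *m Q <= E2)%MS -> 0 < K -> 0 < r < 1 ->
  (forall v : V, (v <= E1)%MS -> forall k, dot (v *m Q ^+ k) (v *m Q ^+ k) <= K * r ^+ k * dot v v) ->
  (forall v : V, (v <= E2)%MS -> forall k, dot (v *m Q' ^+ k) (v *m Q' ^+ k) <= K * r ^+ k * dot v v) ->
  (u <= W)%MS -> (forall k, dot (u *m Q ^+ k) (u *m Q ^+ k) <= C) -> (u <= E1)%MS.
Proof.
move=> WQ QK WE E2W E2Q K0 /andP[r0 r1] h1 h2 uW hu.
have /sub_addsmxP[[a b] /= e] := submx_trans uW WE.
set v1 := a *m E1 in e; set v2 := b *m E2 in e.
have v1E : (v1 <= E1)%MS by exact: submxMl.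
have v2E : (v2 <= E2)%MS by exact: submxMl.
have v2W := submx_trans v2E E2W.
have C0 : 0 <= C by apply: le_trans (hu 0%N); exact: dot_ge0.
suff v20 : v2 = 0 by rewrite e v20 addr0.
apply/eqP; rewrite -dot_eq0 eq_le dot_ge0 andbT leNgt; apply/negP => pos.
pose C2 := 2 * C + 2 * (K * dot v1 v1).
have r01 : 0 <= r < 1 by rewrite ltW.
have [n hn] := geometric_small (K * C2) r01 pos.
have := hn n (leqnn _); rewrite ltNge => /negP; apply.
have bE : (v2 *m Q ^+ n <= E2)%MS by exact: sub_iter.
have eb : v2 *m Q ^+ n *m Q' ^+ n = v2 by exact: (mx_iterK n WQ QK v2W).
have hb : dot (v2 *m Q ^+ n) (v2 *m Q ^+ n) <= C2.
  have -> : v2 *m Q ^+ n = u *m Q ^+ n - v1 *m Q ^+ n by rewrite e mulmxDl addrC addKr.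
  have hun := hu n; have h1n := h1 v1 v1E n.
  set p := u *m Q ^+ n in hun *; set q := v1 *m Q ^+ n in h1n *.
  have := dot_ge0 (p + q); rewrite !dotlin (dotC q p) => h3.
  have h4 : K * r ^+ n * dot v1 v1 <= K * dot v1 v1.
    rewrite ler_wpM2r ?dot_ge0// ler_piMr ?(ltW K0)//.
    by apply: exprn_ile1; exact: ltW.
  rewrite /C2; lra.
have h3 := h2 _ bE n; rewrite eb in h3.
have rn : 0 <= K * r ^+ n by rewrite mulr_ge0 ?(ltW K0)// exprn_ge0// ltW.
rewrite (le_trans h3)// (le_trans (ler_wpM2l rn hb))//.
by rewrite mulrAC.
Qed.

End Criterion.

Section LinearFlow.
Variables (R : realType).
Local Notation V := 'rV[R]_4.
Variables (G : R -> 'M[R]_4) (per : R -> Prop) (W B : 'M[R]_4) (T L : R).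
Hypotheses (T0 : 0 < T) (L0 : 0 < L).
Hypothesis perT : forall k : nat, per (k%:R * T) /\ per (- (k%:R * T)).
Hypothesis G0 : forall v : V, (v <= W)%MS -> v *m G 0 = v.
Hypothesis GD : forall (v : V) s q, (v <= W)%MS -> per q -> v *m G (s + q) = v *m G q *m G s.
Hypothesis Ggrowth : forall (v : V) s p, (v <= W)%MS ->
  dot (v *m G (s + p)) (v *m G (s + p)) <= expR (L * `|p|) * dot (v *m G s) (v *m G s).
Hypothesis WG : forall q, per q -> (W *m G q <= W)%MS.
Hypothesis inc : forall v : V, (v <= W)%MS -> v != 0 -> qf B v < qf B (v *m G T).

Let pT : per T. Proof. by have [h _] := perT 1; rewrite mul1r in h. Qed.
Let pNT : per (- T). Proof. by have [_ h] := perT 1; rewrite mul1r in h. Qed.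

Let WGv q (v : V) : per q -> (v <= W)%MS -> (v *m G q <= W)%MS.
Proof. by move=> pq vW; apply: submx_trans (WG pq); exact: submxMr. Qed.

Lemma return_iter (v : V) k : (v <= W)%MS -> v *m G T ^+ k = v *m G (k%:R * T).
Proof.
move=> vW; elim: k => [|k IH].
  by rewrite expr0 mulmx1 mul0r G0.
rewrite -mx_iterSr IH -natr1 mulrDl mul1r addrC GD//.
by have [] := perT k.
Qed.

Lemma return_iterN (v : V) k : (v <= W)%MS -> v *m G (- T) ^+ k = v *m G (- (k%:R * T)).
Proof.
move=> vW; elim: k => [|k IH].
  by rewrite expr0 mulmx1 mul0r oppr0 G0.
rewrite -mx_iterSr IH -natr1 mulrDl mul1r opprD addrC GD//.
by have [] := perT k.
Qed.

Lemma return_comm (v : V) p q : (v <= W)%MS -> per p -> per q ->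
  v *m G p *m G q = v *m G q *m G p.
Proof. by move=> vW pp pq; rewrite -GD// addrC GD. Qed.

Lemma growth0 (v : V) p : (v <= W)%MS ->
  dot (v *m G p) (v *m G p) <= expR (L * `|p|) * dot v v /\
  dot v v <= expR (L * `|p|) * dot (v *m G p) (v *m G p).
Proof.
move=> vW; split; first by have := Ggrowth 0 p vW; rewrite add0r G0.
by have := Ggrowth p (- p) vW; rewrite subrr G0// normrN.
Qed.

(** [G] is the differential of a flow at a point of a periodic orbit and [per]
    the set of the times that fix the point: the cocycle relation at the same
    base point holds for these times only. The splitting is that of the return
    map [G T]; it is preserved by [G q] for all q in [per] because these maps
    commute with [G T] ([bounded_in_stable]). The rates at the times [s + t]
    with 0 <= s <= T come from those of the return map by [exp_decay]. *)
Theorem linear_flow_splitting : exists Es Eu : 'M[R]_4, exists K l : R,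
  [/\ 0 < K, 0 < l, (Es + Eu :=: W)%MS /\ mxdirect (Es + Eu),
      forall q, per q -> (Es *m G q <= Es)%MS /\ (Eu *m G q <= Eu)%MS &
      forall s t (w : V), 0 <= s <= T -> 0 <= t ->
        ((w <= Es)%MS -> dot (w *m G (t + s)) (w *m G (t + s)) <=
           K * expR (- (l * t)) ^+ 2 * dot (w *m G s) (w *m G s)) /\
        ((w <= Eu)%MS -> dot (w *m G s) (w *m G s) <=
           K * expR (- (l * t)) ^+ 2 * dot (w *m G (t + s)) (w *m G (t + s)))].
Proof.
have PK (v : V) : (v <= W)%MS -> v *m G T *m G (- T) = v.
  by move=> vW; rewrite -GD// addNr G0.
have PK' (v : V) : (v <= W)%MS -> v *m G (- T) *m G T = v.
  by move=> vW; rewrite -GD// subrr G0.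
have [Es [Eu [K [r [K0 r01 [EW dir] [EsP EuP] [hs hu]]]]]] :=
  hyperbolic_splitting (WG pT) (WG pNT) PK' PK inc.
have EsW : (Es <= W)%MS by rewrite -EW addsmxSl.
have EuW : (Eu <= W)%MS by rewrite -EW addsmxSr.
have WE : (W <= Es + Eu)%MS by rewrite EW.
have WE' : (W <= Eu + Es)%MS by rewrite addsmxC.
have /andP[r0 r1] := r01.
have EsG q : per q -> (Es *m G q <= Es)%MS.
  move=> hq; apply/rV_subP => w /submxP[c ->]; rewrite mulmxA.
  have : (c *m Es <= Es)%MS by exact: submxMl.
  move: (c *m Es) => v vE; have vW := submx_trans vE EsW.
  have uW := WGv hq vW.
  apply: (bounded_in_stable (WG pT) PK WE EuW EuP K0 r01 hs hu uW
    (C := expR (L * `|q|) * (K * dot v v))) => k.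
  have [pk _] := perT k.
  rewrite return_iter// return_comm//.
  have vkW := WGv pk vW.
  rewrite (le_trans (growth0 q vkW).1)// ler_wpM2l ?expR_ge0// -return_iter//.
  rewrite (le_trans (hs _ vE k))// ler_wpM2r ?dot_ge0// ler_piMr ?(ltW K0)//.
  by apply: exprn_ile1; exact: ltW.
have EuG q : per q -> (Eu *m G q <= Eu)%MS.
  move=> hq; apply/rV_subP => w /submxP[c ->]; rewrite mulmxA.
  have : (c *m Eu <= Eu)%MS by exact: submxMl.
  move: (c *m Eu) => v vE; have vW := submx_trans vE EuW.
  have uW := WGv hq vW.
  apply: (bounded_in_stable (WG pNT) PK' WE' EsW EsP K0 r01 hu hs uW
    (C := expR (L * `|q|) * (K * dot v v))) => k.
  have [_ pk] := perT k.
  rewrite return_iterN// return_comm//.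
  have vkW := WGv pk vW.
  rewrite (le_trans (growth0 q vkW).1)// ler_wpM2l ?expR_ge0// -return_iterN//.
  rewrite (le_trans (hu _ vE k))// ler_wpM2r ?dot_ge0// ler_piMr ?(ltW K0)//.
  by apply: exprn_ile1; exact: ltW.
(* r bounds squared norms over a period T, whence the factor 2. *)
pose l := - (ln r / (2 * T)).
have lr1 : ln r < 0 by rewrite ln_lt0// r0.
have l0 : 0 < l by rewrite oppr_gt0 pmulr_llt0 ?invr_gt0 ?mulr_gt0.
have a2 t : expR (- (l * t)) ^+ 2 = expR (ln r / T * t).
  by rewrite -expRM_natl; congr expR; rewrite /l; field; rewrite gt_eqF.
have T0' := ltW T0.
pose C0 := K * expR (L * T) / r.
have C00 : 0 < C0 by rewrite divr_gt0// mulr_gt0// expR_gt0.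
have lr0 : ln r / T < 0 by rewrite pmulr_llt0 ?invr_gt0.
have L0' := ltW L0.
have decs (w : V) : (w <= Es)%MS -> forall s, 0 <= s ->
    dot (w *m G s) (w *m G s) <= C0 * expR (ln r / T * s) * dot w w.
  move=> wE s s0; have wW := submx_trans wE EsW.
  apply: (@exp_decay R (fun s => dot (w *m G s) (w *m G s)) T K r L (dot w w)) => //.
  - exact: dot_ge0.
  - by move=> k; rewrite -return_iter//; exact: hs.
  - by move=> p q; exact: Ggrowth.
have decu (w : V) : (w <= Eu)%MS -> forall s, 0 <= s ->
    dot (w *m G (- s)) (w *m G (- s)) <= C0 * expR (ln r / T * s) * dot w w.
  move=> wE s s0; have wW := submx_trans wE EuW.
  apply: (@exp_decay R (fun s => dot (w *m G (- s)) (w *m G (- s))) T K r L (dot w w)) => //.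
  - exact: dot_ge0.
  - by move=> k; rewrite -return_iterN//; exact: hu.
  - by move=> p q; rewrite opprD -(normrN q); exact: Ggrowth.
pose CC := C0 * expR (L * T).
have CC0 : 0 < CC by rewrite mulr_gt0// expR_gt0.
exists Es, Eu, CC, l; split => // [q hq|s t w /andP[s0 sT] t0]; first by split; [exact: EsG|exact: EuG].
rewrite a2.
split=> wE.
  have wW := submx_trans wE EsW.
  have h1 := decs w wE (t + s) (addr_ge0 t0 s0).
  have [_ h2] := growth0 s wW.
  apply: (le_trans h1).
  have h3 : expR (ln r / T * (t + s)) <= expR (ln r / T * t).
    by rewrite ler_expR mulrDr gerDl; apply: mulr_le0_ge0 => //; exact: ltW.
  have h4 : dot w w <= expR (L * T) * dot (w *m G s) (w *m G s).
    apply: (le_trans h2); apply: ler_wpM2r; first exact: dot_ge0.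
    by rewrite ler_expR ler_wpM2l// ger0_norm.
  have -> : CC * expR (ln r / T * t) * dot (w *m G s) (w *m G s) =
      C0 * expR (ln r / T * t) * (expR (L * T) * dot (w *m G s) (w *m G s)).
    by rewrite /CC; ring.
  apply: (le_trans (ler_wpM2r (dot_ge0 w) (ler_wpM2l (ltW C00) h3))).
  by apply: (ler_wpM2l _ h4); rewrite mulr_ge0 ?expR_ge0// ltW.
have wW := submx_trans wE EuW.
(* The expansion of w at the time t + s is the contraction, backwards, of its
   image at the next multiple of the period. *)
pose k := (Num.truncn ((t + s) / T)).+1.
have tsT : 0 <= (t + s) / T by apply: divr_ge0 => //; exact: addr_ge0.
have /andP[k1 k2] := truncn_itv tsT.
have q0 : 0 <= k%:R * T - (t + s).
  by rewrite subr_ge0 -ler_pdivrMr// ltW.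
have qT : k%:R * T - (t + s) <= T.
  by rewrite /k -natr1 mulrDl mul1r; rewrite ler_pdivlMr// in k1; lra.
set q := k%:R * T - (t + s) in q0 qT.
have kq : (t + s) + q = k%:R * T by rewrite addrC subrK.
have [kx _] := perT k.
have wkE : (w *m G (k%:R * T) <= Eu)%MS by apply: submx_trans (EuG _ kx); exact: submxMr.
have h5 : t <= k%:R * T - s by rewrite -kq; lra.
have h1 := decu _ wkE (k%:R * T - s) (le_trans t0 h5).
rewrite -GD// in h1.
have e2 : - (k%:R * T - s) + k%:R * T = s by ring.
rewrite e2 in h1.
have h2 := Ggrowth (t + s) q wW.
rewrite kq in h2.
apply: (le_trans h1).
have h3 : expR (ln r / T * (k%:R * T - s)) <= expR (ln r / T * t).
  by rewrite ler_expR; apply: ler_wnM2l => //; exact: ltW.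
move: (dot (w *m G (k%:R * T)) (w *m G (k%:R * T))) (dot_ge0 (w *m G (k%:R * T))) h2 => a a0 h2.
move: (dot_ge0 (w *m G (t + s))) h2.
move: (dot (w *m G (t + s)) (w *m G (t + s))) => z z0 h2.
have h4 : a <= expR (L * T) * z.
  apply: (le_trans h2); apply: ler_wpM2r => //.
  by rewrite ler_expR ler_wpM2l// ger0_norm.
have -> : CC * expR (ln r / T * t) * z = C0 * expR (ln r / T * t) * (expR (L * T) * z).
  by rewrite /CC; ring.
apply: (le_trans (ler_wpM2r a0 (ler_wpM2l (ltW C00) h3))).
by apply: (ler_wpM2l _ h4); rewrite mulr_ge0 ?expR_ge0// ltW.
Qed.

End LinearFlow.

Section HyperbolicOrbit.
Variables (R : realType).
Local Notation V := 'rV[R]_4.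
Variables (Y : V -> V) (hY : vector_field Y).

Lemma flow_diff_growth : exists2 L, 0 < L & forall y (u : V) s p, sphere3 y -> dot u y = 0 ->
  dot (u *m flow_diff Y (s + p) y) (u *m flow_diff Y (s + p) y) <=
    expR (L * `|p|) * dot (u *m flow_diff Y s y) (u *m flow_diff Y s y).
Proof.
have [L L0 hL] := variation_growth hY; exists L => // y u s p hy uy.
have uy' := flow_diff_tangent hY s hy uy.
have ys := flow_sphere hY s hy.
have [hv e] := flow_diff_variation hY ys uy'.
have [h _] := hL _ _ ys hv p.
have E := flow_diffD hY p s hy uy; rewrite addrC in E.
move: h E e; move: (flow_diff Y) => G h E e.
move: h; rewrite e E mulrC; exact.
Qed.

Variables (g : V -> 'M[R]_4) (hg : riemannian_metric g).
Variables (x : V) (hx : sphere3 x) (T : R) (T0 : 0 < T) (xT : flow Y T x = x).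
Local Notation G t := (flow_diff Y t x).
Variables (W B : 'M[R]_4) (Wx : (W <= tangent x)%MS).
Hypothesis WG : forall r, flow Y r x = x -> (W *m G r <= W)%MS.
Hypothesis WY : (W + Y x :=: tangent x)%MS.
Hypothesis WY0 : (W :&: Y x)%MS = 0.
Hypothesis inc : forall v : V, (v <= W)%MS -> v != 0 -> qf B v < qf B (v *m G T).

(** Two times at which the orbit reaches the same point differ by a time that
    fixes [x], and whose differential preserves [E0]. *)
Lemma bundle_move (m : nat) (E0 : 'M[R]_(m, 4)) s t : (E0 <= tangent x)%MS ->
  (forall r, flow Y r x = x -> (E0 *m G r <= E0)%MS) ->
  flow Y t x = flow Y s x -> (E0 *m G t <= E0 *m G s)%MS.
Proof.
move=> E0x h e.
have e1 : flow Y (t - s) x = x by rewrite addrC flowD// e flowNK.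
have E := flow_diffD_mx hY hx s (t - s) E0x.
have e2 : s + (t - s) = t by rewrite addrC subrK.
have {}h := h _ e1.
move: E h; rewrite e2 e1; move: (flow_diff Y) => H -> h.
exact: submxMr.
Qed.

Lemma bundle_move_eq (m : nat) (E0 : 'M[R]_(m, 4)) s t : (E0 <= tangent x)%MS ->
  (forall r, flow Y r x = x -> (E0 *m G r <= E0)%MS) ->
  flow Y t x = flow Y s x -> (E0 *m G t :=: E0 *m G s)%MS.
Proof.
by move=> E0x h e; apply/eqmxP/andP; split; [exact: bundle_move|exact/bundle_move/esym].
Qed.

(** The splitting of [W] at [x] is carried along the orbit by the differential
    of the flow. A zero of [Y] is covered too: it is an orbit of which every
    positive time [T] is a period, with [W] the whole tangent space. *)
Theorem hyperbolic_of_growth : hyperbolic g Y (Defs.orbit Y x).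
Proof.
have [L L0 hL] := flow_diff_growth.
have tW (v : V) : (v <= W)%MS -> dot v x = 0 by exact: tangent_row.
have [Es [Eu [C [l [C0 l0 [EW dir] EG hE]]]]] :
  exists Es Eu : 'M[R]_4, exists K l : R,
  [/\ 0 < K, 0 < l, (Es + Eu :=: W)%MS /\ mxdirect (Es + Eu),
      forall q, flow Y q x = x -> (Es *m G q <= Es)%MS /\ (Eu *m G q <= Eu)%MS &
      forall s t (w : V), 0 <= s <= T -> 0 <= t ->
        ((w <= Es)%MS -> dot (w *m G (t + s)) (w *m G (t + s)) <=
           K * expR (- (l * t)) ^+ 2 * dot (w *m G s) (w *m G s)) /\
        ((w <= Eu)%MS -> dot (w *m G s) (w *m G s) <=
           K * expR (- (l * t)) ^+ 2 * dot (w *m G (t + s)) (w *m G (t + s)))].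
  apply: (@linear_flow_splitting R (fun t => G t) (fun q => flow Y q x = x) W B T L).
  - exact: T0.
  - exact: L0.
  - by move=> k; split; [exact: flow_period_nat|exact: flow_period_opp].
  - by move=> v /tW vx; have [_ ->] := flow_diff_variation hY hx vx.
  - move=> v s q /tW vx hq; have := flow_diffD hY s q hx vx; rewrite hq; exact.
  - by move=> v s p /tW vx; exact: hL.
  - exact: WG.
  - exact: inc.
have EsW : (Es <= W)%MS by rewrite -EW addsmxSl.
have EuW : (Eu <= W)%MS by rewrite -EW addsmxSr.
have Esx := submx_trans EsW Wx; have Eux := submx_trans EuW Wx.
have Yx0 : dot (Y x) x = 0 by exact: field_tangent.
have EsG q (h : flow Y q x = x) := (EG q h).1.
have EuG q (h : flow Y q x = x) := (EG q h).2.
have YG q : flow Y q x = x -> (Y x *m G q <= Y x)%MS.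
  by move=> hq; rewrite flow_diff_field// hq.
have Yxt : (Y x <= tangent x)%MS by rewrite tangentE Yx0.
have htau (y : V) : exists t, Defs.orbit Y x y -> 0 <= t <= T /\ flow Y t x = y.
  have [[t _ <-]|ny] := pselect (Defs.orbit Y x y); last by exists 0.
  by have [s hs1 e1] := flow_mod hY hx T0 xT t; exists s.
have [tau htau'] := choice htau.
have tauE t : flow Y (tau (flow Y t x)) x = flow Y t x.
  by have [|_ ->] := htau' (flow Y t x); first by exists t.
pose mv (E0 : 'M[R]_4) (y : V) : 'M[R]_4 := E0 *m G (tau y).
have mvE E0 t : (E0 <= tangent x)%MS -> (forall q, flow Y q x = x -> (E0 *m G q <= E0)%MS) ->
    (mv E0 (flow Y t x) :=: E0 *m G t)%MS.
  by move=> h1 h2; apply: bundle_move_eq.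
have Yeq t : (<<Y (flow Y t x)>> :=: Y x *m G t)%MS.
  by rewrite flow_diff_field//; exact: genmxE.
have iv E0 y t : (E0 <= tangent x)%MS -> (forall q, flow Y q x = x -> (E0 *m G q <= E0)%MS) ->
    Defs.orbit Y x y -> (mv E0 y *m flow_diff Y t y :=: mv E0 (flow Y t y))%MS.
  move=> h1 h2 [s _ ey].
  have E1 := mvE E0 (t + s) h1 h2; rewrite (flowD hY t s hx) ey in E1.
  have E2 := mvE E0 s h1 h2; rewrite ey in E2.
  have e3 := flow_diffD_mx hY hx t s h1; rewrite ey in e3.
  apply: eqmx_sym; apply: (eqmx_trans E1); rewrite e3.
  apply/eqmxP; move: E2 => /eqmxP/andP[i1 i2].
  by apply/andP; split; apply: submxMr; [exact: i2|exact: i1].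
have [K1 K10 hK1] := rnorm_le hg C0.
have orbit_pt y v (E0 : 'M[R]_4) : Defs.orbit Y x y -> (E0 <= W)%MS -> (v <= mv E0 y)%MS ->
    exists2 w : V, (w <= E0)%MS & [/\ sphere3 y, dot v y = 0, v = w *m G (tau y) &
      forall t, v *m flow_diff Y t y = w *m G (t + tau y)].
  move=> oy E0W vE; have [/andP[s0 sT] ey] := htau' y oy.
  move: vE; rewrite /mv; set s := tau y in s0 sT ey *.
  move=> /submxP[c]; rewrite mulmxA; have : (c *m E0 <= E0)%MS by exact: submxMl.
  move: (c *m E0) => w wE vw; exists w; first exact: wE.
  have wx := tW _ (submx_trans wE E0W).
  have yS : sphere3 y by rewrite -ey; exact: flow_sphere.
  have vy : dot v y = 0 by rewrite vw -ey; exact: flow_diff_tangent.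
  have e3 t := flow_diffD hY t s hx wx; rewrite ey in e3.
  split; [exact: yS|exact: vy|exact: vw|].
  by move=> t; rewrite vw; exact: esym (e3 t).
have contr y v t : Defs.orbit Y x y -> (v <= mv Es y)%MS -> 0 <= t ->
    rnorm g (flow Y t y) (v *m flow_diff Y t y) <= K1 * expR (- (l * t)) * rnorm g y v.
  move=> oy vE t0; have [st _] := htau' y oy.
  have [w wE [yS vy vw e1]] := orbit_pt y v Es oy EsW vE.
  apply: hK1; [exact: flow_sphere|exact: yS|exact: flow_diff_tangent|exact: vy|exact: expR_ge0|].
  by have [h _] := hE (tau y) t w st t0; rewrite e1 vw; exact: h.
have expa y v t : Defs.orbit Y x y -> (v <= mv Eu y)%MS -> 0 <= t ->
    rnorm g y v <= K1 * expR (- (l * t)) * rnorm g (flow Y t y) (v *m flow_diff Y t y).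
  move=> oy vE t0; have [st _] := htau' y oy.
  have [w wE [yS vy vw e1]] := orbit_pt y v Eu oy EuW vE.
  apply: hK1; [exact: yS|exact: flow_sphere|exact: vy|exact: flow_diff_tangent|exact: expR_ge0|].
  by have [_ h] := hE (tau y) t w st t0; rewrite e1 vw; exact: h.
split.
  split; [exact: orbit_sphere|exact: (orbit_compact hY hx T0 xT)|exact: orbit_invariant].
exists (mv Es), (fun y => <<Y y>>%MS), (mv Eu), K1, l; split.
- by [].
- split.
  + by apply: (bundle_on_orbit hY hx T0 xT Esx) => t; exact: mvE.
  + by apply: (bundle_on_orbit hY hx T0 xT Yxt) => t; exact: Yeq.
  + by apply: (bundle_on_orbit hY hx T0 xT Eux) => t; exact: mvE.
- split.
  + by move=> y t oy; exact: iv.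
  + move=> y t oy; have yS := orbit_sphere hY hx oy.
    apply: (eqmx_trans _ (eqmx_sym (genmxE _))).
    rewrite -(flow_diff_field hY t yS).
    by apply/eqmxP/andP; split; apply: submxMr; rewrite genmxE.
  + by move=> y t oy; exact: iv.
- move=> y oy; have yS := orbit_sphere hY hx oy.
  have [s _ ey] := oy.
  have A1 : (mv Es y :=: Es *m G s)%MS by rewrite -ey; exact: mvE.
  have A2 : (<<Y y>> :=: Y x *m G s)%MS by rewrite -ey; exact: Yeq.
  have A3 : (mv Eu y :=: Eu *m G s)%MS by rewrite -ey; exact: mvE.
  have r1 : \rank (mv Es y) = \rank Es by rewrite A1 (flow_diff_rank hY hx s Esx).
  have r2 : \rank <<Y y>>%MS = \rank (Y x) by rewrite A2 (flow_diff_rank hY hx s Yxt).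
  have r3 : \rank (mv Eu y) = \rank Eu by rewrite A3 (flow_diff_rank hY hx s Eux).
  have Sx : (Es + Y x + Eu :=: tangent x)%MS.
    apply: eqmx_trans WY; apply: (eqmx_trans (B := (Es + Eu + Y x)%MS)).
      by rewrite -!addsmxA (addsmxC (Y x)).
    exact: adds_eqmx.
  have Sy : (mv Es y + <<Y y>> + mv Eu y :=: (Es + Y x + Eu)%MS *m G s)%MS.
    apply: eqmx_sym; apply: (eqmx_trans (addsmxMr _ _ _)); apply: adds_eqmx; last exact: eqmx_sym.
    by apply: (eqmx_trans (addsmxMr _ _ _)); apply: adds_eqmx; exact: eqmx_sym.
  have Sxt : ((Es + Y x + Eu)%MS <= tangent x)%MS by rewrite Sx.
  have rS : \rank (mv Es y + <<Y y>> + mv Eu y)%MS = 3%N.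
    by rewrite Sy (flow_diff_rank hY hx s Sxt) Sx tangent_rank.
  split.
    apply/eqmxP.
    have sub : ((mv Es y + <<Y y>> + mv Eu y)%MS <= tangent y)%MS.
      by rewrite Sy -ey; exact: flow_diff_tangent_mx.
    by rewrite sub/= -(geq_leqif (mxrank_leqif_sup sub)) rS tangent_rank.
  have rE : (\rank Es + \rank (Y x) + \rank Eu)%N = 3%N.
    have := tangent_rank hx; rewrite -WY (mxrank_disjoint_sum WY0) -EW.
    move=> e; apply: etrans e.
    move: dir; rewrite mxdirectE /= => /eqP ->.
    by rewrite addnAC.
  by rewrite mxdirectE /= rS r1 r2 r3 rE.
- split.
  + exact: contr.
  + by move=> y oy; exact: genmxE.
  + move=> y v t oy vE t0.
    have h := expa y v t oy vE t0.
    rewrite -mulrA ler_pdivrMl// -ler_pdivlMl ?expR_gt0// -expRN.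
    by rewrite mulrCA mulrA.
Qed.

End HyperbolicOrbit.

Transparent flow_diff sphere_diff flow mulmx dot.

(** * The vector field *)

Reserved Notation "x $ k" (at level 1, k at level 0, left associativity, format "x $ k").

Section Coordinates.
Variable R : realType.
Local Notation V := 'rV[R]_4.
Local Notation "x $ k" := (x (0 : 'I_1) (inord k : 'I_4)) : ring_scope.

Definition vec4 (a b c d : R) : V := \row_i nth 0 [:: a; b; c; d] i.

Lemma vec4_0 a b c d : (vec4 a b c d)$0 = a. Proof. by rewrite mxE inordK. Qed.
Lemma vec4_1 a b c d : (vec4 a b c d)$1 = b. Proof. by rewrite mxE inordK. Qed.
Lemma vec4_2 a b c d : (vec4 a b c d)$2 = c. Proof. by rewrite mxE inordK. Qed.
Lemma vec4_3 a b c d : (vec4 a b c d)$3 = d. Proof. by rewrite mxE inordK. Qed.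
Definition vec4E := (vec4_0, vec4_1, vec4_2, vec4_3).

Lemma ord4P (P : 'I_4 -> Prop) : P (inord 0) -> P (inord 1) -> P (inord 2) -> P (inord 3) ->
  forall i, P i.
Proof.
move=> h0 h1 h2 h3 i; rewrite -(inord_val i).
by case: i => -[|[|[|[|]]]].
Qed.

Lemma vec4P (x y : V) : x$0 = y$0 -> x$1 = y$1 -> x$2 = y$2 -> x$3 = y$3 -> x = y.
Proof. by move=> h0 h1 h2 h3; apply/rowP; exact: ord4P. Qed.

Lemma sum4 (F : 'I_4 -> R) : \sum_i F i = F (inord 0) + F (inord 1) + F (inord 2) + F (inord 3).
Proof.
rewrite !big_ord_recl big_ord0 addr0 !addrA.
by congr (F _ + F _ + F _ + F _); apply/val_inj; rewrite /= inordK.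
Qed.

Lemma dot4 (u v : V) : dot u v = u$0 * v$0 + u$1 * v$1 + u$2 * v$2 + u$3 * v$3.
Proof. by rewrite dotE sum4. Qed.

Lemma vec4D u v k : (u + v : V)$k = u$k + v$k. Proof. by rewrite mxE. Qed.
Lemma vec4N u k : (- u : V)$k = - u$k. Proof. by rewrite mxE. Qed.
Lemma vec4Z (a : R) u k : (a *: u : V)$k = a * u$k. Proof. by rewrite mxE. Qed.
Definition coordE := (vec4E, vec4D, vec4N, vec4Z).

(** [g] is the scalar product of [x] with the cubic part of the field;
    subtracting it from each rate makes the field tangent to S^3. The row of
    coefficients in the rate of [x_i] gives the eigenvalues in the direction
    [e_i] at the other vertices. *)
Definition cycle_field (x : V) : V :=
  let g := 6 * ((x$1 * x$3) ^+ 2 - (x$0 * x$2) ^+ 2) in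
  vec4 (x$0 * (- 2 * x$1 ^+ 2 - 3 * x$2 ^+ 2 + x$3 ^+ 2 - g))
       (x$1 * (2 * x$0 ^+ 2 - x$2 ^+ 2 + 3 * x$3 ^+ 2 - g))
       (x$2 * (- 3 * x$0 ^+ 2 + x$1 ^+ 2 - 2 * x$3 ^+ 2 - g))
       (x$3 * (- x$0 ^+ 2 + 3 * x$1 ^+ 2 + 2 * x$2 ^+ 2 - g)).

Local Notation X := cycle_field.

(** The differential of the polynomial field on R^4; [sphere_diff] is that of
    its extension by [normalize], see [sphere_diff_X]. *)
Definition dX (x v : V) : V :=
  let g := 6 * ((x$1 * x$3) ^+ 2 - (x$0 * x$2) ^+ 2) in
  let dg := 12 * (x$1 * x$3 * (v$1 * x$3 + x$1 * v$3) - x$0 * x$2 * (v$0 * x$2 + x$0 * v$2)) in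
  vec4 (v$0 * (- 2 * x$1 ^+ 2 - 3 * x$2 ^+ 2 + x$3 ^+ 2 - g) +
          x$0 * (- 4 * (x$1 * v$1) - 6 * (x$2 * v$2) + 2 * (x$3 * v$3) - dg))
       (v$1 * (2 * x$0 ^+ 2 - x$2 ^+ 2 + 3 * x$3 ^+ 2 - g) +
          x$1 * (4 * (x$0 * v$0) - 2 * (x$2 * v$2) + 6 * (x$3 * v$3) - dg))
       (v$2 * (- 3 * x$0 ^+ 2 + x$1 ^+ 2 - 2 * x$3 ^+ 2 - g) +
          x$2 * (- 6 * (x$0 * v$0) + 2 * (x$1 * v$1) - 4 * (x$3 * v$3) - dg))
       (v$3 * (- x$0 ^+ 2 + 3 * x$1 ^+ 2 + 2 * x$2 ^+ 2 - g) +
          x$3 * (- 2 * (x$0 * v$0) + 6 * (x$1 * v$1) + 4 * (x$2 * v$2) - dg)).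

Local Notation p k := (fun y : V => y$k).

(** Stable under the ring operations, so that the differential of a polynomial
    function is found by recursion on its expression. *)
Definition has_diff (f : V -> R) (df : V -> V -> R) :=
  forall x, differentiable f x /\ forall v, is_derive x v f (df x v).

Lemma has_diff_coord k : has_diff (p k) (fun _ v => v$k).
Proof. by move=> x; split => [|v]; [exact: differentiable_coord|exact: is_derive_coord]. Qed.

Lemma has_diffM f df g dg : has_diff f df -> has_diff g dg ->
  has_diff (fun x => f x * g x) (fun x v => df x v * g x + f x * dg x v).
Proof.
move=> hf hg x; have [f1 f2] := hf x; have [g1 g2] := hg x; split => [|v].
  exact: differentiableM.
have f3 := f2 v; have g3 := g2 v.
by apply: is_derive_eq; rewrite /GRing.scale/=; ring.
Qed.

Lemma has_diffB f df g dg : has_diff f df -> has_diff g dg ->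
  has_diff (fun x => f x - g x) (fun x v => df x v - dg x v).
Proof.
move=> hf hg x; have [f1 f2] := hf x; have [g1 g2] := hg x; split => [|v].
  exact: differentiableB.
by have f3 := f2 v; have g3 := g2 v; exact: is_deriveB.
Qed.

Lemma has_diffD f df g dg : has_diff f df -> has_diff g dg ->
  has_diff (fun x => f x + g x) (fun x v => df x v + dg x v).
Proof.
move=> hf hg x; have [f1 f2] := hf x; have [g1 g2] := hg x; split => [|v].
  exact: differentiableD.
by have f3 := f2 v; have g3 := g2 v; exact: is_deriveD.
Qed.

Lemma has_diff_cst (c : R) : has_diff (fun=> c) (fun _ _ => 0).
Proof. by move=> x; split => [|v]; [exact: differentiable_cst|exact: is_derive_cst]. Qed.

Lemma has_diff_eq f f' df df' : has_diff f df -> (forall x, f x = f' x) -> (forall x v, df x v = df' x v) ->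
  has_diff f' df'.
Proof.
move=> h /funext <- e x; have [h1 h2] := h x; split => // v.
by rewrite -e.
Qed.

Lemma has_diff_deq f df df' : has_diff f df -> (forall x v, df x v = df' x v) -> has_diff f df'.
Proof. by move=> h e; exact: has_diff_eq h _ e. Qed.

Ltac has_diff_tac := first [exact: has_diff_coord | exact: has_diff_cst |
  (apply: has_diffM; has_diff_tac) | (apply: has_diffB; has_diff_tac) | (apply: has_diffD; has_diff_tac)].

(** The common shape of the four coordinates of the field. *)
Lemma has_diff_row (k0 k1 k2 k3 k4 : R) (i : nat) :
  has_diff (fun x => x$i * (k0 * (x$0 * x$0) + k1 * (x$1 * x$1) + k2 * (x$2 * x$2) + k3 * (x$3 * x$3)
    - k4 * ((x$1 * x$3) * (x$1 * x$3) - (x$0 * x$2) * (x$0 * x$2))))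
   (fun x v => v$i * (k0 * (x$0 * x$0) + k1 * (x$1 * x$1) + k2 * (x$2 * x$2) + k3 * (x$3 * x$3)
    - k4 * ((x$1 * x$3) * (x$1 * x$3) - (x$0 * x$2) * (x$0 * x$2))) +
    x$i * (2 * k0 * (x$0 * v$0) + 2 * k1 * (x$1 * v$1) + 2 * k2 * (x$2 * v$2) + 2 * k3 * (x$3 * v$3)
    - 2 * k4 * ((x$1 * x$3) * (v$1 * x$3 + x$1 * v$3) - (x$0 * x$2) * (v$0 * x$2 + x$0 * v$2)))).
Proof.
apply: has_diff_deq; first by has_diff_tac.
by move=> x v /=; ring.
Qed.

Lemma has_diff_X i : has_diff (fun x => X x 0 i) (fun x v => dX x v 0 i).
Proof.
elim/ord4P: i.
- apply: has_diff_eq (has_diff_row 0 (-2) (-3) 1 6 0) _ _ => [x|x v]; rewrite !coordE; ring.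
- apply: has_diff_eq (has_diff_row 2 0 (-1) 3 6 1) _ _ => [x|x v]; rewrite !coordE; ring.
- apply: has_diff_eq (has_diff_row (-3) 1 0 (-2) 6 2) _ _ => [x|x v]; rewrite !coordE; ring.
- apply: has_diff_eq (has_diff_row (-1) 3 2 0 6 3) _ _ => [x|x v]; rewrite !coordE; ring.
Qed.

Lemma differentiable_X x : differentiable X x.
Proof. by apply: differentiable_rV => i; have [] := has_diff_X i x. Qed.

Lemma is_derive_X x v : is_derive x v X (dX x v).
Proof. by apply: is_derive_rV => i; have [_] := has_diff_X i x; apply. Qed.

Lemma X_tangent x : sphere3 x -> dot (X x) x = 0.
Proof.
rewrite /sphere3/= !dot4 !vec4E => e.
set g := 6 * _.
transitivity (g * (1 - (x$0 * x$0 + x$1 * x$1 + x$2 * x$2 + x$3 * x$3))).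
  by rewrite /g; ring.
by rewrite e subrr mulr0.
Qed.

Local Notation dn x v := (rho x *: v - (rho x ^+ 3 * dot x v) *: x).

Lemma X_normalize_derive x v : x != 0 ->
  is_derive x v (X \o @normalize R) (dX (normalize x) (dn x v)).
Proof.
move=> x0; have n := differentiable_normalize x0.
have dX := differentiable_X (normalize x).
have d : differentiable (X \o @normalize R) x by exact: differentiable_comp.
apply: DeriveDef; first exact: diff_derivable.
rewrite deriveE// diff_comp//= -deriveE// -deriveE//.
by have -> := @derive_val _ _ _ _ _ _ _ (is_derive_normalize v x0);
   have -> := @derive_val _ _ _ _ _ _ _ (is_derive_X _ _).
Qed.

Section ContinuousAt.
Variables (T : topologicalType) (x : T).
Implicit Types f g : T -> R.
(** Continuity at a point as a predicate of the function, to be decomposed by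
    recursion on its expression. *)
Definition cont_at f : Prop := {for x, continuous f}.

Lemma cont_atD f g : cont_at f -> cont_at g -> cont_at (fun y => f y + g y).
Proof. by move=> cf cg; exact: (cvgD cf cg). Qed.

Lemma cont_atN f : cont_at f -> cont_at (fun y => - f y).
Proof. by move=> cf; exact: (cvgN cf). Qed.

Lemma cont_atM f g : cont_at f -> cont_at g -> cont_at (fun y => f y * g y).
Proof. exact: continuous_mulf. Qed.

Lemma cont_atC (a : R) : cont_at (fun=> a).
Proof. exact: cvg_cst. Qed.

Lemma cont_at_ext f g : (forall y, g y = f y) -> cont_at f -> cont_at g.
Proof. by move=> /funext ->. Qed.
End ContinuousAt.

Ltac cont_tac := lazymatch goal with
  | |- cont_at _ (fun y => @GRing.add _ (@?a y) (@?b y)) => apply: (@cont_atD _ _ a b); cont_tac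
  | |- cont_at _ (fun y => @GRing.mul _ (@?a y) (@?b y)) => apply: (@cont_atM _ _ a b); cont_tac
  | |- cont_at _ (fun y => @GRing.opp _ (@?a y)) => apply: (@cont_atN _ _ a); cont_tac
  | |- _ => first [assumption | exact: cont_atC]
  end.

(** One coordinate of [dX], with the coordinates of [x] and [v] as independent
    variables and the coefficients of the rate as parameters. *)
Definition drow (k0 k1 k2 k3 x0 x1 x2 x3 v0 v1 v2 v3 xi vi : R) : R :=
  vi * (k0 * (x0 * x0) + k1 * (x1 * x1) + k2 * (x2 * x2) + k3 * (x3 * x3)
    + - (6 * ((x1 * x3) * (x1 * x3) + - ((x0 * x2) * (x0 * x2))))) +
  xi * (2 * k0 * (x0 * v0) + 2 * k1 * (x1 * v1) + 2 * k2 * (x2 * v2) + 2 * k3 * (x3 * v3)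
    + - (12 * ((x1 * x3) * (v1 * x3 + x1 * v3) + - ((x0 * x2) * (v0 * x2 + x0 * v2))))).

Lemma continuous_drow (T : topologicalType) (k0 k1 k2 k3 : R)
    (x0 x1 x2 x3 v0 v1 v2 v3 xi vi : T -> R) (x : T) :
  cont_at x x0 -> cont_at x x1 -> cont_at x x2 -> cont_at x x3 ->
  cont_at x v0 -> cont_at x v1 -> cont_at x v2 -> cont_at x v3 ->
  cont_at x xi -> cont_at x vi ->
  cont_at x (fun y => drow k0 k1 k2 k3 (x0 y) (x1 y) (x2 y) (x3 y) (v0 y) (v1 y)
    (v2 y) (v3 y) (xi y) (vi y)).
Proof. by move=> *; rewrite /drow; cont_tac. Qed.

Lemma dX_drow0 x v : dX x v 0 (inord 0) =
  drow 0 (-2) (-3) 1 (x$0) (x$1) (x$2) (x$3) (v$0) (v$1) (v$2) (v$3) (x$0) (v$0).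
Proof. by rewrite /drow vec4E; ring. Qed.
Lemma dX_drow1 x v : dX x v 0 (inord 1) =
  drow 2 0 (-1) 3 (x$0) (x$1) (x$2) (x$3) (v$0) (v$1) (v$2) (v$3) (x$1) (v$1).
Proof. by rewrite /drow vec4E; ring. Qed.
Lemma dX_drow2 x v : dX x v 0 (inord 2) =
  drow (-3) 1 0 (-2) (x$0) (x$1) (x$2) (x$3) (v$0) (v$1) (v$2) (v$3) (x$2) (v$2).
Proof. by rewrite /drow vec4E; ring. Qed.
Lemma dX_drow3 x v : dX x v 0 (inord 3) =
  drow (-1) 3 2 0 (x$0) (x$1) (x$2) (x$3) (v$0) (v$1) (v$2) (v$3) (x$3) (v$3).
Proof. by rewrite /drow vec4E; ring. Qed.

Lemma continuous_dX (T : topologicalType) (f h : T -> V) (x : T) :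
  {for x, continuous f} -> {for x, continuous h} ->
  {for x, continuous (fun y => dX (f y) (h y))}.
Proof.
move=> cf ch; apply: continuous_mx => i j; rewrite (ord1 i).
have c k : cont_at x (fun y => (f y)$k) by exact: continuous_entry.
have d k : cont_at x (fun y => (h y)$k) by exact: continuous_entry.
have H (k0 k1 k2 k3 : R) (k : nat) := @continuous_drow T k0 k1 k2 k3 _ _ _ _ _ _ _ _ _ _ x (c 0%N) (c 1%N) (c 2%N) (c 3%N)
  (d 0%N) (d 1%N) (d 2%N) (d 3%N) (c k) (d k).
elim/ord4P: j.
- exact: (cont_at_ext (fun y => dX_drow0 (f y) (h y)) (H _ _ _ _ 0%N)).
- exact: (cont_at_ext (fun y => dX_drow1 (f y) (h y)) (H _ _ _ _ 1%N)).
- exact: (cont_at_ext (fun y => dX_drow2 (f y) (h y)) (H _ _ _ _ 2%N)).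
- exact: (cont_at_ext (fun y => dX_drow3 (f y) (h y)) (H _ _ _ _ 3%N)).
Qed.

Lemma continuous_scalef (T : topologicalType) (a : T -> R) (f : T -> V) (x : T) :
  {for x, continuous a} -> {for x, continuous f} -> {for x, continuous (fun y => a y *: f y)}.
Proof. by move=> ca cf; exact: (cvgZ ca cf). Qed.

Lemma continuous_subv (T : topologicalType) (f h : T -> V) (x : T) :
  {for x, continuous f} -> {for x, continuous h} -> {for x, continuous (fun y => f y - h y)}.
Proof. by move=> cf ch; exact: (cvgB cf ch). Qed.

Lemma vector_field_X : vector_field X.
Proof.
split=> [x hx|]; first by rewrite tangentE X_tangent.
split=> [x x0|v x x0].
  by apply: differentiable_comp; [exact: differentiable_normalize|exact: differentiable_X].
have cid : {for x, continuous (fun y : V => y)} by exact: cvg_id.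
have cv : {for x, continuous (fun _ : V => v)} by exact: continuous_cst_at.
have cr := continuous_rho x0.
apply: (@continuous_near_eq _ _ _ (fun y => dX (normalize y) (dn y v))).
  apply: continuous_dX.
    exact: (continuous_scalef cr cid).
  apply: continuous_subv; apply: continuous_scalef => //.
  apply: continuous_mulf; last exact: continuous_dot.
  by apply: continuous_mulf => //; apply: continuous_mulf.
apply: filterS (near_neq0 x0) => y y0.
by have -> := @derive_val _ _ _ _ _ _ _ (X_normalize_derive v y0).
Qed.

Lemma sphere_diff_X x v : sphere3 x -> v *m sphere_diff X x = dX x (v - dot v x *: x).
Proof.
move=> hx; have x0 := sphere_neq0 hx.
have := X_normalize_derive v x0; rewrite rho_sphere// normalize_id// expr1n mul1r scale1r (dotC x v).
move=> h; have e := @derive_val _ _ _ _ _ _ _ h.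
rewrite -e deriveE; last exact: (field_diff vector_field_X).
by rewrite /sphere_diff mul_rV_lin1.
Qed.

End Coordinates.

(** * Lyapunov functions and quadratic forms for the vector field *)

Section Forms.
Variable R : realType.
Local Notation V := 'rV[R]_4.
Local Notation "x $ k" := (x (0 : 'I_1) (inord k : 'I_4)) : ring_scope.
Local Notation X := (@cycle_field R).
Implicit Types x p v : V.

(** The signs alternate along the cycle, so that on the arc from [e_i] to
    [e_(i+1)] the plane normal to the arc contains a direction of each
    sign. *)
Definition eps : 'M[R]_4 := diag_mx (vec4 1 (-1) 1 (-1)).

Lemma mul_eps p : p *m eps = vec4 (p$0) (- p$1) (p$2) (- p$3).
Proof.
rewrite mul_mx_diag; apply: vec4P; rewrite vec4E !mxE !inordK//=; ring.
Qed.

Lemma mul_outer v (a b : V) : v *m (a^T *m b) = dot v a *: b.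
Proof. by rewrite mulmxA [v *m a^T]mx11_scalar mul_scalar_mx. Qed.

Lemma vec4_eta x : x = vec4 (x$0) (x$1) (x$2) (x$3).
Proof. by apply: vec4P; rewrite vec4E. Qed.

Lemma vec4_opp (a b c d : R) : - vec4 a b c d = vec4 (- a) (- b) (- c) (- d).
Proof. by apply: vec4P; rewrite !coordE. Qed.

Lemma vec4_add (a b c d a' b' c' d' : R) :
  vec4 a b c d + vec4 a' b' c' d' = vec4 (a + a') (b + b') (c + c') (d + d').
Proof. by apply: vec4P; rewrite !coordE. Qed.

Lemma vec4_scale (k a b c d : R) : k *: vec4 a b c d = vec4 (k * a) (k * b) (k * c) (k * d).
Proof. by apply: vec4P; rewrite !coordE. Qed.

Lemma vec4_dot (a b c d a' b' c' d' : R) :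
  dot (vec4 a b c d) (vec4 a' b' c' d') = a * a' + b * b' + c * c' + d * d'.
Proof. by rewrite dot4 !vec4E. Qed.

Lemma X_vec4 (a b c d : R) : X (vec4 a b c d) =
  vec4 (a * (- 2 * b ^+ 2 - 3 * c ^+ 2 + d ^+ 2 - 6 * ((b * d) ^+ 2 - (a * c) ^+ 2)))
       (b * (2 * a ^+ 2 - c ^+ 2 + 3 * d ^+ 2 - 6 * ((b * d) ^+ 2 - (a * c) ^+ 2)))
       (c * (- 3 * a ^+ 2 + b ^+ 2 - 2 * d ^+ 2 - 6 * ((b * d) ^+ 2 - (a * c) ^+ 2)))
       (d * (- a ^+ 2 + 3 * b ^+ 2 + 2 * c ^+ 2 - 6 * ((b * d) ^+ 2 - (a * c) ^+ 2))).
Proof. by rewrite /cycle_field !vec4E. Qed.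

Lemma dX_vec4 (a b c d v0 v1 v2 v3 : R) : dX (vec4 a b c d) (vec4 v0 v1 v2 v3) =
  vec4 (drow 0 (-2) (-3) 1 a b c d v0 v1 v2 v3 a v0)
       (drow 2 0 (-1) 3 a b c d v0 v1 v2 v3 b v1)
       (drow (-3) 1 0 (-2) a b c d v0 v1 v2 v3 c v2)
       (drow (-1) 3 2 0 a b c d v0 v1 v2 v3 d v3).
Proof.
by apply: vec4P; rewrite (dX_drow0, dX_drow1, dX_drow2, dX_drow3) !vec4E.
Qed.

Lemma eps_vec4 (a b c d : R) : vec4 a b c d *m eps = vec4 a (- b) c (- d).
Proof. by rewrite mul_eps !vec4E. Qed.

Definition vec4_calc := (eps_vec4, vec4_scale, vec4_opp, vec4_add, dX_vec4, X_vec4, vec4_dot).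

Definition trX x : R := (dX x (vec4 1 0 0 0 - x$0 *: x))$0 + (dX x (vec4 0 1 0 0 - x$1 *: x))$1 +
  (dX x (vec4 0 0 1 0 - x$2 *: x))$2 + (dX x (vec4 0 0 0 1 - x$3 *: x))$3.

Lemma tr_sphere_diff_X x : sphere3 x -> \tr (sphere_diff X x) = trX x.
Proof.
move=> hx.
have h (i : 'I_4) : sphere_diff X x i i = (dX x (delta_mx 0 i - x 0 i *: x)) 0 i.
  have e : dot (delta_mx 0 i) x = x 0 i by rewrite /dot -rowE !mxE.
  have E := sphere_diff_X (delta_mx 0 i) hx; rewrite e in E; rewrite -E -rowE.
  by rewrite [RHS]mxE.
rewrite /mxtrace sum4 !h /trX.
have e (i : 'I_4) : delta_mx 0 i = vec4 ((i == 0%N :> nat)%:R) ((i == 1%N :> nat)%:R)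
    ((i == 2%N :> nat)%:R) ((i == 3%N :> nat)%:R) :> V.
  apply/rowP => j; rewrite mxE eqxx /= mxE.
  by elim/ord4P: j; rewrite inordK//= -val_eqE/= inordK// eq_sym.
by rewrite !e !inordK.
Qed.

(** The derivative along the flow of [Y] of the form with matrix [eps] on the
    cross product of a tangent vector, [Y] and [x]; see [transverse_flow]. *)
Definition transverse_form (Y : V -> V) x : 'M[R]_4 :=
  (2 * \tr (sphere_diff Y x)) *: eps - 2 *: (eps *m (sphere_diff Y x + x^T *m Y x)).

Lemma qf_transverse (Y : V -> V) x p : qf (transverse_form Y x) p =
  2 * \tr (sphere_diff Y x) * dot (p *m eps) p -
  2 * (dot (p *m eps *m sphere_diff Y x) p + dot (p *m eps) x * dot (Y x) p).
Proof.
rewrite /qf /transverse_form mulmxBr -!scalemxAr mulmxA mulmxDr mul_outer.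
by rewrite !dotlin; ring.
Qed.

(** The cross products are orthogonal to [X x], and the added term vanishes on
    such vectors. At the points of the cycle, including the zeros of [X], it
    makes the form positive on all vectors orthogonal to [x], and this
    persists for nearby points and fields. *)
Definition gamma_form x : 'M[R]_4 := transverse_form X x + 12 *: ((X x)^T *m X x).

Lemma qf_gamma x p : sphere3 x -> qf (gamma_form x) p =
  2 * trX x * dot (p *m eps) p -
  2 * (dot (dX x (p *m eps - dot (p *m eps) x *: x)) p + dot (p *m eps) x * dot (X x) p)
  + 12 * dot p (X x) ^+ 2.
Proof.
move=> hx; rewrite -tr_sphere_diff_X// -sphere_diff_X//.
rewrite /gamma_form {1}/qf mulmxDr dotDl.
rewrite -[dot (p *m transverse_form X x) p]/(qf (transverse_form X x) p) qf_transverse.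
by rewrite -scalemxAr mul_outer !dotlin (dotC (X x) p); ring.
Qed.

(** [s] is the component of (p, q) along the unit vector (-b, a). *)
Lemma arc_tangential (a b p q : R) : a ^+ 2 + b ^+ 2 = 1 -> p * a + q * b = 0 ->
  exists2 s, p = - (s * b) & q = s * a.
Proof.
move=> h1 h2; exists (q * a - p * b).
  have : p * (a ^+ 2 + b ^+ 2) = a * (p * a + q * b) - (q * a - p * b) * b by ring.
  by rewrite h1 h2 mulr0 mulr1 add0r.
have : q * (a ^+ 2 + b ^+ 2) = b * (p * a + q * b) + (q * a - p * b) * a by ring.
by rewrite h1 h2 mulr0 mulr1 add0r.
Qed.

(** On each circle of the cycle, the form splits into a term in the component
    [s] of [p] along the circle and terms in its two normal coordinates, and
    the lower bound leaves an explicit sum of squares. *)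
Lemma gamma_arc01 x p : sphere3 x -> dot p x = 0 -> x$2 = 0 -> x$3 = 0 ->
  2 * dot p p <= qf (gamma_form x) p.
Proof.
move=> hx hp h2 h3; rewrite qf_gamma//.
move: hx hp; rewrite /sphere3/= (vec4_eta x) (vec4_eta p) h2 h3.
move: (x$0) (x$1) (p$0) (p$1) (p$2) (p$3) => a b p0 p1 p2 p3.
rewrite /trX !vec4E !vec4_calc !vec4E /drow !mulr0 ?addr0 ?add0r -!expr2 => hx hp.
have [s -> ->] := arc_tangential hx hp.
have hb : b ^+ 2 = 1 - a ^+ 2 by rewrite -hx; ring.
rewrite -subr_ge0 [X in 0 <= X](_ : _ = s ^+ 2 * 6 + s ^+ 2 * 24 * (a ^+ 2 * b ^+ 2)); last by ring: hb.
by do ?[exact: sqr_ge0|exact: ler0n|apply: addr_ge0|apply: mulr_ge0].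
Qed.

Lemma gamma_arc12 x p : sphere3 x -> dot p x = 0 -> x$0 = 0 -> x$3 = 0 ->
  2 * dot p p <= qf (gamma_form x) p.
Proof.
move=> hx hp h0 h3; rewrite qf_gamma//.
move: hx hp; rewrite /sphere3/= (vec4_eta x) (vec4_eta p) h0 h3.
move: (x$1) (x$2) (p$0) (p$1) (p$2) (p$3) => a b p0 p1 p2 p3.
rewrite /trX !vec4E !vec4_calc !vec4E /drow !mulr0 ?addr0 ?add0r -!expr2 => hx hp.
have [s -> ->] := arc_tangential hx hp.
have hb : b ^+ 2 = 1 - a ^+ 2 by rewrite -hx; ring.
rewrite -subr_ge0 [X in 0 <= X](_ : _ = 6 * (a ^+ 2 * p0 ^+ 2) + 6 * (b ^+ 2 * p3 ^+ 2)); last by ring: hb.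
by do ?[exact: sqr_ge0|exact: ler0n|apply: addr_ge0|apply: mulr_ge0].
Qed.

Lemma gamma_arc23 x p : sphere3 x -> dot p x = 0 -> x$0 = 0 -> x$1 = 0 ->
  2 * dot p p <= qf (gamma_form x) p.
Proof.
move=> hx hp h0 h1; rewrite qf_gamma//.
move: hx hp; rewrite /sphere3/= (vec4_eta x) (vec4_eta p) h0 h1.
move: (x$2) (x$3) (p$0) (p$1) (p$2) (p$3) => a b p0 p1 p2 p3.
rewrite /trX !vec4E !vec4_calc !vec4E /drow !mulr0 ?addr0 ?add0r -!expr2 => hx hp.
have [s -> ->] := arc_tangential hx hp.
have hb : b ^+ 2 = 1 - a ^+ 2 by rewrite -hx; ring.
rewrite -subr_ge0 [X in 0 <= X](_ : _ = s ^+ 2 * 6 + s ^+ 2 * 24 * (a ^+ 2 * b ^+ 2)); last by ring: hb.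
by do ?[exact: sqr_ge0|exact: ler0n|apply: addr_ge0|apply: mulr_ge0].
Qed.

Lemma gamma_arc30 x p : sphere3 x -> dot p x = 0 -> x$1 = 0 -> x$2 = 0 ->
  2 * dot p p <= qf (gamma_form x) p.
Proof.
move=> hx hp h1 h2; rewrite qf_gamma//.
move: hx hp; rewrite /sphere3/= (vec4_eta x) (vec4_eta p) h1 h2.
move: (x$3) (x$0) (p$0) (p$1) (p$2) (p$3) => a b p0 p1 p2 p3.
rewrite /trX !vec4E !vec4_calc !vec4E /drow !mulr0 ?addr0 ?add0r -!expr2 => hx hp.
have [s -> ->] := arc_tangential hx hp.
have hb : b ^+ 2 = 1 - a ^+ 2 by rewrite -hx; ring.
rewrite -subr_ge0 [X in 0 <= X](_ : _ = 6 * (a ^+ 2 * p2 ^+ 2) + 6 * (b ^+ 2 * p1 ^+ 2)); last by ring: hb.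
by do ?[exact: sqr_ge0|exact: ler0n|apply: addr_ge0|apply: mulr_ge0].
Qed.

Lemma gamma_pos x p : sphere3 x -> dot p x = 0 -> x$1 * x$3 = 0 -> x$0 * x$2 = 0 ->
  2 * dot p p <= qf (gamma_form x) p.
Proof.
move=> hx hp /eqP; rewrite mulf_eq0 => /orP[] /eqP h1 /eqP; rewrite mulf_eq0 => /orP[] /eqP h2.
- exact: gamma_arc23.
- exact: gamma_arc30.
- exact: gamma_arc12.
- exact: gamma_arc01.
Qed.

(** [phi] and [psi] vanish together exactly on the cycle, and reach their
    maximum 1/4 at the sinks and at the sources respectively. *)
Definition phi x : R := (x$1 * x$3) ^+ 2.
Definition psi x : R := (x$0 * x$2) ^+ 2.
Definition dphi x v : R := 2 * (x$1 * x$3) * (v$1 * x$3 + x$1 * v$3).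
Definition dpsi x v : R := 2 * (x$0 * x$2) * (v$0 * x$2 + x$0 * v$2).

(** Half of the logarithmic derivatives of [phi] and [1 / psi] along the
    field, on the sphere. *)
Definition phi_rate x : R := (x$0 ^+ 2 + x$2 ^+ 2) * (3 * (x$1 ^+ 2 + x$3 ^+ 2) + 1)
  + 3 * (x$1 ^+ 2 - x$3 ^+ 2) ^+ 2 + 12 * psi x.
Definition psi_rate x : R := (x$1 ^+ 2 + x$3 ^+ 2) * (3 * (x$0 ^+ 2 + x$2 ^+ 2) + 1)
  + 3 * (x$0 ^+ 2 - x$2 ^+ 2) ^+ 2 + 12 * phi x.

Lemma dphi_X x : sphere3 x -> dphi x (X x) = 2 * phi x * phi_rate x.
Proof.
rewrite /sphere3/= dot4 -!expr2 => hx.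
have h : x$0 ^+ 2 = 1 - x$1 ^+ 2 - x$2 ^+ 2 - x$3 ^+ 2 by rewrite -hx; ring.
rewrite /dphi /phi_rate /psi /phi !vec4E; move: h.
move: (x$0) (x$1) (x$2) (x$3) => a b c d h.
by ring: h.
Qed.

Lemma dpsi_X x : sphere3 x -> dpsi x (X x) = - (2 * psi x * psi_rate x).
Proof.
rewrite /sphere3/= dot4 -!expr2 => hx.
have h : x$0 ^+ 2 = 1 - x$1 ^+ 2 - x$2 ^+ 2 - x$3 ^+ 2 by rewrite -hx; ring.
rewrite /dpsi /psi_rate /psi /phi !vec4E; move: h.
move: (x$0) (x$1) (x$2) (x$3) => a b c d h.
by ring: h.
Qed.

Lemma rate_eq0 (a b c d : R) : a ^+ 2 + b ^+ 2 + c ^+ 2 + d ^+ 2 = 1 ->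
  (a ^+ 2 + c ^+ 2) * (3 * (b ^+ 2 + d ^+ 2) + 1) + 3 * (b ^+ 2 - d ^+ 2) ^+ 2
    + 12 * (a * c) ^+ 2 <= 0 ->
  [/\ a = 0, c = 0, b ^+ 2 = 1 / 2 & d ^+ 2 = 1 / 2].
Proof.
move=> h h2.
have ha := sqr_ge0 a; have hb := sqr_ge0 b; have hc := sqr_ge0 c; have hd := sqr_ge0 d.
have hac := sqr_ge0 (a * c); have hbd := sqr_ge0 (b ^+ 2 - d ^+ 2).
have h3 : 0 <= (a ^+ 2 + c ^+ 2) * (3 * (b ^+ 2 + d ^+ 2)).
  by apply: mulr_ge0; [exact: addr_ge0|apply: mulr_ge0 => //; exact: addr_ge0].
have h4 : (a ^+ 2 + c ^+ 2) * (3 * (b ^+ 2 + d ^+ 2) + 1) =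
  (a ^+ 2 + c ^+ 2) * (3 * (b ^+ 2 + d ^+ 2)) + a ^+ 2 + c ^+ 2 by ring.
have a0 : a ^+ 2 = 0 by lra.
have c0 : c ^+ 2 = 0 by lra.
have bd0 : (b ^+ 2 - d ^+ 2) ^+ 2 = 0 by lra.
move: a0 c0 bd0 => /eqP; rewrite sqrf_eq0 => /eqP a0 /eqP; rewrite sqrf_eq0 => /eqP c0.
move=> /eqP; rewrite sqrf_eq0 => /eqP bd0.
by split=> //; rewrite a0 c0 in h; lra.
Qed.

Lemma phi_rate_eq0 x : sphere3 x -> phi_rate x <= 0 ->
  [/\ x$0 = 0, x$2 = 0, x$1 ^+ 2 = 1 / 2 & x$3 ^+ 2 = 1 / 2].
Proof. by rewrite /sphere3/= dot4 -!expr2 => hx; exact: rate_eq0. Qed.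

Lemma psi_rate_eq0 x : sphere3 x -> psi_rate x <= 0 ->
  [/\ x$1 = 0, x$3 = 0, x$0 ^+ 2 = 1 / 2 & x$2 ^+ 2 = 1 / 2].
Proof.
rewrite /sphere3/= dot4 -!expr2 => hx; apply: rate_eq0.
by rewrite -hx; ring.
Qed.

Lemma sink_diag x v : x$0 = 0 -> x$2 = 0 -> x$1 ^+ 2 = 1 / 2 -> x$3 ^+ 2 = 1 / 2 ->
  dX x v = vec4 (- 2 * v$0) (- 3 * v$1) (- 2 * v$2) (- 3 * v$3).
Proof.
move=> h0 h2 h1 h3; rewrite {1}(vec4_eta x) {1}(vec4_eta v) h0 h2 dX_vec4 /drow.
move: h1 h3.
move: (x$1) (x$3) (v$0) (v$1) (v$2) (v$3) => b d v0 v1 v2 v3 hb hd.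
have half : 2 * (1 / 2) = 1 :> R by field.
move: (1 / 2) half hb hd => h half hb hd.
transitivity (vec4 (v0 * (- h - 6 * h ^+ 2)) (v1 * (3 * h - 18 * h ^+ 2) + 6 * (b * d * v3) * (1 - 2 * h))
   (v2 * (- h - 6 * h ^+ 2)) (v3 * (3 * h - 18 * h ^+ 2) + 6 * (b * d * v1) * (1 - 2 * h))).
  by congr vec4; ring: hb hd.
have -> : h = 1 / 2 by lra.
by congr vec4; field.
Qed.

Lemma source_diag x v : x$1 = 0 -> x$3 = 0 -> x$0 ^+ 2 = 1 / 2 -> x$2 ^+ 2 = 1 / 2 ->
  dX x v = vec4 (3 * v$0) (2 * v$1) (3 * v$2) (2 * v$3).
Proof.
move=> h0 h2 h1 h3; rewrite {1}(vec4_eta x) {1}(vec4_eta v) h0 h2 dX_vec4 /drow.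
move: h1 h3.
move: (x$0) (x$2) (v$0) (v$1) (v$2) (v$3) => b d v0 v1 v2 v3 hb hd.
have half : 2 * (1 / 2) = 1 :> R by field.
move: (1 / 2) half hb hd => h half hb hd.
transitivity (vec4 (v0 * (- 3 * h + 18 * h ^+ 2) - 6 * (b * d * v2) * (1 - 2 * h)) (v1 * (h + 6 * h ^+ 2))
   (v2 * (- 3 * h + 18 * h ^+ 2) - 6 * (b * d * v0) * (1 - 2 * h)) (v3 * (h + 6 * h ^+ 2))).
  by congr vec4; ring: hb hd.
have -> : h = 1 / 2 by lra.
by congr vec4; field.
Qed.

(** The differential at a zero is diagonal in the standard basis, with
    eigenvalues of modulus at least 1. At [+-e_i], where the vectors
    orthogonal to [x] have i-th coordinate 0, the i-th entry is set to 1. *)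
Definition diag_hyperbolic x := exists l0 l1 l2 l3 : R,
  [/\ 1 <= l0 ^+ 2, 1 <= l1 ^+ 2, 1 <= l2 ^+ 2 & 1 <= l3 ^+ 2] /\
  forall v, dot v x = 0 -> dX x v = vec4 (l0 * v$0) (l1 * v$1) (l2 * v$2) (l3 * v$3).

Lemma vertex_diag x : sphere3 x ->
  [\/ [/\ x$1 = 0, x$2 = 0 & x$3 = 0], [/\ x$0 = 0, x$2 = 0 & x$3 = 0],
      [/\ x$0 = 0, x$1 = 0 & x$3 = 0] | [/\ x$0 = 0, x$1 = 0 & x$2 = 0]] ->
  diag_hyperbolic x.
Proof.
rewrite /sphere3/= dot4 -!expr2 => hx.
have key (a : R) : a ^+ 2 = 1 -> forall b, b * a = 0 -> b = 0.
  move=> ha b /eqP; rewrite mulf_eq0 => /orP[/eqP //|/eqP a0].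
  by move/eqP: ha; rewrite a0 expr0n eq_sym oner_eq0.
case=> -[h1 h2 h3]; rewrite h1 h2 h3 expr0n ?addr0 ?add0r in hx.
- exists 1, 2, (-3), (-1); split; first by split; rewrite ?sqrrN; lra.
  move=> v; rewrite dot4 h1 h2 h3 !mulr0 ?addr0 ?add0r => /(key _ hx) e.
  rewrite {1}(vec4_eta x) {1}(vec4_eta v) h1 h2 h3 e dX_vec4 /drow.
  by congr vec4; ring: hx.
- exists (-2), 1, 1, 3; split; first by split; rewrite ?sqrrN; lra.
  move=> v; rewrite dot4 h1 h2 h3 !mulr0 ?addr0 ?add0r => /(key _ hx) e.
  rewrite {1}(vec4_eta x) {1}(vec4_eta v) h1 h2 h3 e dX_vec4 /drow.
  by congr vec4; ring: hx.
- exists (-3), (-1), 1, 2; split; first by split; rewrite ?sqrrN; lra.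
  move=> v; rewrite dot4 h1 h2 h3 !mulr0 ?addr0 ?add0r => /(key _ hx) e.
  rewrite {1}(vec4_eta x) {1}(vec4_eta v) h1 h2 h3 e dX_vec4 /drow.
  by congr vec4; ring: hx.
- exists 1, 3, (-2), 1; split; first by split; rewrite ?sqrrN; lra.
  move=> v; rewrite dot4 h1 h2 h3 !mulr0 ?addr0 ?add0r => /(key _ hx) e.
  rewrite {1}(vec4_eta x) {1}(vec4_eta v) h1 h2 h3 e dX_vec4 /drow.
  by congr vec4; ring: hx.
Qed.

Lemma prod0 (k a b : R) : k != 0 -> k * (a * b ^+ 2) = 0 -> (a == 0) || (b == 0).
Proof. by move=> k0 /eqP; rewrite mulf_eq0 (negbTE k0)/= mulf_eq0 sqrf_eq0. Qed.

(** Where the derivatives of [phi] and [psi] along the field vanish, the point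
    is a sink, a source, or lies on the cycle; the only zeros on the cycle are
    the vertices. *)
Lemma zero_diag x : sphere3 x -> X x = 0 -> diag_hyperbolic x.
Proof.
move=> hx X0.
have Xk k : (X x)$k = 0 by rewrite X0 mxE.
have := dphi_X hx; rewrite {1}/dphi !Xk !(mul0r, mulr0, addr0) => /esym/eqP.
rewrite -mulrA mulf_eq0 pnatr_eq0/= mulf_eq0 => /orP[/eqP p0|/eqP r0]; last first.
  have [h0 h2 h1 h3] : [/\ x$0 = 0, x$2 = 0, x$1 ^+ 2 = 1 / 2 & x$3 ^+ 2 = 1 / 2].
    by apply: phi_rate_eq0; rewrite ?r0.
  exists (-2), (-3), (-2), (-3); split; first by split; lra.
  by move=> v _; exact: sink_diag.
have := dpsi_X hx; rewrite {1}/dpsi !Xk !(mul0r, mulr0, addr0) => /esym/eqP.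
rewrite oppr_eq0 -mulrA mulf_eq0 pnatr_eq0/= mulf_eq0 => /orP[/eqP q0|/eqP r0]; last first.
  have [h0 h2 h1 h3] : [/\ x$1 = 0, x$3 = 0, x$0 ^+ 2 = 1 / 2 & x$2 ^+ 2 = 1 / 2].
    by apply: psi_rate_eq0; rewrite ?r0.
  exists 3, 2, 3, 2; split; first by split; lra.
  by move=> v _; exact: source_diag.
apply: vertex_diag => //.
move: p0 q0 => /eqP; rewrite sqrf_eq0 mulf_eq0 => /orP[] /eqP h1 /eqP;
  rewrite sqrf_eq0 mulf_eq0 => /orP[] /eqP h2.
- have := Xk 2%N; rewrite vec4E h1 h2 => e.
  have /orP[/eqP h3|/eqP h3] : (x$2 == 0) || (x$3 == 0) by apply: (@prod0 (-2)); [by rewrite oppr_eq0 pnatr_eq0|rewrite -[RHS]e; ring].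
  + by constructor 4.
  + by constructor 3.
- have := Xk 3%N; rewrite vec4E h1 h2 => e.
  have /orP[/eqP h3|/eqP h3] : (x$3 == 0) || (x$0 == 0) by apply: (@prod0 (-1)); [by rewrite oppr_eq0 oner_eq0|rewrite -[RHS]e; ring].
  + by constructor 1.
  + by constructor 4.
- have := Xk 1%N; rewrite vec4E h1 h2 => e.
  have /orP[/eqP h3|/eqP h3] : (x$1 == 0) || (x$2 == 0) by apply: (@prod0 (-1)); [by rewrite oppr_eq0 oner_eq0|rewrite -[RHS]e; ring].
  + by constructor 3.
  + by constructor 2.
- have := Xk 0%N; rewrite vec4E h1 h2 => e.
  have /orP[/eqP h3|/eqP h3] : (x$0 == 0) || (x$1 == 0) by apply: (@prod0 (-2)); [by rewrite oppr_eq0 pnatr_eq0|rewrite -[RHS]e; ring].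
  + by constructor 2.
  + by constructor 1.
Qed.

(** The derivative of [dot (v *m D) v] when v moves by the linear flow of D =
    [sphere_diff X x]. *)
Definition zero_form x : 'M[R]_4 :=
  sphere_diff X x *m sphere_diff X x + sphere_diff X x *m (sphere_diff X x)^T.

Lemma qf_outer_gram (D : 'M[R]_4) (E : 'M[R]_4) v :
  qf (D *m E + D *m E^T) v = dot (v *m D *m E) v + dot (v *m D) (v *m E).
Proof. by rewrite /qf mulmxDr dotDl !mulmxA [in X in _ + X = _]dot_mulmxr trmxK. Qed.

Lemma qf_zero x v : sphere3 x -> X x = 0 -> dot v x = 0 -> 2 * dot v v <= qf (zero_form x) v.
Proof.
move=> hx X0 vx; rewrite qf_outer_gram.
have [l0 [l1 [l2 [l3 [[h0 h1 h2 h3] hd]]]]] := zero_diag hx X0.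
have eD w : dot w x = 0 -> w *m sphere_diff X x = dX x w.
  by move=> e; rewrite sphere_diff_X// e scale0r subr0.
have tg : dot (v *m sphere_diff X x) x = 0.
  by have := sphere_diff_tangency (@vector_field_X R) v hx; rewrite X0 dot0l addr0.
rewrite (eD _ tg) (hd _ tg) (eD _ vx) (hd _ vx) !dot4 !vec4E.
set a := v$0; set b := v$1; set c := v$2; set d := v$3.
have ha := ler_wpM2r (sqr_ge0 a) h0; have hb := ler_wpM2r (sqr_ge0 b) h1.
have hc := ler_wpM2r (sqr_ge0 c) h2; have hd' := ler_wpM2r (sqr_ge0 d) h3.
have -> : l0 * (l0 * a) * a + l1 * (l1 * b) * b + l2 * (l2 * c) * c + l3 * (l3 * d) * d +
  (l0 * a * (l0 * a) + l1 * b * (l1 * b) + l2 * c * (l2 * c) + l3 * d * (l3 * d)) =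
  2 * (l0 ^+ 2 * a ^+ 2 + l1 ^+ 2 * b ^+ 2 + l2 ^+ 2 * c ^+ 2 + l3 ^+ 2 * d ^+ 2) by ring.
rewrite -!expr2; lra.
Qed.

Lemma phi_max x : sphere3 x -> phi x <= 1 / 4 /\ (1 / 4 <= phi x -> phi_rate x <= 0).
Proof.
rewrite /sphere3/= dot4 -!expr2 => hx; rewrite /phi_rate /psi /phi.
move: (x$0) (x$1) (x$2) (x$3) hx => a b c d hx.
have ha := sqr_ge0 a; have hc := sqr_ge0 c; have hb := sqr_ge0 b; have hd := sqr_ge0 d.
have e : (b * d) ^+ 2 = (b ^+ 2 + d ^+ 2) ^+ 2 / 4 - (b ^+ 2 - d ^+ 2) ^+ 2 / 4 by field.
have h1 := sqr_ge0 (b ^+ 2 - d ^+ 2).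
have q1 : b ^+ 2 + d ^+ 2 <= 1 by lra.
have h2 : (b ^+ 2 + d ^+ 2) ^+ 2 <= b ^+ 2 + d ^+ 2.
  by rewrite expr2 ler_piMr// addr_ge0.
split; first by rewrite e; lra.
rewrite {1}e => h.
have a0 : a ^+ 2 = 0 by lra.
have c0 : c ^+ 2 = 0 by lra.
by rewrite exprMn a0 c0; lra.
Qed.

Lemma psi_max x : sphere3 x -> psi x <= 1 / 4 /\ (1 / 4 <= psi x -> psi_rate x <= 0).
Proof.
rewrite /sphere3/= dot4 => hx.
have hy : sphere3 (vec4 (x$1) (x$0) (x$3) (x$2)).
  by rewrite /sphere3/= vec4_dot -hx; ring.
by have := phi_max hy; rewrite /phi /phi_rate /psi /psi_rate /phi !vec4E.
Qed.

(** Near a sink, the squared norm of a field close to [X] decreases along its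
    own orbits; [qf_source] is the analogue for sources. *)
Lemma qf_sink x v : sphere3 x -> phi_rate x <= 0 -> dot v x = 0 ->
  2 * dot v v <= - qf (sphere_diff X x) v.
Proof.
move=> hx /(phi_rate_eq0 hx)[h0 h2 h1 h3] vx.
rewrite /qf sphere_diff_X// vx scale0r subr0 sink_diag// !dot4 !vec4E.
by have := sqr_ge0 (v$1); have := sqr_ge0 (v$3); lra.
Qed.

Lemma qf_source x v : sphere3 x -> psi_rate x <= 0 -> dot v x = 0 ->
  2 * dot v v <= qf (sphere_diff X x) v.
Proof.
move=> hx /(psi_rate_eq0 hx)[h0 h2 h1 h3] vx.
rewrite /qf sphere_diff_X// vx scale0r subr0 source_diag// !dot4 !vec4E.
by have := sqr_ge0 (v$0); have := sqr_ge0 (v$2); lra.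
Qed.

End Forms.

(** * Persistence of positive forms, and a barrier for periodic functions *)

Section Perturbation.
Variable R : realType.
Local Notation V := 'rV[R]_4.

Lemma qf_norm (A : 'M[R]_4) (v : V) : `|qf A v| <= 4 * `|A| * dot v v.
Proof.
have n0 := dot_ge0 v; have a0 : 0 <= `|A| by exact: normr_ge0.
have b0 : 0 <= 4 * `|A| * dot v v by rewrite !mulr_ge0.
rewrite -(@ler_pXn2r _ 2)// ?nnegrE// real_normK ?num_real//.
rewrite (le_trans (dot_CS _ _))// (le_trans (ler_wpM2r n0 (dot_mulmx _ _)))//.
by rewrite le_eqVlt; apply/orP; left; apply/eqP; ring.
Qed.

Lemma norm_mul4 (A B : 'M[R]_4) : `|A *m B| <= 4 * `|A| * `|B|.
Proof.
apply: norm_mx_le => [|i j]; first by rewrite !mulr_ge0.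
rewrite mxE (le_trans (ler_norm_sum _ _ _))//.
have -> : 4 * `|A| * `|B| = \sum_(k < 4) (`|A| * `|B|) by rewrite sum_const4 mulrA.
by apply: ler_sum => k _; rewrite normrM ler_pM// norm_coord.
Qed.

Lemma norm_outer (a b : V) : `|a^T *m b| <= `|a| * `|b|.
Proof.
apply: norm_mx_le => [|i j]; first by rewrite !mulr_ge0.
by rewrite mxE big_ord1 normrM mxE ler_pM// norm_coord.
Qed.

(** Where [w] is nonpositive the form is positive, so the maximum of the form
    and of [w] is positive on the unit tangent bundle, and bounded below by
    compactness; where [w] is smaller than this bound, it is the form that
    exceeds it. *)
Lemma form_near (N : V -> 'M[R]_4) (w : V -> R) :
  (forall x, x != 0 -> {for x, continuous N}) -> (forall x, {for x, continuous w}) ->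
  (forall x p, sphere3 x -> w x <= 0 -> dot p x = 0 -> 2 * dot p p <= qf (N x) p) ->
  exists2 k, 0 < k & forall x p, sphere3 x -> w x < k -> dot p x = 0 ->
    k * dot p p <= qf (N x) p.
Proof.
move=> cN cw hN.
pose f (z : V * V) := Num.max (qf (N z.1) z.2) (w z.1).
have [z [hz1 hz2 hz3]||k k0 hk] := @unit_tangent_lb R f.
- have c1 := @continuous_fst_at R z; have c2 := @continuous_snd_at R z.
  have cN1 : {for z, continuous (fun y : V * V => N y.1)}.
    by apply: (@continuous_comp _ _ _ (fun y : V * V => y.1) N) => //; apply: cN; exact: sphere_neq0.
  have cw1 : {for z, continuous (fun y : V * V => w y.1)}.
    by apply: (@continuous_comp _ _ _ (fun y : V * V => y.1) w).
  have cq : {for z, continuous (fun y : V * V => qf (N y.1) y.2)}.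
    exact: (continuous_dot (continuous_mulmx c2 cN1) c2).
  exact: (@continuous_max R _ (fun y : V * V => qf (N y.1) y.2) (fun y : V * V => w y.1) z cq cw1).
- move=> z [hz1 hz2 hz3]; rewrite /f lt_max.
  have [h|h] := leP (w z.1) 0; last by rewrite orbT.
  by rewrite (lt_le_trans _ (hN _ _ hz1 h hz3))// hz2 mulr1.
- exists k => // x p hx hw hp.
  have [->|p0] := eqVneq p 0; first by rewrite dot0r mulr0 qf0.
  have Kz : unit_tangent (x, normalize p).
    by split => //=; [exact: normalize_sphere|rewrite dotZl hp mulr0].
  have := hk _ Kz; rewrite /f/= le_max => /orP[|h]; last by have := lt_le_trans hw h; rewrite ltxx.
  rewrite normalizeE qfZ => h; have d0 : 0 < dot p p by rewrite dot_gt0.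
  have := ler_wpM2r (ltW d0) h.
  by rewrite mulrAC rho_sqr// mul1r.
Qed.

Lemma incr_local (h : R -> R) (d t : R) : is_derive t 1 h d -> 0 < d ->
  exists2 e, 0 < e & forall s, 0 < s < e -> h (t - s) < h t < h (t + s).
Proof.
move=> [hd hv] d0.
have := hd; rewrite /derivable => /cvg_ex[l hl].
have el : l = d by rewrite -hv; apply/esym/cvg_lim.
rewrite el in hl.
have d2 : 0 < d / 2 by rewrite divr_gt0.
move/cvgrPdist_lt: hl => /(_ _ d2) /nbhs_ballP[e /= e0 he].
exists e => // s /andP[s0 se].
have key r : r != 0 -> `|r| < e -> 0 < r^-1 * (h (t + r) - h t).
  move=> r0 re; have : ball (0 : R) e r by rewrite /ball/= sub0r normrN.
  move=> /he /(_ r0); rewrite /= /GRing.scale/= mulr1 (addrC r t).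
  set q := r^-1 * _; move=> hq; have := ler_norm (d - q); lra.
apply/andP; split.
  have : 0 < (- s)^-1 * (h (t + - s) - h t) by apply: key; rewrite ?oppr_eq0 ?gt_eqF ?normrN ?gtr0_norm.
  rewrite invrN mulNr oppr_gt0 pmulr_rlt0 ?invr_gt0// subr_lt0//.
have : 0 < s^-1 * (h (t + s) - h t) by apply: key; rewrite ?gt_eqF ?gtr0_norm.
by rewrite pmulr_rgt0 ?invr_gt0// subr_gt0.
Qed.

Lemma strict_incr_derive (k dk : R -> R) (T : R) : 0 < T ->
  (forall t : R, is_derive t 1 k (dk t)) -> (forall t, 0 <= dk t) -> 0 < dk 0 -> k 0 < k T.
Proof.
move=> T0 hk k0 d0; have [e e0 he] := incr_local (hk 0) d0.
pose s := Num.min (e / 2) T.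
have s0 : 0 < s by rewrite lt_min T0 divr_gt0.
have se : s < e by rewrite gt_min; apply/orP; left; lra.
have /andP[_] := he s (introT andP (conj s0 se)); rewrite add0r => h1.
apply: (lt_le_trans h1); apply: (nondecr_derive _ hk) => //.
by rewrite ge_min lexx orbT.
Qed.

Lemma periodic_nat (T : R) (h : R -> R) : (forall t, h (t + T) = h t) ->
  forall (n : nat) t, h (t + n%:R * T) = h t.
Proof.
move=> hp; elim=> [|n IH] t; first by rewrite mul0r addr0.
by rewrite -natr1 mulrDl mul1r addrA hp IH.
Qed.

Lemma periodic_argmin (T : R) (h : R -> R) : 0 < T -> continuous h ->
  (forall t, h (t + T) = h t) -> forall a, exists2 m, a <= m & forall t, h m <= h t.
Proof.
move=> T0 ch hp a.
have [m ml hm] := @EVT_min R h 0 T (ltW T0) (continuous_subspaceT ch).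
have hm' t : h m <= h t.
  have pos s : 0 <= s -> h m <= h s.
    move=> s0; have sT : 0 <= s / T by rewrite divr_ge0// ltW.
    have /andP[ks sk] := truncn_itv sT.
    have e : s = (s - (Num.truncn (s / T))%:R * T) + (Num.truncn (s / T))%:R * T by rewrite subrK.
    rewrite e periodic_nat//; apply: hm; rewrite in_itv/=; apply/andP; split.
      by rewrite subr_ge0 -ler_pdivlMr.
    have hs : s < (Num.truncn (s / T)).+1%:R * T by rewrite -ltr_pdivrMr.
    by rewrite -natr1 mulrDl mul1r in hs; lra.
  pose n := (Num.truncn (`|t| / T)).+1.
  rewrite -(periodic_nat hp n t); apply: pos.
  have h1 : `|t| < n%:R * T.
    by rewrite -ltr_pdivrMr//; have /andP[] := truncn_itv (divr_ge0 (normr_ge0 t) (ltW T0)).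
  by have := ler_norm (- t); rewrite normrN; lra.
pose n := (Num.truncn (`|a - m| / T)).+1.
exists (m + n%:R * T) => [|t]; last by rewrite periodic_nat.
have h1 : `|a - m| < n%:R * T.
  by rewrite -ltr_pdivrMr//; have /andP[] := truncn_itv (divr_ge0 (normr_ge0 (a - m)) (ltW T0)).
by have := ler_norm (a - m); lra.
Qed.

Lemma last_above (h : R -> R) (a b eta : R) : continuous h -> a <= b -> eta <= h a ->
  exists2 s, a <= s <= b /\ eta <= h s & forall r, s < r <= b -> h r < eta.
Proof.
move=> ch ab ha.
pose A := [set s | eta <= h s] `&` [set` `[a, b]].
have cA : compact A.
  apply: (subclosed_compact _ (@segment_compact _ a b)); last by move=> t [].
  apply: closedI; last exact: itv_closed.
  by apply: (@closed_comp _ _ h [set r | eta <= r]); [move=> t _; exact: ch|exact: closed_ge].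
have A0 : A !=set0 by exists a; split => //=; rewrite in_itv/= lexx.
have [s sA hs] := compact_EVT_max (f := idfun) A0 cA (continuous_subspaceT (fun x => cvg_id)).
rewrite inE in sA; have [s1 s2] := sA; rewrite /= in_itv/= in s2.
exists s => // r /andP[sr rb]; rewrite ltNge; apply/negP => hr.
have : r <= s.
  apply: hs; rewrite inE; split => //=; rewrite in_itv/= rb andbT.
  by case/andP: s2 => /le_trans + _; apply; exact: ltW.
by rewrite leNgt sr.
Qed.

(** Suppose that [h] takes a value at least [eta]. If it never goes below
    [eta], then at a minimum it would increase, unless it is everywhere above
    [c0], in which case [e] decreases strictly and is not periodic. If it does
    go below, there is a last time before that with [h] at least [eta]; but
    there [h] increases, or is above [c0]. *)
Lemma periodic_barrier (h dh e de : R -> R) (T eta c0 : R) : 0 < T -> eta <= c0 ->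
  (forall t : R, is_derive t 1 h (dh t)) -> (forall t : R, is_derive t 1 e (de t)) ->
  (forall t, h (t + T) = h t) -> e T = e 0 ->
  (forall t, eta <= h t <= c0 -> 0 < dh t) -> (forall t, c0 < h t -> de t < 0) ->
  forall t, h t < eta.
Proof.
move=> T0 ec hd ed hp ep h1 h2 t0; rewrite ltNge; apply/negP => ht0.
have ch : continuous h by exact: is_derive_cont hd.
have [m t0m hm] := periodic_argmin T0 ch hp t0.
have [hme|hme] := leP eta (h m).
  have [hmc|hmc] := leP (h m) c0.
    have [e1 e10 he1] := incr_local (hd m) (h1 m (introT andP (conj hme hmc))).
    have q1 : 0 < e1 / 2 < e1 by apply/andP; split; lra.
    by have /andP[] := he1 _ q1; rewrite ltNge hm.
  have neg t : de t < 0 by apply: h2; exact: lt_le_trans hmc (hm t).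
  have : - e 0 < - e T.
    have edN (t : R) : is_derive t 1 (fun t => - e t) (- de t).
      by have := ed t; exact: is_deriveN.
    apply: (strict_incr_derive T0 edN); last by rewrite oppr_gt0.
    by move=> t; rewrite oppr_ge0 ltW.
  by rewrite ep ltxx.
have [s [sm hs] hr] := last_above ch t0m ht0.
have sm' : s < m.
  case/andP: sm => _; rewrite le_eqVlt => /orP[/eqP es|//].
  by move: hme; rewrite -es ltNge hs.
(* s is the last time before m at which h is at least eta; it suffices that h
   remains so for a short while. *)
suff [r r0 hr'] : exists2 r, 0 < r & forall q, 0 < q < r -> eta <= h (s + q).
  pose q := Num.min (r / 2) (m - s).
  have q0 : 0 < q by rewrite lt_min subr_gt0 sm' divr_gt0.
  have qr : q < r by rewrite gt_min; apply/orP; left; lra.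
  have qm : s + q <= m by rewrite -lerBrDl ge_min lexx orbT.
  have sq : s < s + q by rewrite ltrDl.
  have := hr (s + q) (introT andP (conj sq qm)).
  by rewrite ltNge hr'// q0.
have [hsc|hsc] := leP (h s) c0.
  have [e1 e10 he1] := incr_local (hd s) (h1 s (introT andP (conj hs hsc))).
  by exists e1 => // q /he1/andP[_ /ltW]; exact: le_trans.
have hpos : 0 < h s - c0 by rewrite subr_gt0.
have := ch s => /cvgrPdist_lt/(_ _ hpos)/nbhs_ballP[r /= r0 hr1].
exists r => // q /andP[q0 qr].
have : ball s r (s + q) by rewrite /ball/= opprD addNKr normrN gtr0_norm.
by move=> /hr1 /=; have := ler_norm (h s - h (s + q)); lra.
Qed.

End Perturbation.

(** * The cross product of three vectors of R^4 *)

Section Cross.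
Variable R : realType.
Local Notation V := 'rV[R]_4.
Local Notation "x $ k" := (x (0 : 'I_1) (inord k : 'I_4)) : ring_scope.

Definition det3 (a1 a2 a3 b1 b2 b3 c1 c2 c3 : R) : R :=
  a1 * (b2 * c3 - b3 * c2) - a2 * (b1 * c3 - b3 * c1) + a3 * (b1 * c2 - b2 * c1).

(** The vector dual to the volume form contracted with [v], [y] and [x]. At a
    point [x] of the sphere with [y] tangent and nonzero, it represents the
    tangent vector [v] modulo [y]. *)
Definition cross (v y x : V) : V :=
  let m (i j k : nat) a b := det3 (a$i) (a$j) (a$k) (b$i) (b$j) (b$k) (x$i) (x$j) (x$k) in
  vec4 (m 1 2 3 y v) (m 0 2 3 v y) (m 0 1 3 y v) (m 0 1 2 v y).

Lemma cross_linear (a : R) u v y x : cross (a *: u + v) y x = a *: cross u y x + cross v y x.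
Proof. by rewrite /cross vec4_scale vec4_add !coordE /det3; congr vec4; ring. Qed.

Lemma dot_cross_base v y x : dot (cross v y x) x = 0.
Proof. by rewrite dot4 !vec4E /det3; ring. Qed.

Lemma dot_cross_field v y x : dot (cross v y x) y = 0.
Proof. by rewrite dot4 !vec4E /det3; ring. Qed.

Lemma cross_field y x : cross y y x = 0.
Proof. by apply: vec4P; rewrite /cross vec4E mxE /det3; ring. Qed.

(** The Gram determinant of [v], [y] and [x]. *)
Lemma dot_cross_gram v y x : dot x x = 1 -> dot v x = 0 -> dot y x = 0 ->
  dot (cross v y x) (cross v y x) = dot v v * dot y y - dot v y ^+ 2.
Proof.
move=> xx vx yx.
have -> : dot v v * dot y y - dot v y ^+ 2 =
  dot v v * dot y y * dot x x + 2 * dot v y * dot y x * dot v x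
  - dot v v * dot y x ^+ 2 - dot y y * dot v x ^+ 2 - dot x x * dot v y ^+ 2.
  by rewrite xx vx yx; ring.
by rewrite !dot4 !vec4E /det3; ring.
Qed.

Lemma cross_eq0 v y x : sphere3 x -> dot v x = 0 -> dot y x = 0 -> y != 0 ->
  cross v y x = 0 -> (v <= y)%MS.
Proof.
move=> xx vx yx y0 c0; have := dot_cross_gram xx vx yx; rewrite c0 dot0l => h.
have d0 : dot y y != 0 by rewrite dot_eq0.
have e : v - (dot v y / dot y y) *: y = 0.
  apply/eqP; rewrite -dot_eq0 !dotlin (dotC y v); apply/eqP.
  transitivity ((dot v v * dot y y - dot v y ^+ 2) / dot y y); first by field.
  by rewrite -h mul0r.
by move/eqP: e; rewrite subr_eq0 => /eqP ->; exact: scalemx_sub.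
Qed.

Definition cross_mx (y x : V) : 'M[R]_4 := \matrix_(i, j) cross (delta_mx 0 i) y x 0 j.

Lemma mul_cross_mx v y x : v *m cross_mx y x = cross v y x.
Proof.
have lin : linear (fun v => cross v y x) by move=> a u w; exact: cross_linear.
pose f : {linear V -> V} := HB.pack (fun v => cross v y x) (GRing.isLinear.Build _ _ _ _ _ lin).
rewrite -[RHS]/(f v) -mul_rV_lin1; congr (v *m _).
by apply/matrixP => i j; rewrite !mxE.
Qed.

(** A matrix acts on the third exterior power of R^4, identified with R^4 by
    the volume form, as its trace minus its transpose. *)
Lemma cross_mulmx v y x (M : 'M[R]_4) :
  cross (v *m M) y x + cross v (y *m M) x + cross v y (x *m M) =
  \tr M *: cross v y x - cross v y x *m M^T.
Proof.
have mE (u : V) k : (u *m M)$k = u$0 * M (inord 0) (inord k) + u$1 * M (inord 1) (inord k)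
    + u$2 * M (inord 2) (inord k) + u$3 * M (inord 3) (inord k) by rewrite mxE sum4.
have tE (u : V) k : (u *m M^T)$k = u$0 * M (inord k) (inord 0) + u$1 * M (inord k) (inord 1)
    + u$2 * M (inord k) (inord 2) + u$3 * M (inord k) (inord 3).
  by rewrite mxE sum4 !mxE.
rewrite /mxtrace sum4.
by apply: vec4P; rewrite !vec4D vec4N vec4Z tE !vec4E !mE /det3; ring.
Qed.

Lemma is_derive_det3 (a1 a2 a3 b1 b2 b3 c1 c2 c3 : R -> R) (a1' a2' a3' b1' b2' b3' c1' c2' c3' t : R) :
  is_derive t 1 a1 a1' -> is_derive t 1 a2 a2' -> is_derive t 1 a3 a3' ->
  is_derive t 1 b1 b1' -> is_derive t 1 b2 b2' -> is_derive t 1 b3 b3' ->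
  is_derive t 1 c1 c1' -> is_derive t 1 c2 c2' -> is_derive t 1 c3 c3' ->
  is_derive t 1 (fun s => det3 (a1 s) (a2 s) (a3 s) (b1 s) (b2 s) (b3 s) (c1 s) (c2 s) (c3 s))
    (det3 a1' a2' a3' (b1 t) (b2 t) (b3 t) (c1 t) (c2 t) (c3 t) +
     det3 (a1 t) (a2 t) (a3 t) b1' b2' b3' (c1 t) (c2 t) (c3 t) +
     det3 (a1 t) (a2 t) (a3 t) (b1 t) (b2 t) (b3 t) c1' c2' c3').
Proof.
move=> ha1 ha2 ha3 hb1 hb2 hb3 hc1 hc2 hc3.
have M u v w z u' v' w' z' (hu : is_derive t 1 u u') (hv : is_derive t 1 v v')
    (hw : is_derive t 1 w w') (hz : is_derive t 1 z z') :=
  is_derive_subf (is_derive_mulf hu hv) (is_derive_mulf hw hz).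
have := is_derive_addf (is_derive_subf (is_derive_mulf ha1 (M _ _ _ _ _ _ _ _ hb2 hc3 hb3 hc2))
  (is_derive_mulf ha2 (M _ _ _ _ _ _ _ _ hb1 hc3 hb3 hc1)))
  (is_derive_mulf ha3 (M _ _ _ _ _ _ _ _ hb1 hc2 hb2 hc1)).
set d := (X in is_derive t 1 _ X -> _); set d' := (X in _ -> is_derive t 1 _ X).
have -> : d = d' by rewrite /d /d' /det3; ring.
exact.
Qed.

Lemma is_derive_cross (v y x : R -> V) (v' y' x' : V) (t : R) :
  is_derive t 1 v v' -> is_derive t 1 y y' -> is_derive t 1 x x' ->
  is_derive t 1 (fun s => cross (v s) (y s) (x s))
    (cross v' (y t) (x t) + cross (v t) y' (x t) + cross (v t) (y t) x').
Proof.
move=> /is_derive_mx hv /is_derive_mx hy /is_derive_mx hx; apply/is_derive_mx => i j.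
rewrite (ord1 i).
have key k l m (a b : R -> V) (a' b' : V) :
    (forall i j, is_derive t 1 (fun s => a s i j) (a' i j)) ->
    (forall i j, is_derive t 1 (fun s => b s i j) (b' i j)) ->
  is_derive t 1 (fun s => det3 ((a s)$k) ((a s)$l) ((a s)$m) ((b s)$k) ((b s)$l) ((b s)$m)
      ((x s)$k) ((x s)$l) ((x s)$m))
    (det3 (a'$k) (a'$l) (a'$m) ((b t)$k) ((b t)$l) ((b t)$m) ((x t)$k) ((x t)$l) ((x t)$m) +
     det3 ((a t)$k) ((a t)$l) ((a t)$m) (b'$k) (b'$l) (b'$m) ((x t)$k) ((x t)$l) ((x t)$m) +
     det3 ((a t)$k) ((a t)$l) ((a t)$m) ((b t)$k) ((b t)$l) ((b t)$m) (x'$k) (x'$l) (x'$m)).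
  by move=> ha hb; exact: is_derive_det3.
have ext (f h : R -> R) (d e : R) : is_derive t 1 f d -> (forall s, h s = f s) -> e = d ->
    is_derive t 1 h e by move=> hf /funext -> ->.
elim/ord4P: j.
- apply: (ext _ _ _ _ (key 1%N 2%N 3%N y v y' v' hy hv)) => [s|]; rewrite ?vec4E// !vec4D !vec4E; ring.
- apply: (ext _ _ _ _ (key 0%N 2%N 3%N v y v' y' hv hy)) => [s|]; rewrite ?vec4E// !vec4D !vec4E; ring.
- apply: (ext _ _ _ _ (key 0%N 1%N 3%N y v y' v' hy hv)) => [s|]; rewrite ?vec4E// !vec4D !vec4E; ring.
- apply: (ext _ _ _ _ (key 0%N 1%N 2%N v y v' y' hv hy)) => [s|]; rewrite ?vec4E// !vec4D !vec4E; ring.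
Qed.

End Cross.

(** * Hyperbolicity of periodic orbits and of zeros *)

Section Transverse.
Variable R : realType.
Local Notation V := 'rV[R]_4.

Lemma is_derive_mulmxr (p : R -> V) (p' : V) (A : 'M[R]_4) (t : R) :
  is_derive t 1 p p' -> is_derive t 1 (fun s => p s *m A) (p' *m A).
Proof.
move=> hp; apply/is_derive_mx => i j; rewrite (ord1 i).
have e (u : V) : (u *m A) 0 j = dot u (\row_k A k j).
  by rewrite mxE dotE; apply: eq_bigr => k _; rewrite mxE.
have -> : (fun s => (p s *m A) 0 j) = (fun s => dot (p s) (\row_k A k j)).
  by apply/funext => s; exact: e.
have := is_derive_dot hp (is_derive_cst (\row_k A k j : V) t (1 : R)).
by rewrite dot0r addr0 e.
Qed.

Lemma eps_tr : (eps R)^T = eps R. Proof. exact: tr_diag_mx. Qed.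

(** As [D] annihilates [c], adding to it the matrix that sends [c] to [y] and
    is 0 on the tangent space gives one matrix by which all three factors of
    the cross product move, so that [cross_mulmx] applies. *)
Lemma transverse_derive (w y c : R -> V) (D : 'M[R]_4) (t : R) :
  is_derive t 1 w (w t *m D) -> is_derive t 1 y (y t *m D) -> is_derive t 1 c (y t) ->
  dot (w t) (c t) = 0 -> dot (y t) (c t) = 0 -> dot (c t) (c t) = 1 -> c t *m D = 0 ->
  is_derive t 1 (fun s => dot (cross (w s) (y s) (c s) *m eps R) (cross (w s) (y s) (c s)))
    (qf ((2 * \tr D) *: eps R - 2 *: (eps R *m (D + (c t)^T *m y t))) (cross (w t) (y t) (c t))).
Proof.
move=> hw hy hc wc yc cc cD.
pose M := D + (c t)^T *m y t.
have wM : w t *m D = w t *m M by rewrite mulmxDr mul_outer wc scale0r addr0.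
have yM : y t *m D = y t *m M by rewrite mulmxDr mul_outer yc scale0r addr0.
have cM : y t = c t *m M by rewrite mulmxDr mul_outer cc scale1r cD add0r.
rewrite wM in hw; rewrite yM in hy.
have hc' : is_derive t 1 c (c t *m M) by rewrite -cM.
have hp := is_derive_cross hw hy hc'; rewrite cross_mulmx in hp.
have trM : \tr M = \tr D.
  by rewrite mxtraceD mxtrace_mulC /mxtrace big_ord1 -[X in _ + X]/(dot (y t) (c t)) yc addr0.
have := is_derive_dot (is_derive_mulmxr (eps R) hp) hp.
rewrite trM -/M; move: (cross (w t) (y t) (c t)) => p.
set d := (X in is_derive t 1 _ X -> _) => hd.
suff -> : qf ((2 * \tr D) *: eps R - 2 *: (eps R *m M)) p = d by [].
rewrite /d [dot ((_ - _) *m eps R) p]dot_mulmxr eps_tr (dotC _ (p *m eps R)).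
rewrite /qf mulmxBr -!scalemxAr mulmxA.
have e : dot (p *m eps R) (p *m M^T) = dot (p *m eps R *m M) p by rewrite [RHS]dot_mulmxr.
rewrite !(dotDl, dotDr, dotNl, dotNr, dotZl, dotZr) e; ring.
Qed.

Variables (Y : V -> V) (hY : vector_field Y).
Local Notation G t x := (flow_diff Y t x).

Lemma transverse_flow x (v : V) (t : R) : sphere3 x -> dot v x = 0 ->
  is_derive t 1 (fun s => dot (cross (v *m G s x) (Y (flow Y s x)) (flow Y s x) *m eps R)
      (cross (v *m G s x) (Y (flow Y s x)) (flow Y s x)))
    (qf (transverse_form Y (flow Y t x)) (cross (v *m G t x) (Y (flow Y t x)) (flow Y t x))).
Proof.
move=> hx vx; have cS := flow_sphere hY t hx.
have [hv _] := flow_diff_variation hY hx vx.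
apply: (@transverse_derive (fun s => v *m G s x) (fun s => Y (flow Y s x)) (fun s => flow Y s x)
  (sphere_diff Y (flow Y t x)) t).
- exact: hv.
- exact: (variation_field hY hx).
- exact: flow_derive.
- exact: flow_diff_tangent.
- exact: field_tangent.
- exact: cS.
- exact: sphere_diff_radial.
Qed.

Lemma mulmx_commute_sub (v : V) (A B : 'M[R]_4) : v *m A *m B = v *m B *m A ->
  (v *m A - v) *m B = v *m B *m (A - 1%:M).
Proof. by move=> e; rewrite mulmxBl e mulmxBr mulmx1. Qed.

Variables (g : V -> 'M[R]_4) (hg : riemannian_metric g).

(** Since the form increases along the orbit on nonzero cross products, the
    return map has no fixed vector in the tangent space modulo [Y]. Hence the
    image [W] of the return map minus the identity is a complement of [Y x],
    and it is invariant under the differentials that commute with the return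
    map. The cross product transports the form to [W], where
    [hyperbolic_of_growth] applies. *)
Theorem periodic_hyperbolic x T : sphere3 x -> 0 < T -> flow Y T x = x -> Y x != 0 ->
  (forall t p, dot p (flow Y t x) = 0 -> dot p (Y (flow Y t x)) = 0 -> p != 0 ->
     0 < qf (transverse_form Y (flow Y t x)) p) ->
  hyperbolic g Y (Defs.orbit Y x).
Proof.
move=> hx T0 xT Yx0 hpos.
have Yx : dot (Y x) x = 0 by exact: field_tangent.
pose Q (p : V) := dot (p *m eps R) p.
have incr (v : V) : dot v x = 0 -> cross v (Y x) x != 0 ->
    Q (cross v (Y x) x) < Q (cross (v *m G T x) (Y x) x).
  move=> vx c0.
  have hd t := transverse_flow t hx vx.
  have ge0 t : 0 <= qf (transverse_form Y (flow Y t x))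
      (cross (v *m G t x) (Y (flow Y t x)) (flow Y t x)).
    have [->|n0] := eqVneq (cross (v *m G t x) (Y (flow Y t x)) (flow Y t x)) 0.
      by rewrite qf0.
    by apply/ltW/hpos => //; [exact: dot_cross_base|exact: dot_cross_field].
  have [_ v0] := flow_diff_variation hY hx vx.
  have pos0 : 0 < qf (transverse_form Y x) (cross v (Y x) x).
    have h0 := hpos 0 (cross v (Y x) x); rewrite (flow0 hY hx) in h0.
    by apply: h0; [exact: dot_cross_base|exact: dot_cross_field|exact: c0].
  have h := strict_incr_derive T0 hd ge0.
  move: v0 h; rewrite xT (flow0 hY hx).
  move: (flow_diff Y 0 x) (flow_diff Y T x) => G0 GT v0; rewrite v0 => h.
  exact: h pos0.
have ker (v : V) : dot v x = 0 -> cross (v *m G T x) (Y x) x = cross v (Y x) x -> (v <= Y x)%MS.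
  move=> vx e; apply: (cross_eq0 hx vx Yx Yx0); apply/eqP.
  apply: contraT => c0.
  by have := incr v vx c0; rewrite e ltxx.
pose W := tangent x *m (G T x - 1%:M).
have GTx (v : V) : dot v x = 0 -> dot (v *m G T x) x = 0.
  by move=> vx; have := flow_diff_tangent hY T hx vx; rewrite xT.
have YG : Y x *m G T x = Y x by have := flow_diff_field hY T hx; rewrite xT.
have tv (v : V) : (v <= tangent x)%MS -> dot v x = 0 by rewrite tangentE => /eqP.
have Wx : (W <= tangent x)%MS.
  rewrite /W mulmxBr mulmx1; apply: addmx_sub; last by rewrite eqmx_opp.
  by have := flow_diff_tangent_mx hY hx T (submx_refl (tangent x)); rewrite xT.
have Welt (w : V) : (w <= W)%MS -> exists2 v : V, dot v x = 0 & w = v *m G T x - v.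
  move=> /submxP[a ->]; exists (a *m tangent x); first by apply: tv; exact: submxMl.
  by rewrite /W mulmxA mulmxBr mulmx1.
have WY0 : (W :&: Y x)%MS = 0.
  apply/eqP/rowV0P => w; rewrite sub_capmx => /andP[/Welt[v vx ->] /sub_rVP[a e]].
  rewrite e; suff -> : a = 0 by rewrite scale0r.
  apply/eqP; apply: contraT => a0.
  have vY : (v <= Y x)%MS.
    apply: ker => //.
    have -> : v *m G T x = a *: Y x + v by rewrite -e subrK.
    by rewrite cross_linear cross_field scaler0 add0r.
  have /sub_rVP[b vb] := vY.
  move/eqP: e; rewrite vb -scalemxAl YG subrr eq_sym scaler_eq0 (negbTE a0)/=.
  by rewrite (negbTE Yx0).
(* Rank formula: the kernel of the return map minus the identity is the line
   of Y x. *)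
have rkW : (2 <= \rank W)%N.
  pose K := (tangent x :&: kermx (G T x - 1%:M))%MS.
  have := mxrank_mul_ker (tangent x) (G T x - 1%:M); rewrite (tangent_rank hx) -/W.
  have KY : (K <= Y x)%MS.
    apply/rV_subP => v; rewrite sub_capmx => /andP[/tv vx /sub_kermxP].
    rewrite mulmxBr mulmx1 => /eqP; rewrite subr_eq0 => /eqP e.
    by apply: ker => //; rewrite e.
  have := mxrankS KY; rewrite rank_rV Yx0 -/K; move: (\rank K) (\rank W) => a b.
  by case: a => [|[|a]] //; case: b => [|[|b]].
have WY : (W + Y x :=: tangent x)%MS.
  have sub : ((W + Y x)%MS <= tangent x)%MS by rewrite addsmx_sub Wx tangentE Yx eqxx.
  apply/eqmxP; rewrite sub/= -(geq_leqif (mxrank_leqif_sup sub)) (tangent_rank hx).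
  by rewrite (mxrank_disjoint_sum WY0) rank_rV Yx0 addn1.
have WG r : flow Y r x = x -> (W *m G r x <= W)%MS.
  move=> xr; apply/rV_subP => u /submxP[a ->]; rewrite mulmxA.
  have /Welt[v vx ->] : (a *m W <= W)%MS by exact: submxMl.
  have e : v *m G T x *m G r x = v *m G r x *m G T x.
    have e1 := flow_diffD hY r T hx vx; rewrite xT in e1.
    have e2 := flow_diffD hY T r hx vx; rewrite xr addrC in e2.
    move: e1 e2; move: (flow_diff Y (r + T) x) (G T x) (G r x) => A A1 A2 e1 e2.
    by rewrite -e1.
  have vrx : dot (v *m G r x) x = 0 by have := flow_diff_tangent hY r hx vx; rewrite xr.
  have -> : (v *m G T x - v) *m G r x = v *m G r x *m (G T x - 1%:M).
    exact: mulmx_commute_sub.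
  by apply: submxMr; rewrite tangentE vrx.
pose B := cross_mx (Y x) x *m eps R *m (cross_mx (Y x) x)^T.
have qB (v : V) : qf B v = Q (cross v (Y x) x).
  by rewrite /qf /B !mulmxA mul_cross_mx dot_mulmxr trmxK mul_cross_mx.
apply: (hyperbolic_of_growth hY hg hx T0 xT Wx WG WY WY0 (B := B)).
move=> v vW v0; rewrite !qB; have vx := tv _ (submx_trans vW Wx).
apply: incr => //; apply: contra_neq v0 => /(cross_eq0 hx vx Yx Yx0) vY.
by apply/eqP; rewrite -submx0 -WY0 sub_capmx vW.
Qed.

Lemma flow_singular x t : sphere3 x -> Y x = 0 -> flow Y t x = x.
Proof.
move=> hx Y0; apply: (flow_unique hY (c := fun=> x)); split=> // s.
by rewrite Y0; exact: is_derive_cst.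
Qed.

Lemma field_neq0 x t : sphere3 x -> Y x != 0 -> Y (flow Y t x) != 0.
Proof.
move=> hx; apply: contra_neq => Y0.
have := flow_singular (- t) (flow_sphere hY t hx) Y0; rewrite flowNK// => ->.
exact: Y0.
Qed.

Lemma periodic_field_neq0 x : periodic_point Y x -> Y x != 0.
Proof.
move=> [hx [t [t0 _ h]]]; apply/eqP => Y0.
by apply: (h (t / 2)); [rewrite divr_gt0|lra|exact: flow_singular].
Qed.

Lemma qf_bilinear_derive (w : R -> V) (D E : 'M[R]_4) (t : R) :
  is_derive t 1 w (w t *m D) ->
  is_derive t 1 (fun s => qf E (w s)) (qf (D *m E + D *m E^T) (w t)).
Proof.
move=> hw; rewrite qf_outer_gram.
have := is_derive_dot (is_derive_mulmxr E hw) hw.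
by rewrite (dotC (w t *m E)).
Qed.

(** A zero is an orbit of period 1. The hypothesis says that the form with
    matrix [E] increases along the linear flow of the differential. *)
Theorem singular_hyperbolic x (E : 'M[R]_4) : sphere3 x -> Y x = 0 ->
  (forall v, dot v x = 0 -> v != 0 ->
     0 < qf (sphere_diff Y x *m E + sphere_diff Y x *m E^T) v) ->
  hyperbolic g Y [set x].
Proof.
move=> hx Y0 hpos.
have fx t : flow Y t x = x by exact: flow_singular.
have ox : Defs.orbit Y x = [set x].
  apply/seteqP; split => [y [t _ <-]|y ->]; first exact: fx.
  by exists 0 => //; exact: fx.
rewrite -ox.
have Wx : (tangent x <= tangent x)%MS by exact: submx_refl.
have WG r : flow Y r x = x -> (tangent x *m G r x <= tangent x)%MS.
  by move=> xr; have := flow_diff_tangent_mx hY hx r Wx; rewrite xr.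
apply: (hyperbolic_of_growth hY hg hx (@ltr01 R) (fx 1) Wx WG _ _ (B := E)).
- by rewrite Y0; exact: addsmx0.
- by rewrite Y0 capmx0.
move=> v; rewrite tangentE => /eqP vx v0.
have [hv e0] := flow_diff_variation hY hx vx.
have hd (t : R) := qf_bilinear_derive E (hv t).
have vt t : dot (v *m G t x) x = 0 by have := flow_diff_tangent hY t hx vx; rewrite fx.
have ge0 t : 0 <= qf (sphere_diff Y (flow Y t x) *m E + sphere_diff Y (flow Y t x) *m E^T) (v *m G t x).
  rewrite fx; have [->|n0] := eqVneq (v *m G t x) 0; first by rewrite qf0.
  by apply/ltW/hpos.
have h := strict_incr_derive ltr01 hd ge0.
move: e0 h; rewrite fx; move: (flow_diff Y 0 x) (flow_diff Y 1 x) => G0 G1 e0.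
by rewrite e0; apply; exact: hpos.
Qed.

End Transverse.

(** * Flows close to the example *)

Section Star.
Variable R : realType.
Local Notation V := 'rV[R]_4.
Local Notation "x $ k" := (x (0 : 'I_1) (inord k : 'I_4)) : ring_scope.
Local Notation X := (@cycle_field R).
Let hX := @vector_field_X R.

Lemma continuous_X (x : V) : {for x, continuous X}.
Proof. exact: differentiable_continuous (differentiable_X x). Qed.

Lemma continuous_scale_mx (T : topologicalType) (a : T -> R) (A : T -> 'M[R]_4) (x : T) :
  {for x, continuous a} -> {for x, continuous A} -> {for x, continuous (fun y => a y *: A y)}.
Proof. by move=> ca cA; exact: (cvgZ ca cA). Qed.

Lemma continuous_add_mx (T : topologicalType) (A B : T -> 'M[R]_4) (x : T) :
  {for x, continuous A} -> {for x, continuous B} -> {for x, continuous (fun y => A y + B y)}.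
Proof. by move=> cA cB; exact: (cvgD cA cB). Qed.

Lemma continuous_tr (T : topologicalType) (A : T -> 'M[R]_4) (x : T) :
  {for x, continuous A} -> {for x, continuous (fun y => \tr (A y))}.
Proof. by move=> cA; apply: continuous_sum => i; exact: continuous_entry. Qed.

Lemma continuous_gamma_form (x : V) : x != 0 -> {for x, continuous (@gamma_form R)}.
Proof.
move=> x0; have cD := sphere_diff_cont hX x0; have cX := continuous_X (x := x).
have cid : {for x, continuous (fun y : V => y)} by exact: cvg_id.
have ce : {for x, continuous (fun _ : V => eps R)} by exact: continuous_cst_at.
have c2 (a : R) : {for x, continuous (fun _ : V => a)} by exact: continuous_cst_at.
have h1 := continuous_scale_mx (continuous_mulf (c2 2) (continuous_tr cD)) ce.
have h2 := continuous_scale_mx (c2 2) (continuous_mulmx ce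
  (continuous_add_mx cD (continuous_mulmx (continuous_trmx cid) cX))).
have h3 := continuous_scale_mx (c2 12) (continuous_mulmx (continuous_trmx cX) cX).
exact: (continuous_add_mx (continuous_subf h1 h2) h3).
Qed.

Lemma continuous_zero_form (x : V) : x != 0 -> {for x, continuous (@zero_form R)}.
Proof.
move=> x0; have cD := sphere_diff_cont hX x0.
exact: (continuous_add_mx (continuous_mulmx cD cD) (continuous_mulmx cD (continuous_trmx cD))).
Qed.

Lemma coord_cont (x : V) k : cont_at x (fun y : V => y$k).
Proof. by apply: continuous_entry; exact: cvg_id. Qed.

Lemma cont_atX2 (T : topologicalType) (x : T) (f : T -> R) :
  cont_at x f -> cont_at x (fun y => f y ^+ 2).
Proof. by move=> cf; apply: (cont_at_ext (fun y => expr2 _)); exact: cont_atM. Qed.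

Ltac poly_tac := lazymatch goal with
  | |- cont_at _ (fun y => @GRing.add _ (@?a y) (@?b y)) => apply: (@cont_atD _ _ _ a b); poly_tac
  | |- cont_at _ (fun y => @GRing.mul _ (@?a y) (@?b y)) => apply: (@cont_atM _ _ _ a b); poly_tac
  | |- cont_at _ (fun y => @GRing.opp _ (@?a y)) => apply: (@cont_atN _ _ _ a); poly_tac
  | |- cont_at _ (fun y => @GRing.exp _ (@?a y) _) => apply: (@cont_atX2 _ _ a); poly_tac
  | |- _ => first [exact: cont_atC | exact: coord_cont]
  end.

Lemma continuous_phi (x : V) : {for x, continuous (@phi R)}.
Proof. by suff: cont_at x (@phi R) by []; rewrite /phi; poly_tac. Qed.

Lemma continuous_psi (x : V) : {for x, continuous (@psi R)}.
Proof. by suff: cont_at x (@psi R) by []; rewrite /psi; poly_tac. Qed.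

Lemma continuous_phi_rate (x : V) : {for x, continuous (@phi_rate R)}.
Proof. by suff: cont_at x (@phi_rate R) by []; rewrite /phi_rate /psi; poly_tac. Qed.

Lemma continuous_psi_rate (x : V) : {for x, continuous (@psi_rate R)}.
Proof. by suff: cont_at x (@psi_rate R) by []; rewrite /psi_rate /phi; poly_tac. Qed.

Lemma is_derive_sqr_coord (c : R -> V) (c' : V) (i j : nat) (t : R) : is_derive t 1 c c' ->
  is_derive t 1 (fun s => ((c s)$i * (c s)$j) ^+ 2)
    (2 * ((c t)$i * (c t)$j) * (c'$i * (c t)$j + (c t)$i * c'$j)).
Proof.
move=> /is_derive_mx hc.
have h := is_derive_mulf (hc 0 (inord i)) (hc 0 (inord j)).
have -> : (fun s => ((c s)$i * (c s)$j) ^+ 2) =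
  (fun s => ((c s)$i * (c s)$j) * ((c s)$i * (c s)$j)) by apply/funext => s; rewrite expr2.
have := is_derive_mulf h h; set a := (X in is_derive t 1 _ X -> _) => ha.
suff -> : 2 * ((c t)$i * (c t)$j) * (c'$i * (c t)$j + (c t)$i * c'$j) = a by [].
by rewrite /a; ring.
Qed.

Lemma coord_le1 (x : V) k : sphere3 x -> `|x$k| <= 1.
Proof. by move=> hx; rewrite (le_trans (norm_coord _ _ _))// sphere_norm_le. Qed.

Lemma sqr_coord_bound (x w : V) (i j : nat) : sphere3 x ->
  `|2 * (x$i * x$j) * (w$i * x$j + x$i * w$j)| <= 4 * `|w|.
Proof.
move=> hx; have hi := coord_le1 i hx; have hj := coord_le1 j hx.
have wi := norm_coord w 0 (inord i); have wj := norm_coord w 0 (inord j).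
rewrite !normrM (ger0_norm (_ : 0 <= 2)) //.
have h1 : `|x$i| * `|x$j| <= 1 by rewrite -[leRHS]mulr1 ler_pM.
have h2 : `|w$i * x$j + x$i * w$j| <= 2 * `|w|.
  rewrite (le_trans (ler_normD _ _))// !normrM.
  have := ler_pM (normr_ge0 _) (normr_ge0 _) wi hj.
  have := ler_pM (normr_ge0 _) (normr_ge0 _) hi wj.
  rewrite mulr1 mul1r; lra.
have := ler_pM (mulr_ge0 (normr_ge0 (x$i)) (normr_ge0 (x$j))) (normr_ge0 _) h1 h2.
rewrite mul1r; lra.
Qed.

Lemma dphi_near (x w w' : V) (d : R) : sphere3 x -> `|w' - w| < d ->
  dphi x w - 4 * d < dphi x w' /\ dpsi x w' < dpsi x w + 4 * d.
Proof.
move=> hx hw; have h1 := sqr_coord_bound (w' - w) 1 3 hx.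
have h2 := sqr_coord_bound (w' - w) 0 2 hx.
move: h1 h2; rewrite !coordE.
rewrite (_ : 2 * (x$1 * x$3) * _ = dphi x w' - dphi x w); last by rewrite /dphi; ring.
rewrite (_ : 2 * (x$0 * x$2) * _ = dpsi x w' - dpsi x w); last by rewrite /dpsi; ring.
rewrite !ler_norml => /andP[h1 h2] /andP[h3 h4]; split; lra.
Qed.

(** The maximum of [r] and [w - c0] is positive on the sphere, hence bounded
    below there. *)
Lemma rate_lb (w r : V -> R) (c0 : R) : (forall x, {for x, continuous w}) ->
  (forall x, {for x, continuous r}) ->
  (forall x, sphere3 x -> w x <= c0 -> 0 < r x) ->
  exists2 k, 0 < k & forall x, sphere3 x -> w x <= c0 -> k <= r x.
Proof.
move=> cw cr h.
have [x||k k0 hk] := @compact_gt0_lb R V (@sphere3 R) (fun x => Num.max (r x) (w x - c0)) (@sphere_compact R).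
- apply: (@continuous_max R _ r (fun y => w y - c0) x); first exact: cr.
  by apply: continuous_subf; [exact: cw|exact: continuous_cst_at].
- move=> x hx; rewrite lt_max subr_gt0.
  by have [/(h x hx) -> //|_] := leP (w x) c0; rewrite orbT.
exists k => // x hx hw; have := hk x hx; rewrite le_max => /orP[//|h1].
by have := lt_le_trans k0 h1; rewrite subr_gt0 ltNge hw.
Qed.

Lemma norm_tr4 (A : 'M[R]_4) : `|\tr A| <= 4 * `|A|.
Proof.
rewrite /mxtrace (le_trans (ler_norm_sum _ _ _))// -sum_const4.
by apply: ler_sum => i _; exact: norm_coord.
Qed.

Lemma norm_eps : `|eps R| <= 1.
Proof.
apply: norm_mx_le => // i j; rewrite mxE.
case: (i == j); rewrite ?mulr0n ?normr0 ?mulr1n//.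
by elim/ord4P: i; rewrite vec4E ?normrN normr1.
Qed.

Lemma norm_scale4 (a : R) (A : 'M[R]_4) : `|a *: A| <= `|a| * `|A|.
Proof.
apply: norm_mx_le => [|i j]; first by rewrite mulr_ge0.
by rewrite mxE normrM ler_wpM2l// norm_coord.
Qed.

Lemma norm_trmx (A : 'M[R]_4) : `|A^T| <= `|A|.
Proof. by apply: norm_mx_le => // i j; rewrite mxE norm_coord. Qed.

Lemma qf_near (A B : 'M[R]_4) (k e : R) (v : V) : v != 0 ->
  k * dot v v <= qf A v -> `|B - A| <= e -> 4 * e < k -> 0 < qf B v.
Proof.
move=> v0 h1 h2 h3; have d0 : 0 < dot v v by rewrite dot_gt0.
have h4 : qf B v = qf A v + qf (B - A) v.
  by rewrite /qf mulmxBr !dotlin; ring.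
have h5 : `|qf (B - A) v| <= 4 * e * dot v v.
  by rewrite (le_trans (qf_norm _ _))// ler_wpM2r ?(ltW d0)// ler_wpM2l.
have h6 : 4 * e * dot v v < k * dot v v by rewrite ltr_pM2r.
have h7 := ler_norm (- qf (B - A) v); rewrite normrN in h7.
by rewrite h4; lra.
Qed.

Lemma zero_form_near (A B : 'M[R]_4) (d b : R) : `|A - B| <= d -> `|B| <= b ->
  `|A *m B + A *m B^T - (B *m B + B *m B^T)| <= 8 * (d * b).
Proof.
move=> h1 h2; rewrite -!mulmxDr -mulmxBl (le_trans (norm_mul4 _ _))//.
have n := norm_trmx B.
have n2 : `|B + B^T| <= 2 * b by rewrite (le_trans (ler_normD _ _))//; lra.
have := ler_pM (normr_ge0 (A - B)) (normr_ge0 (B + B^T)) h1 n2.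
by rewrite -mulrA; lra.
Qed.

Lemma transverse_near (Y : V -> V) (d : R) (x : V) : sphere3 x ->
  `|Y x - X x| < d -> `|sphere_diff Y x - sphere_diff X x| < d ->
  `|transverse_form Y x - transverse_form X x| <= 24 * d.
Proof.
move=> hx h1 h2.
have -> : transverse_form Y x - transverse_form X x =
  (2 * \tr (sphere_diff Y x - sphere_diff X x)) *: eps R
  - 2 *: (eps R *m (sphere_diff Y x - sphere_diff X x + x^T *m (Y x - X x))).
  rewrite /transverse_form; move: (sphere_diff Y x) (sphere_diff X x) (Y x) (X x) => A B a b.
  rewrite mxtraceD raddfN /= !(mulmxDr, mulmxBr, mulmxN) mulrBr scalerBl !scalerDr !scalerN.
  move: (2 * \tr A) (2 * \tr B) (eps R *m A) (eps R *m B) (eps R *m (x^T *m a)) (eps R *m (x^T *m b)) => p q P Q S U.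
  move: (p *: eps R) (q *: eps R) (2 *: P) (2 *: Q) (2 *: S) (2 *: U) => p' q' P' Q' S' U'.
  by apply/matrixP => i j; rewrite !mxE; ring.
move: h1 h2; move: (sphere_diff Y x - sphere_diff X x) (Y x - X x) => D w h1 h2.
have e1 := norm_eps; have e0 := normr_ge0 (eps R).
have t := norm_tr4 D.
have o := norm_outer x w; have xn := sphere_norm_le hx.
have xw : `|x| * `|w| <= `|w| by rewrite ler_piMl.
have m := norm_mul4 (eps R) (D + x^T *m w).
have Dw : `|D + x^T *m w| <= 2 * d.
  by rewrite (le_trans (ler_normD _ _))//; lra.
have m2 : `|eps R| * `|D + x^T *m w| <= 1 * (2 * d) by rewrite ler_pM.
have s1 := norm_scale4 (2 * \tr D) (eps R); rewrite normrM (ger0_norm (_ : 0 <= 2)) // in s1.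
have s2 := norm_scale4 2 (eps R *m (D + x^T *m w)); rewrite (ger0_norm (_ : 0 <= 2)) // in s2.
rewrite (le_trans (ler_normB _ _))//.
have t2 : `|\tr D| * `|eps R| <= (4 * d) * 1 by rewrite ler_pM//; lra.
rewrite -!mulrA in m m2 s1 s2; lra.
Qed.

(** [gamma_form] exceeds [transverse_form] by 12 times the square of
    [dot p (X x)], which is small since [p] is orthogonal to [Y x] and [Y] is
    close to [X]. *)
Lemma transverse_pos (Y : V -> V) (k d : R) (x p : V) : sphere3 x -> d <= 1 -> 144 * d < k ->
  k * dot p p <= qf (gamma_form x) p ->
  `|Y x - X x| < d -> `|sphere_diff Y x - sphere_diff X x| < d ->
  dot p (Y x) = 0 -> p != 0 -> 0 < qf (transverse_form Y x) p.
Proof.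
move=> hx d1 dk hk h1 h2 pY p0.
have d0 : 0 <= d by apply: ltW; exact: le_lt_trans (normr_ge0 _) h1.
apply: (@qf_near (transverse_form X x) _ (k - 48 * d) (24 * d)) => //.
- have e : qf (gamma_form x) p = qf (transverse_form X x) p + 12 * dot p (X x) ^+ 2.
    rewrite /gamma_form /qf mulmxDr dotDl -scalemxAr mul_outer !dotlin (dotC (X x) p).
    by ring.
  have e2 : dot p (X x) ^+ 2 <= dot p p * (4 * d).
    have -> : dot p (X x) = - dot p (Y x - X x) by rewrite dotDr dotNr pY add0r opprK.
    rewrite sqrrN (le_trans (dot_CS _ _))// ler_wpM2l ?dot_ge0//.
    rewrite (le_trans (dot_le_norm _))// ler_wpM2l//.
    have w0 := normr_ge0 (Y x - X x).
    rewrite expr2 (le_trans (ler_pM w0 w0 (ltW h1) (ltW h1)))//.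
    by rewrite ler_piMl.
  by rewrite mulrBl; rewrite e in hk; lra.
- exact: transverse_near.
- lra.
Qed.

Section Close.
Variables (g : V -> 'M[R]_4) (hg : riemannian_metric g).
(** Lower bounds [kG], [k0] and [ks] for the forms near the cycle, near the
    zeros, and near the sinks and sources, and [rf] for the rates away from
    these; [eta] is the level of [phi] and [psi] below which periodic orbits
    are confined. *)
Variables (kG k0 ks rf eta c0 BX d : R).
Hypothesis formG : forall x p, sphere3 x -> phi x + psi x < kG -> dot p x = 0 ->
  kG * dot p p <= qf (gamma_form x) p.
Hypothesis form0 : forall x v, sphere3 x -> dot (X x) (X x) < k0 -> dot v x = 0 ->
  k0 * dot v v <= qf (zero_form x) v.
Hypothesis formS : forall x v, sphere3 x -> c0 < phi x -> dot v x = 0 ->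
  ks * dot v v <= qf (- sphere_diff X x) v.
Hypothesis formR : forall x v, sphere3 x -> c0 < psi x -> dot v x = 0 ->
  ks * dot v v <= qf (sphere_diff X x) v.
Hypothesis rateF : forall x, sphere3 x -> phi x <= c0 -> rf <= phi_rate x.
Hypothesis rateS : forall x, sphere3 x -> psi x <= c0 -> rf <= psi_rate x.
Hypotheses (eta0 : 0 < eta) (etac : eta <= c0) (etaG : 2 * eta <= kG) (rf0 : 0 < rf) (k00 : 0 < k0).
Hypothesis boundX : forall x, sphere3 x -> `|sphere_diff X x| <= BX.
Hypotheses (d0 : 0 < d) (d1 : d <= 1) (dG : 144 * d < kG) (d0' : 4 * d < k0)
  (ds : 4 * d < ks) (dr : 2 * d < eta * rf) (dB : 32 * (d * BX) < k0).
Variables (Y : V -> V) (hY : vector_field Y) (XY : C1_close d X Y).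

(** At a zero of [Y] the field [X] is small, so that [zero_form] is positive,
    and it is close to the derivative of the same form along the flow of
    [Y]. *)
Lemma close_singular x : singularity Y x -> hyperbolic g Y [set x].
Proof.
move=> [hx Y0]; have [h1 h2] := XY hx.
apply: (singular_hyperbolic hY hg hx Y0 (E := sphere_diff X x)) => v vx v0.
have X2 : dot (X x) (X x) < k0.
  rewrite Y0 sub0r normrN in h1.
  apply: le_lt_trans d0'; rewrite (le_trans (dot_le_norm _))// ler_wpM2l//.
  have w0 := normr_ge0 (X x).
  rewrite expr2 (le_trans (ler_pM w0 w0 (ltW h1) (ltW h1)))//.
  by rewrite ler_piMl// ltW.
have dB' := dB; apply: (qf_near v0 (form0 hx X2 vx) (e := 8 * (d * BX))); last by lra.
exact: (zero_form_near (ltW h2) (boundX hx)).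
Qed.

Lemma energy_derive x t : sphere3 x ->
  is_derive (t : R) 1 (fun s => dot (Y (flow Y s x)) (Y (flow Y s x)))
    (2 * qf (sphere_diff Y (flow Y t x)) (Y (flow Y t x))).
Proof.
move=> hx; have h := variation_field hY hx t.
have := is_derive_dot h h; rewrite (dotC (Y _)) /qf.
by set a := dot _ _; rewrite mulr_natl mulr2n.
Qed.

(** [periodic_barrier] for [phi] and the squared norm of [Y], which decreases
    along the orbits where [phi] exceeds [c0], that is near the sinks. *)
Lemma close_below_phi x T : sphere3 x -> 0 < T -> flow Y T x = x -> Y x != 0 ->
  forall t, phi (flow Y t x) < eta.
Proof.
move=> hx T0 xT Y0.
have hS t := flow_sphere hY t hx.
apply: (@periodic_barrier R (fun t => phi (flow Y t x))
  (fun t => dphi (flow Y t x) (Y (flow Y t x)))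
  (fun t => dot (Y (flow Y t x)) (Y (flow Y t x)))
  (fun t => 2 * qf (sphere_diff Y (flow Y t x)) (Y (flow Y t x))) T eta c0) => //.
- by move=> t; exact: (is_derive_sqr_coord 1 3 (flow_derive hY t hx)).
- by move=> t; exact: energy_derive.
- by move=> t; rewrite flowD// xT.
- by rewrite flow0// xT.
- move=> t /andP[p1 p2]; have [h1 _] := XY (hS t).
  have [h _] := dphi_near (hS t) h1; apply: le_lt_trans h; rewrite dphi_X//.
  have r := rateF (hS t) p2.
  have dr' := dr; have := ler_pM (ltW eta0) (ltW rf0) p1 r; lra.
- move=> t pc; have [_ h2] := XY (hS t).
  have yt : dot (Y (flow Y t x)) (flow Y t x) = 0 by exact: field_tangent.
  rewrite pmulr_rlt0// -oppr_gt0 -qfN.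
  apply: (qf_near (field_neq0 hY t hx Y0) (formS (hS t) pc yt) _ ds).
  by rewrite -opprD normrN ltW.
Qed.

(** The same argument with time reversed: near the sources the squared norm of
    [Y] increases. *)
Lemma close_below_psi x T : sphere3 x -> 0 < T -> flow Y T x = x -> Y x != 0 ->
  forall t, psi (flow Y t x) < eta.
Proof.
move=> hx T0 xT Y0 t0.
have hS t := flow_sphere hY t hx.
have xTN := flow_periodN hY hx xT.
suff h : forall t, psi (flow Y (- t) x) < eta by rewrite -(opprK t0).
apply: (@periodic_barrier R (fun t => psi (flow Y (- t) x))
  (fun t => - dpsi (flow Y (- t) x) (Y (flow Y (- t) x)))
  (fun t => dot (Y (flow Y (- t) x)) (Y (flow Y (- t) x)))
  (fun t => - (2 * qf (sphere_diff Y (flow Y (- t) x)) (Y (flow Y (- t) x)))) T eta c0) => //.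
- move=> t; apply: (@is_derive_reflect R _ (fun t => psi (flow Y t x))).
  exact: (is_derive_sqr_coord 0 2 (flow_derive hY (- t) hx)).
- move=> t; apply: (@is_derive_reflect R _ (fun t => dot (Y (flow Y t x)) (Y (flow Y t x)))).
  exact: energy_derive.
- by move=> t; rewrite opprD flowD// xTN.
- by rewrite oppr0 flow0// xTN.
- move=> t /andP[p1 p2]; have [h1 _] := XY (hS (- t)).
  have [_ h] := dphi_near (hS (- t)) h1; rewrite oppr_gt0; apply: (lt_le_trans h); rewrite dpsi_X//.
  have r := rateS (hS (- t)) p2.
  have dr' := dr; have := ler_pM (ltW eta0) (ltW rf0) p1 r; lra.
- move=> t pc; have [_ h2] := XY (hS (- t)).
  have yt : dot (Y (flow Y (- t) x)) (flow Y (- t) x) = 0 by exact: field_tangent.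
  rewrite oppr_lt0 pmulr_rgt0//.
  by apply: (qf_near (field_neq0 hY (- t) hx Y0) (formR (hS (- t)) pc yt) (ltW h2) ds).
Qed.

Lemma close_periodic x : periodic_point Y x -> hyperbolic g Y (Defs.orbit Y x).
Proof.
move=> px; have Y0 := periodic_field_neq0 hY px.
have [hx [T [T0 xT _]]] := px.
apply: (periodic_hyperbolic hY hg hx T0 xT Y0) => t p pc pY p0.
have hS := flow_sphere hY t hx; have [h1 h2] := XY hS.
apply: (transverse_pos hS d1 dG _ h1 h2 pY p0); apply: formG => //.
have etaG' := etaG; have := close_below_phi hx T0 xT Y0 t; have := close_below_psi hx T0 xT Y0 t; lra.
Qed.

End Close.

Theorem star_X (g : V -> 'M[R]_4) : riemannian_metric g -> star g X.
Proof.
move=> hg; split; first exact: hX.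
have cNN (N : V -> 'M[R]_4) (x : V) : {for x, continuous N} -> {for x, continuous (fun y => - N y)}.
  by move=> cN; exact: (cvgN cN).
have [kG kG0 formG] : exists2 k, 0 < k & forall x p : V, sphere3 x -> phi x + psi x < k ->
    dot p x = 0 -> k * dot p p <= qf (gamma_form x) p.
  apply: (form_near (w := fun x => phi x + psi x) continuous_gamma_form).
    by move=> x; exact: (cont_atD (continuous_phi (x := x)) (continuous_psi (x := x))).
  move=> x p hx h px.
  have p0 := sqr_ge0 (x$1 * x$3); have q0 := sqr_ge0 (x$0 * x$2).
  rewrite /phi /psi in h.
  by apply: gamma_pos => //; apply/eqP; rewrite -sqrf_eq0; apply/eqP; lra.
have [k0 k00 form0] : exists2 k, 0 < k & forall x v : V, sphere3 x -> dot (X x) (X x) < k ->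
    dot v x = 0 -> k * dot v v <= qf (zero_form x) v.
  apply: (form_near (w := fun x => dot (X x) (X x)) continuous_zero_form).
    by move=> x; apply: continuous_dot; exact: continuous_X.
  move=> x p hx h px; apply: qf_zero => //.
  by apply/eqP; rewrite -dot_eq0 eq_le h dot_ge0.
have [ks ks0 formS] : exists2 k, 0 < k & forall x v : V, sphere3 x -> 1 / 4 - phi x < k ->
    dot v x = 0 -> k * dot v v <= qf (- sphere_diff X x) v.
  apply: (form_near (N := fun x => - sphere_diff X x) (w := fun x => 1 / 4 - phi x)).
  - by move=> x x0; apply: cNN; exact: sphere_diff_cont.
  - by move=> x; apply: continuous_subf; [exact: continuous_cst_at|exact: continuous_phi].
  - move=> x p hx h px; rewrite qfN; apply: qf_sink => //.
    by have [_] := phi_max hx; apply; rewrite subr_le0 in h.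
have [kr kr0 formR] : exists2 k, 0 < k & forall x v : V, sphere3 x -> 1 / 4 - psi x < k ->
    dot v x = 0 -> k * dot v v <= qf (sphere_diff X x) v.
  apply: (form_near (N := fun x => sphere_diff X x) (w := fun x => 1 / 4 - psi x)).
  - by move=> x x0; exact: sphere_diff_cont.
  - by move=> x; apply: continuous_subf; [exact: continuous_cst_at|exact: continuous_psi].
  - move=> x p hx h px; apply: qf_source => //.
    by have [_] := psi_max hx; apply; rewrite subr_le0 in h.
have [k [k1 k2 k3 k4]] : exists k : R, [/\ 0 < k, k <= ks, k <= kr & k <= 1 / 16].
  exists (Num.min ks (Num.min kr (1 / 16))); split.
  - by rewrite !lt_min ks0 kr0 /=; lra.
  - by rewrite ge_min lexx.
  - by rewrite ge_min ge_min lexx orbT.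
  - by rewrite ge_min ge_min lexx !orbT.
pose c0 := 1 / 4 - k.
have rate1 : exists2 r, 0 < r & forall x : V, sphere3 x -> phi x <= c0 -> r <= phi_rate x.
  apply: (rate_lb continuous_phi continuous_phi_rate) => x hx hc; rewrite ltNge; apply/negP.
  move=> /(phi_rate_eq0 hx)[_ _ e1 e3].
  by move: hc; rewrite /phi exprMn e1 e3 /c0; lra.
have rate2 : exists2 r, 0 < r & forall x : V, sphere3 x -> psi x <= c0 -> r <= psi_rate x.
  apply: (rate_lb continuous_psi continuous_psi_rate) => x hx hc; rewrite ltNge; apply/negP.
  move=> /(psi_rate_eq0 hx)[_ _ e1 e3].
  by move: hc; rewrite /psi exprMn e1 e3 /c0; lra.
have [r1 r10 hr1] := rate1; have [r2 r20 hr2] := rate2.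
have [r [r0 rr1 rr2]] : exists r : R, [/\ 0 < r, r <= r1 & r <= r2].
  exists (Num.min r1 r2); split; first by rewrite lt_min r10.
  - by rewrite ge_min lexx.
  - by rewrite ge_min lexx orbT.
have [eta [eta0 etaG etac]] : exists eta : R, [/\ 0 < eta, 2 * eta <= kG & eta <= c0].
  exists (Num.min (kG / 2) (1 / 8)); split.
  - by rewrite lt_min; apply/andP; split; lra.
  - have : Num.min (kG / 2) (1 / 8) <= kG / 2 by rewrite ge_min lexx.
    by move: (Num.min _ _) => m; lra.
  - have : Num.min (kG / 2) (1 / 8) <= 1 / 8 by rewrite ge_min lexx orbT.
    by rewrite /c0; move: (Num.min _ _) => m; lra.
have [BX BX0 hB] := field_bounded hX.
have [m [m0 m1 mG mk [m2 mr]]] : exists m : R, [/\ 0 < m, m <= 1, m <= kG, m <= k & m <= k0 /\ m <= eta * r].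
  exists (Num.min 1 (Num.min kG (Num.min k (Num.min k0 (eta * r))))).
  by rewrite !lt_min !ge_min !lexx !orbT ltr01 kG0 k1 k00 mulr_gt0.
(* 200 exceeds every numerical factor in the conditions on d. *)
pose d := m / (200 * (1 + BX)).
have B1 : 0 < 200 * (1 + BX) by lra.
have d0 : 0 < d by rewrite divr_gt0.
have eB : 200 * d + 200 * (d * BX) = m.
  by rewrite /d; field; rewrite gt_eqF//; lra.
have dB0 : 0 < d * BX by rewrite mulr_gt0.
have hc : c0 = 1 / 4 - k by [].
have fS x v (hx : sphere3 x) : c0 < phi x -> dot v x = 0 -> k * dot v v <= qf (- sphere_diff X x) v.
  move=> hp vx; apply: (le_trans (ler_wpM2r (dot_ge0 v) k2)); apply: formS => //; lra.
have fR x v (hx : sphere3 x) : c0 < psi x -> dot v x = 0 -> k * dot v v <= qf (sphere_diff X x) v.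
  move=> hp vx; apply: (le_trans (ler_wpM2r (dot_ge0 v) k3)); apply: formR => //; lra.
have r1' x : sphere3 x -> phi x <= c0 -> r <= phi_rate x.
  by move=> hx /(hr1 x hx); exact: le_trans.
have r2' x : sphere3 x -> psi x <= c0 -> r <= psi_rate x.
  by move=> hx /(hr2 x hx); exact: le_trans.
have hB' x (hx : sphere3 x) : `|sphere_diff X x| <= BX := (hB x hx).2.
have [q1 [q2 q3]] : d <= 1 /\ 144 * d < kG /\ 4 * d < k0 by do !split; lra.
have [q4 [q5 q6]] : 4 * d < k /\ 2 * d < eta * r /\ 32 * (d * BX) < k0 by do !split; lra.
exists [set Y | vector_field Y /\ C1_close d X Y]; split.
  split; first by move=> Y [].
  by exists d => // Y hY XY; split.
move=> Y [hY XY]; split => x hx.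
  exact: (close_periodic hg formG fS fR r1' r2' eta0 etac etaG r0 q1 q2 q4 q5 hY XY hx).
exact: (close_singular hg form0 hB' d0 q1 q3 q6 hY XY hx).
Qed.

End Star.

(** * An obstruction to sectional hyperbolicity *)

Section NoSectional.
Variable R : realType.
Local Notation V := 'rV[R]_4.
Local Notation "x $ k" := (x (0 : 'I_1) (inord k : 'I_4)) : ring_scope.

Lemma exp_small (a l C : R) : 0 < a -> 0 < l -> 0 <= C ->
  (forall t, 0 <= t -> a <= C * expR (- (l * t))) -> False.
Proof.
move=> a0 l0 C0 h.
have t0 : 0 <= C / (a * l) by apply: divr_ge0 => //; apply: mulr_ge0; exact: ltW.
have := h _ t0; rewrite expRN -ler_pdivrMr ?invr_gt0 ?expR_gt0// invrK.
have e : l * (C / (a * l)) = C / a by field; rewrite !gt_eqF.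
rewrite e => h1; have := expR_ge1Dx (C / a) => h2.
have := le_trans (ler_wpM2l (ltW a0) h2) h1.
have -> : a * (1 + C / a) = a + C by field; rewrite gt_eqF.
lra.
Qed.

Variables (g : V -> 'M[R]_4) (hg : riemannian_metric g).

Lemma rnorm_ge_coord : exists2 m : R, 0 < m & forall z v k, sphere3 z -> dot v z = 0 ->
  m * `|v$k| <= rnorm g z v.
Proof.
have [m [M [m0 M0 h]]] := metric_bounds hg.
exists (Num.sqrt m) => [|z v k hz vz]; first by rewrite sqrtr_gt0.
rewrite -(@ler_pXn2r _ 2)// ?nnegrE ?mulr_ge0 ?sqrtr_ge0//.
rewrite exprMn sqr_sqrtr ?(ltW m0)// rnorm_sqr// real_normK ?num_real//.
have /andP[h1 _] := h z v hz vz; apply: le_trans h1.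
by rewrite ler_wpM2l ?(ltW m0)// coord_le_dot.
Qed.

Lemma rnorm_gt0 z v : sphere3 z -> dot v z = 0 -> v != 0 -> 0 < rnorm g z v.
Proof.
move=> hz vz v0; rewrite sqrtr_gt0; have [_ _] := hg; apply => //.
by rewrite tangentE vz.
Qed.

Lemma rnorm_ub (Z : V -> V) : vector_field Z ->
  exists2 C, 0 <= C & forall z, sphere3 z -> rnorm g z (Z z) <= C.
Proof.
move=> hZ; have [BZ BZ0 hB] := field_bounded hZ.
have [m [M [m0 M0 h]]] := metric_bounds hg.
exists (Num.sqrt (M * (4 * BZ ^+ 2))) => [|z hz]; first exact: sqrtr_ge0.
have zt := field_tangent hZ hz; have /andP[_ h1] := h z (Z z) hz zt.
apply: ler_wsqrtr; apply: (le_trans h1); rewrite ler_wpM2l ?(ltW M0)//.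
rewrite (le_trans (dot_le_norm _))// ler_wpM2l//.
by apply: sqr_le; [exact: normr_ge0|have [] := hB z hz].
Qed.

Lemma rarea_scale z u v (a b : R) : 0 <= a <= 1 -> 0 <= b <= 1 ->
  rarea g z (a *: u) (b *: v) <= rarea g z u v.
Proof.
move=> /andP[a0 a1] /andP[b0 b1].
have eZ (c d : R) p q : metric_form g z (c *: p) (d *: q) = c * d * metric_form g z p q.
  rewrite /metric_form linearZ/= -!scalemxAl -scalemxAr scalerA.
  by rewrite [LHS]mxE.
rewrite /rarea !eZ.
have -> : a * a * metric_form g z u u * (b * b * metric_form g z v v) - (a * b * metric_form g z u v) ^+ 2
  = (a * b) ^+ 2 * (metric_form g z u u * metric_form g z v v - metric_form g z u v ^+ 2) by ring.
rewrite sqrtrM ?sqr_ge0// ler_piMl ?sqrtr_ge0// sqrtr_sqr ger0_norm ?mulr_ge0//.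
by rewrite -[leRHS]mulr1 ler_pM.
Qed.

Lemma rarea_gt0 z u v : sphere3 z -> dot u z = 0 -> dot v z = 0 ->
  v != 0 -> (forall a, u + a *: v != 0) -> 0 < rarea g z u v.
Proof.
move=> hz uz vz v0 ind; have [_ gS gP] := hg.
have vv : 0 < metric_form g z v v by apply: gP => //; rewrite tangentE vz.
pose a := - (metric_form g z u v / metric_form g z v v).
have : 0 < metric_form g z (u + a *: v) (u + a *: v).
  by apply: gP => //; rewrite tangentE dotDl dotZl uz vz mulr0 addr0.
have sym : metric_form g z v u = metric_form g z u v.
  have e : v *m g z *m u^T = (u *m g z *m v^T)^T by rewrite !trmx_mul trmxK gS// mulmxA.
  by rewrite /metric_form e mxE.
have -> : metric_form g z (u + a *: v) (u + a *: v) = metric_form g z u u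
    + a * metric_form g z u v + a * metric_form g z v u + a ^+ 2 * metric_form g z v v.
  rewrite /metric_form linearD/= linearZ/= !mulmxDl !mulmxDr -!scalemxAl -!scalemxAr.
  by rewrite !mxE; ring.
rewrite sym sqrtr_gt0.
have -> : metric_form g z u u + a * metric_form g z u v + a * metric_form g z u v + a ^+ 2 * metric_form g z v v
  = (metric_form g z u u * metric_form g z v v - metric_form g z u v ^+ 2) / metric_form g z v v.
  by rewrite /a; field; rewrite gt_eqF.
by rewrite pmulr_lgt0// invr_gt0.
Qed.

Variables (Z : V -> V) (hZ : vector_field Z) (c : R -> V) (e : V) (r2 r3 : R -> R) (s1 l2 l3 : R).
Hypothesis flow_c : forall s t, flow Z t (c s) = c (s + t).
Hypothesis c_sphere : forall s, sphere3 (c s).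
Hypothesis c_plane : forall s, (c s)$2 = 0 /\ (c s)$3 = 0.
Hypothesis Zc : forall s, Z (c s) != 0 /\ (Z (c s))$2 = 0 /\ (Z (c s))$3 = 0.
Hypothesis rates : forall s v, dot v (c s) = 0 ->
  (v *m sphere_diff Z (c s))$2 = r2 s * v$2 /\ (v *m sphere_diff Z (c s))$3 = r3 s * v$3.
Hypothesis rates_ge0 : forall s, s1 <= s -> 0 <= r2 s /\ 0 <= r3 s.
Hypotheses (e_sphere : sphere3 e) (Ze : Z e = 0) (e_plane : e$2 = 0 /\ e$3 = 0).
Hypothesis c_to_e : forall U : set V, open U -> U e -> exists s, U (c s).
Let b2 : V := delta_mx 0 (inord 2).
Let b3 : V := delta_mx 0 (inord 3).
Hypotheses (eig2 : b2 *m sphere_diff Z e = l2 *: b2) (eig3 : b3 *m sphere_diff Z e = l3 *: b3).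
Hypotheses (l2le : l2 <= 0) (l3le : l3 <= 0).

(** The squared coordinate has derivative twice [r] times itself. *)
Lemma coord_nondecr (s : R) (v : V) (k : nat) (r : R -> R) : s1 <= s -> dot v (c s) = 0 ->
  (forall s v, dot v (c s) = 0 -> (v *m sphere_diff Z (c s))$k = r s * v$k) ->
  (forall s, s1 <= s -> 0 <= r s) ->
  forall t, 0 <= t -> `|v$k| <= `|(v *m flow_diff Z t (c s))$k|.
Proof.
move=> hs vs hr r0 t t0.
have [hv v0] := flow_diff_variation hZ (c_sphere s) vs.
have vt q : dot (v *m flow_diff Z q (c s)) (c (s + q)) = 0.
  by have := flow_diff_tangent hZ q (c_sphere s) vs; rewrite flow_c.
have hd (q : R) : is_derive q 1 (fun q => (v *m flow_diff Z q (c s))$k)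
    (r (s + q) * (v *m flow_diff Z q (c s))$k).
  by rewrite -hr//; have := hv q; rewrite flow_c => /is_derive_mx; apply.
have hd2 (q : R) := is_derive_mulf (hd q) (hd q).
have h := nondecr_derive t0 hd2.
rewrite -(@ler_pXn2r _ 2)// ?nnegrE// !real_normK ?num_real// !expr2.
rewrite -{1 2}v0; apply: h => q /andP[q0 _].
have -> : r (s + q) * (v *m flow_diff Z q (c s))$k * (v *m flow_diff Z q (c s))$k +
   (v *m flow_diff Z q (c s))$k * (r (s + q) * (v *m flow_diff Z q (c s))$k) =
   2 * (r (s + q) * (v *m flow_diff Z q (c s))$k ^+ 2).
  by move: (r _) ((v *m flow_diff Z q (c s))$k) => x y; ring.
apply: mulr_ge0 => //; apply: mulr_ge0; last exact: sqr_ge0.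
by apply: r0; lra.
Qed.

(** Tangent vectors at a point of a coordinate circle that lie in the plane of
    the circle are tangent to the circle, hence proportional. *)
Lemma planar_parallel (x v z : V) : sphere3 x -> x$2 = 0 -> x$3 = 0 ->
  dot v x = 0 -> dot z x = 0 -> v$2 = 0 -> v$3 = 0 -> z$2 = 0 -> z$3 = 0 -> z != 0 ->
  exists a, v = a *: z.
Proof.
rewrite /sphere3/= !dot4 => hx x2 x3 vx zx v2 v3 z2 z3 z0.
rewrite x2 x3 v2 v3 z2 z3 !mulr0 !addr0 -?expr2 in hx vx zx.
have [a ea0 ea1] := arc_tangential hx vx; have [b eb0 eb1] := arc_tangential hx zx.
have b0 : b != 0.
  apply: contra_neq z0 => b0; apply: vec4P; rewrite mxE ?z2 ?z3//.
    by rewrite eb0 b0 mul0r oppr0.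
  by rewrite eb1 b0 mul0r.
exists (a / b); apply: vec4P; rewrite vec4Z ?v2 ?v3 ?z2 ?z3 ?mulr0// ?ea0 ?ea1 ?eb0 ?eb1.
  by field.
by field.
Qed.

(** [c] is an orbit of [Z] in the plane of the coordinates 0 and 1, and the
    zero [e] lies in its closure. The coordinates 2 and 3 of a tangent vector
    move independently, at the rates [r2] and [r3], nonnegative at the end of
    the orbit; so a contracted vector has none of them, and is a multiple of
    [Z]. But [Z] is bounded along the past of the orbit, so it cannot be
    contracted at a uniform rate. The contracted bundle is thus 0 on [c], and
    at [e], where the complementary bundle is everything although the flow
    does not expand the area in the directions 2 and 3. *)
Lemma no_sectional (L : set V) : L e -> (forall s, L (c s)) -> ~ sectional_hyperbolic g Z L.
Proof.
move=> Le Lc [_ _ [E [F [[[[bE bF] [iE iF] sum _] [K [l [K0 l0 hc]]]] [K' [l' [K'0 l'0 hs]]]]]]].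
have Etan y : L y -> (E y <= tangent y)%MS.
  by move=> Ly; have [<- _] := sum y Ly; exact: addsmxSl.
have Edot y (v : V) : L y -> (v <= E y)%MS -> dot v y = 0.
  by move=> Ly vE; apply/eqP; rewrite -tangentE; exact: submx_trans vE (Etan y Ly).
have [m m0 hm] := rnorm_ge_coord.
have [C C0 hC] := rnorm_ub hZ.
have rn0 z v : 0 <= rnorm g z v by exact: sqrtr_ge0.
have E0 s (v : V) : s1 <= s -> (v <= E (c s))%MS -> v = 0.
  move=> hs1 vE; have vs := Edot _ _ (Lc s) vE.
  have van k (r : R -> R) : (forall s v, dot v (c s) = 0 -> (v *m sphere_diff Z (c s))$k = r s * v$k) ->
      (forall s, s1 <= s -> 0 <= r s) -> v$k = 0.
    move=> hr r0; apply/eqP; rewrite -normr_eq0; apply/negPn/negP => n0.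
    have pos : 0 < m * `|v$k| by rewrite mulr_gt0// lt_def n0 normr_ge0.
    apply: (@exp_small (m * `|v$k|) l (K * rnorm g (c s) v)) => //.
      by rewrite mulr_ge0// ltW.
    move=> t t0.
    have h1 := coord_nondecr hs1 vs hr r0 t0.
    have h2 := hc _ _ _ (Lc s) vE t0.
    have tg := flow_diff_tangent hZ t (c_sphere s) vs.
    have h3 := hm _ _ k (flow_sphere hZ t (c_sphere s)) tg.
    rewrite mulrAC; apply: le_trans h2; apply: le_trans h3.
    by rewrite ler_wpM2l// ltW.
  have v2 : v$2 = 0.
    by apply: (van 2%N r2) => [s' v' /rates[]//|s' /rates_ge0[]].
  have v3 : v$3 = 0.
    by apply: (van 3%N r3) => [s' v' /rates[]//|s' /rates_ge0[]].
  have [c2 c3] := c_plane s; have [z0 [z2 z3]] := Zc s.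
  have zt : dot (Z (c s)) (c s) = 0 by exact: field_tangent.
  have [a va] := planar_parallel (c_sphere s) c2 c3 vs zt v2 v3 z2 z3 z0.
  apply/eqP/negPn/negP => v0.
  have a0 : a != 0 by apply: contra_neq v0 => a0; rewrite va a0 scale0r.
  have zE : (Z (c s) <= E (c s))%MS.
    have -> : Z (c s) = a^-1 *: v by rewrite va scalerA mulVf// scale1r.
    exact: scalemx_sub.
  apply: (@exp_small (rnorm g (c s) (Z (c s))) l (K * C)) => //.
  - exact: rnorm_gt0.
  - by rewrite mulr_ge0// ltW.
  move=> t t0.
  (* Z at c s is the image of Z at c (s - t), which stays bounded. *)
  have zE' : (Z (c (s - t)) <= E (c (s - t)))%MS.
    have h1 := iE (c s) (- t) (Lc s); rewrite flow_c in h1.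
    have h2 := flow_diff_field hZ (- t) (c_sphere s); rewrite flow_c in h2.
    by rewrite -h2 -h1; exact: submxMr.
  have h3 := hc _ _ _ (Lc (s - t)) zE' t0.
  rewrite (flow_diff_field hZ t (c_sphere (s - t))) flow_c subrK in h3.
  apply: (le_trans h3); rewrite [leRHS]mulrAC ler_wpM2l ?hC//.
  by rewrite mulr_ge0 ?expR_ge0// ltW.
have E0' s (v : V) : (v <= E (c s))%MS -> v = 0.
  move=> vE; have vs := Edot _ _ (Lc s) vE.
  pose t := `|s1 - s|.
  have hst : s1 <= s + t by have := ler_norm (s1 - s); rewrite /t; lra.
  have h1 := iE (c s) t (Lc s); rewrite flow_c in h1.
  have w0 : v *m flow_diff Z t (c s) = 0.
    by apply: (E0 _ _ hst); rewrite -h1; exact: submxMr.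
  by have := flow_diffNK hZ t (c_sphere s) vs; rewrite w0 mul0mx.
(* The rank of a subbundle is locally constant, and c accumulates at e. *)
have Ee0 : (E e = 0).
  have [U [k [B [[oU Ue] _ hB]]]] := bE e Le.
  have [s Us] := c_to_e oU Ue.
  have [f1 e1] := hB _ (Lc s) Us; have [f2 e2] := hB _ Le Ue.
  have k0 : k = 0%N.
    have /eqP <- := f1; rewrite -e1; apply/eqP; rewrite mxrank_eq0 -submx0.
    by apply/rV_subP => v /E0' ->; exact: sub0mx.
  apply/eqP; rewrite -mxrank_eq0 e2; have /eqP -> := f2.
  by rewrite k0.
have Ft (v : V) : dot v e = 0 -> (v <= F e)%MS.
  move=> ve; have [h _] := sum e Le.
  have : (v <= (E e + F e)%MS)%MS by rewrite h tangentE ve.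
  by rewrite Ee0; move/submx_trans; apply; rewrite addsmx_sub sub0mx submx_refl.
have [e2 e3] := e_plane.
have dotb k : dot (delta_mx 0 (inord k) : V) e = e$k by rewrite /dot -rowE !mxE.
have b2e : dot b2 e = 0 by rewrite dotb.
have b3e : dot b3 e = 0 by rewrite dotb.
have fe t : flow Z t e = e by exact: flow_singular.
have Gb (b : V) (la : R) : dot b e = 0 -> b *m sphere_diff Z e = la *: b ->
    forall t, b *m flow_diff Z t e = expR (la * t) *: b.
  move=> be hb t.
  have hv : variation Z (fun t => flow Z t e) (fun t => expR (la * t) *: b).
    move=> q; rewrite fe -scalemxAl hb scalerA mulrC.
    apply/is_derive_mx => i j; rewrite mxE.
    have -> : (fun s => (expR (la * s) *: b) i j) = (fun s => expR (la * s) * b i j).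
      by apply/funext => s; rewrite mxE.
    have := is_derive_mulf (is_derive_exp la q) (is_derive_cst (b i j) q (1 : R)).
    by rewrite mulr0 addr0.
  have := flow_diff_unique hZ e_sphere _ hv t; rewrite mulr0 expR0 scale1r.
  by apply.
have pos : 0 < rarea g e b2 b3.
  apply: rarea_gt0 => //.
    by apply/eqP => /matrixP/(_ 0 (inord 3)); rewrite !mxE !eqxx => /eqP; rewrite oner_eq0.
  move=> a; apply/eqP => /matrixP/(_ 0 (inord 2)); rewrite !mxE !eqxx /= -val_eqE/= !inordK//=.
  by rewrite mulr0 addr0 => /eqP; rewrite oner_eq0.
have t0 : 0 <= K' / l' by rewrite divr_ge0 ?ltW.
have := hs e b2 b3 _ Le (Ft _ b2e) (Ft _ b3e) t0.
rewrite fe (Gb _ _ b2e eig2) (Gb _ _ b3e eig3) => h.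
have u1 (la : R) : la <= 0 -> 0 <= expR (la * (K' / l')) <= 1.
  by move=> h1; rewrite expR_ge0 -expR0 ler_expR mulr_le0_ge0.
have := le_trans h (rarea_scale e b2 b3 (u1 _ l2le) (u1 _ l3le)).
rewrite ger_pMl// mulrC ler_pdivrMr// mul1r.
have -> : l' * (K' / l') = K' by field; rewrite gt_eqF.
by rewrite leNgt; have := expR_ge1Dx K'; move: (expR K') => q; lra.
Qed.

End NoSectional.

(** * The reversed flow *)

Section Opposite.
Variable R : realType.
Local Notation V := 'rV[R]_4.
Variables (Y : V -> V) (hY : vector_field Y).

Lemma vector_fieldN : vector_field (fun x => - Y x).
Proof.
have [tY [dY cY]] := hY; split=> [x hx|]; first by rewrite eqmx_opp; exact: tY.
split=> [x x0|v x x0].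
  by have := dY x x0; exact: differentiableN.
apply: (@continuous_near_eq _ _ _ (fun y => - 'D_v (Y \o @normalize R) y)).
  by have := cY v x x0; exact: continuousN.
apply: filterS (near_neq0 x0) => y y0.
have := @deriveN _ _ _ (Y \o @normalize R) y v; apply.
by apply: diff_derivable; exact: dY.
Qed.

Lemma flow_opp t x : sphere3 x -> flow (fun x => - Y x) t x = flow Y (- t) x.
Proof.
move=> hx; apply: (flow_unique vector_fieldN (c := fun t => flow Y (- t) x)); split.
- by rewrite oppr0 flow0.
- by move=> s; exact: flow_sphere.
- by move=> s; apply: (@is_derive_reflect R _ (fun t => flow Y t x)); exact: flow_derive.
Qed.

Lemma sphere_diff_opp x (v : V) : sphere3 x ->
  v *m sphere_diff (fun x => - Y x) x = - (v *m sphere_diff Y x).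
Proof.
move=> /sphere_neq0 x0.
have d1 := field_diff hY x0; have d2 := field_diff vector_fieldN x0.
have J f : differentiable f x -> v *m 'J f x = 'D_v f x :> V.
  by move=> d; rewrite mul_rV_lin1 -deriveE.
apply: (etrans (J _ d2)); apply: (etrans (deriveN _)); first exact: diff_derivable.
by congr (- _); exact: esym (J _ d1).
Qed.

End Opposite.

(** * The Riemannian distance of nearby points *)

Section Distance.
Variable R : realType.
Local Notation V := 'rV[R]_4.
Variables (g : V -> 'M[R]_4) (hg : riemannian_metric g).

Section ShortPath.
Variables (x w : V) (hx : sphere3 x) (hy : sphere3 (x + w)).
Hypothesis wle : dot w w <= 1.
Let gam (t : R) : V := x + t *: w.

Let gam_dot t : dot (gam t) (gam t) = 1 - t * (1 - t) * dot w w.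
Proof.
have xx : dot x x = 1 by exact: hx.
have yy : dot (x + w) (x + w) = 1 by exact: hy.
have e : 2 * dot x w = - dot w w by move: yy; rewrite !dotlin xx (dotC w x); lra.
rewrite /gam !dotlin (dotC w x).
rewrite xx; have -> : dot x w = - dot w w / 2 by lra.
by field.
Qed.

Let gam_ge t : 3 / 4 <= dot (gam t) (gam t).
Proof.
rewrite gam_dot; have w0 := dot_ge0 w.
have h : 4 * (t * (1 - t)) <= 1 by have := sqr_ge0 (2 * t - 1); lra.
have [h1|h1] := leP (t * (1 - t)) 0.
  have := mulr_le0_ge0 h1 w0; lra.
have := ler_pM (ltW h1) w0 (lexx _) wle; lra.
Qed.

Let gam_neq0 t : gam t != 0.
Proof. by rewrite -dot_gt0; have := gam_ge t; lra. Qed.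

Let dpath t : V := rho (gam t) *: w - (rho (gam t) ^+ 3 * dot (gam t) w) *: gam t.

Let path_derive (t : R) : is_derive t 1 (fun s => normalize (gam s)) (dpath t).
Proof.
have h := derive_comp_jacobian (differentiable_normalize (gam_neq0 t)) (is_derive_segment x w t).
suff <- : w *m 'J (@normalize R) (gam t) = dpath t by [].
rewrite mul_rV_lin1 -deriveE; last exact: differentiable_normalize.
exact: (@derive_val _ _ _ _ _ _ _ (is_derive_normalize w (gam_neq0 t))).
Qed.

Let gam_cont : continuous gam.
Proof. by apply: is_derive_cont => t; exact: is_derive_segment. Qed.

Let dpath_cont : continuous dpath.
Proof.
move=> t; have cg : {for t, continuous gam} by exact: gam_cont.
have cr : {for t, continuous (fun s => rho (gam s))}.
  by apply: continuous_comp; [exact: cg|exact: continuous_rho].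
have cw : {for t, continuous (fun _ : R => w)} by exact: continuous_cst_at.
exact: (continuous_subv (continuous_scalef cr cw) (continuous_scalef (continuous_mulf
  (continuous_mulf cr (continuous_mulf cr cr)) (continuous_dot cg cw)) cg)).
Qed.

Let dpath_tangent t : dot (dpath t) (normalize (gam t)) = 0.
Proof.
have h := rho_sqr (gam_neq0 t).
rewrite /dpath normalizeE; move: (gam t) h => p h; rewrite !dotlin (dotC w p).
transitivity (rho p ^+ 2 * dot p w * (1 - rho p ^+ 2 * dot p p)); first by ring.
by rewrite h subrr mulr0.
Qed.

Let dpath_le t : dot (dpath t) (dpath t) <= 2 * dot w w.
Proof.
have h := rho_sqr (gam_neq0 t); have gg := gam_ge t.
have r2 : rho (gam t) ^+ 2 <= 2.
  have r0 := sqr_ge0 (rho (gam t)).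
  have := ler_wpM2l r0 gg; rewrite h; lra.
move: h r2; rewrite /dpath; move: (gam t) => p h r2.
have -> : dot (rho p *: w - (rho p ^+ 3 * dot p w) *: p) (rho p *: w - (rho p ^+ 3 * dot p w) *: p) =
  rho p ^+ 2 * dot w w - rho p ^+ 4 * dot p w ^+ 2 * (2 - rho p ^+ 2 * dot p p).
  by rewrite !dotlin (dotC w p); ring.
rewrite h; have p0 : 0 <= rho p ^+ 4 * dot p w ^+ 2.
  by apply: mulr_ge0; [exact: exprn_even_ge0|exact: sqr_ge0].
have := ler_wpM2r (dot_ge0 w) r2; lra.
Qed.

(** The normalized chord from [x] to [x + w]. For w of norm at most 1 the
    chord stays at squared distance at least 3/4 from the origin, which bounds
    the speed of its normalization. *)
Lemma short_path (M : R) : 0 < M ->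
  (forall z v, sphere3 z -> dot v z = 0 -> metric_form g z v v <= M * dot v v) ->
  rdist g x (x + w) <= Num.sqrt (2 * M * dot w w).
Proof.
move=> M0 hM.
pose c t := normalize (gam t).
have cS t : sphere3 (c t) by exact: normalize_sphere.
have c1 : derive1 c = dpath.
  by apply/funext => t; rewrite derive1E (@derive_val _ _ _ _ _ _ _ (path_derive t)).
have pc : sphere_path x (x + w) c.
  split=> //.
  - by move=> t; have [] := path_derive t.
  - by rewrite c1.
  - by rewrite /c /gam scale0r addr0 scale1r; split; exact: normalize_id.
have lb : has_lbound [set path_length g c' | c' in sphere_path x (x + w)].
  by exists 0 => _ [c' _ <-]; apply: Rintegral_ge0 => t _; exact: sqrtr_ge0.
apply: (le_trans (ge_inf lb (ex_intro2 _ _ c pc erefl))).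
rewrite /path_length c1.
pose f t := rnorm g (c t) (dpath t).
have fb t : f t <= Num.sqrt (2 * M * dot w w).
  rewrite /f; apply: ler_wsqrtr; apply: (le_trans (hM _ _ (cS t) (dpath_tangent t))).
  by have := ler_wpM2l (ltW M0) (dpath_le t); lra.
have cf : continuous f.
  move=> t; have [gC _ _] := hg.
  have cgam : {for t, continuous (fun s => g (normalize (gam s)))}.
    apply: (@continuous_comp _ _ _ gam (fun z => g (normalize z))); first exact: gam_cont.
    by have /= := gC 0%N; apply; exact: gam_neq0.
  have cd : {for t, continuous dpath} by exact: dpath_cont.
  have h := continuous_dot (continuous_mulmx cd cgam) cd.
  exact: (continuous_comp h (@sqrt_continuous R _)).
have cI : compact ([set` `[0, 1]] : set R) by exact: segment_compact.
have fI : lebesgue_measure.-integrable [set` `[0, 1]] (EFin \o f).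
  by apply: continuous_compact_integrable => //; exact: continuous_subspaceT.
have bI : lebesgue_measure.-integrable [set` `[0, 1]] (EFin \o (fun _ : R => Num.sqrt (2 * M * dot w w))).
  by apply: continuous_compact_integrable => //; apply: continuous_subspaceT => t; exact: cvg_cst.
pose b := Num.sqrt (2 * M * dot w w).
apply: (@le_trans _ _ (\int[lebesgue_measure]_(t in [set` `[0, 1]]) b)).
  apply: le_Rintegral; [exact: measurable_itv|exact: fI|exact: bI|].
  by move=> t _; exact: fb.
rewrite Rintegral_cst; last exact: measurable_itv.
rewrite (_ : fine _ = 1) ?mulr1//.
have h := lebesgue_measure_itv (`[0, 1] : interval R).
apply: (etrans (congr1 fine h)).
by rewrite /= lte_fin ltr01 oppr0 adde0.
Qed.

End ShortPath.

Lemma rdist_near (e : R) : 0 < e -> exists2 d, 0 < d &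
  forall x y, sphere3 x -> sphere3 y -> dot (y - x) (y - x) < d -> rdist g x y < e.
Proof.
move=> e0; have [m [M [m0 M0 h]]] := metric_bounds hg.
exists (Num.min 1 (e ^+ 2 / (2 * M))) => [|x y hx hy].
  by rewrite lt_min ltr01 divr_gt0 ?exprn_gt0 ?mulr_gt0.
rewrite lt_min => /andP[w1 w2].
have hy' : sphere3 (x + (y - x)) by rewrite addrC subrK.
have -> : y = x + (y - x) by rewrite addrC subrK.
apply: le_lt_trans (short_path hx hy' (ltW w1) M0 _) _.
  by move=> z v hz vz; have /andP[] := h z v hz vz.
rewrite -[ltRHS](ger0_norm (ltW e0)) -sqrtr_sqr ltr_sqrt ?exprn_gt0//.
by rewrite -ltr_pdivlMl ?mulr_gt0// mulrC.
Qed.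

End Distance.

(** * Heteroclinic connections and chain recurrence *)

Section Chain.
Variable R : realType.
Local Notation V := 'rV[R]_4.
Variables (g : V -> 'M[R]_4) (hg : riemannian_metric g).

(** Concatenation of chains. *)
Lemma chain_stable_trans (Y : V -> V) x y z :
  chain_stable g Y x y -> chain_stable g Y y z -> chain_stable g Y x z.
Proof.
move=> h1 h2 e e0; have [n [xs [ts [n1 [x0 xn] xS xj]]]] := h1 e e0.
have [m [ys [us [m1 [y0 ym] yS yj]]]] := h2 e e0.
exists (n + m)%N, (fun i => if (i < n)%N then xs i else ys (i - n)%N),
  (fun i => if (i < n)%N then ts i else us (i - n)%N); split.
- by rewrite addn_gt0 n1.
- by rewrite n1 ltnNge leq_addr /= addKn.
- move=> i hi; case: ltnP => hn; first by apply: xS; exact: ltnW.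
  by apply: yS; rewrite leq_subLR.
- move=> i hi; case: ltnP => hn.
    have := xj i hn; case: ltnP => hn1 //.
    have e1 : i.+1 = n by apply/eqP; rewrite eqn_leq hn.
    by rewrite e1 subnn y0 xn.
  rewrite ltnNge (leq_trans hn (leqnSn i)) /= subSn//.
  by apply: yj; rewrite ltn_subLR.
Qed.

Lemma exp_lt (l d : R) : 0 < l -> 0 < d -> exists2 T, 0 < T &
  forall t, T <= t -> 2 * expR (- (l * t)) < d.
Proof.
move=> l0 d0; exists (2 / d / l); first by rewrite !divr_gt0.
move=> t ht; rewrite expRN ltr_pdivrMr ?expR_gt0//.
rewrite -ltr_pdivrMl// mulrC; have := expR_ge1Dx (l * t).
have : 2 / d <= l * t by rewrite -ler_pdivrMl// mulrC.
lra.
Qed.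

Section Connection.
Variables (Y : V -> V) (hY : vector_field Y) (p q : V) (a : R) (a0 : 0 < a).
Hypotheses (hp : dot p p = 1) (hq : dot q q = 1) (pq : dot p q = 0).
Hypothesis Ypq : forall al be, Y (al *: p + be *: q) =
  (- (a * al * be ^+ 2)) *: p + (a * al ^+ 2 * be) *: q.

Definition arc_base (t : R) : V := p + expR (a * t) *: q.
(** By [Ypq], the ratio of the coordinates along [q] and [p] grows as
    [expR (a * t)] on the circle through these points, which gives the
    connecting orbit in closed form. *)
Definition arc (t : R) : V := normalize (arc_base t).

Lemma arc_base_dot t : dot (arc_base t) (arc_base t) = 1 + expR (a * t) ^+ 2.
Proof.
rewrite /arc_base; move: (expR (a * t)) => x.
by rewrite !dotlin hp hq (dotC q) pq; ring.
Qed.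

Lemma arc_base_neq0 t : arc_base t != 0.
Proof. by rewrite -dot_gt0 arc_base_dot ltr_pwDl// sqr_ge0. Qed.

Lemma arcE t : exists2 r, 0 < r /\ r ^+ 2 * (1 + expR (a * t) ^+ 2) = 1 &
  arc t = r *: p + (r * expR (a * t)) *: q.
Proof.
exists (rho (arc_base t)).
  split; first by rewrite rho_gt0// arc_base_neq0.
  by rewrite -arc_base_dot rho_sqr// arc_base_neq0.
by rewrite /arc normalizeE [X in _ *: X]/arc_base scalerDr scalerA.
Qed.

Lemma arc_sphere t : sphere3 (arc t).
Proof. exact/normalize_sphere/arc_base_neq0. Qed.

Lemma is_derive_arc (t : R) : is_derive t 1 arc (Y (arc t)).
Proof.
pose E := expR (a * t).
have hb : is_derive t 1 arc_base ((a * E) *: q).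
  apply/is_derive_mx => i j.
  have -> : (fun s => arc_base s i j) = (fun s => p i j + expR (a * s) * q i j).
    by apply/funext => s; rewrite !mxE.
  have h := is_derive_addf (is_derive_cst (p i j) t (1 : R))
    (is_derive_mulf (is_derive_exp a t) (is_derive_cst (q i j) t (1 : R))).
  by move: h; rewrite mulr0 addr0 add0r mxE.
have h := derive_comp_jacobian (differentiable_normalize (arc_base_neq0 t)) hb.
suff <- : (a * E) *: q *m 'J (@normalize R) (arc_base t) = Y (arc t) by [].
rewrite mul_rV_lin1 -deriveE; last exact/differentiable_normalize/arc_base_neq0.
rewrite (@derive_val _ _ _ _ _ _ _ (is_derive_normalize _ (arc_base_neq0 t))).
have h1 := rho_sqr (arc_base_neq0 t); rewrite arc_base_dot -/E in h1.
rewrite /arc normalizeE; move: (rho (arc_base t)) h1 => r h1.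
clear h; rewrite /arc_base -/E; move: E h1 {hb} => E h1.
rewrite (scalerDr r p) (scalerA r E q) Ypq !dotlin pq hq !(mulr0, add0r).
have -> : r *: ((a * E) *: q) - (r ^+ 3 * (E * (a * E * 1))) *: (p + E *: q) =
  (- (a * r * (r * E) ^+ 2)) *: p + (r * a * E - r ^+ 3 * a * E ^+ 3) *: q.
  apply/rowP => j; rewrite !mxE; ring.
congr (_ + _ *: q).
transitivity (r * a * E * (r ^+ 2 * (1 + E ^+ 2)) - r ^+ 3 * a * E ^+ 3); first by rewrite h1 mulr1.
by ring.
Qed.

Lemma flow_arc s t : flow Y t (arc s) = arc (s + t).
Proof.
apply: (flow_unique hY (c := fun t => arc (s + t))); split=> [|r|r].
- by rewrite addr0.
- exact: arc_sphere.
- have -> : (fun t => arc (s + t)) = (fun t => arc (t + s)) by apply/funext => u; rewrite addrC.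
  by rewrite addrC; apply: is_derive_shiftr; exact: is_derive_arc.
Qed.

Lemma arc_near_q t : dot (q - arc t) (q - arc t) <= 2 * expR (- (2 * a * t)).
Proof.
have [r [r0 h] ->] := arcE t.
have e : expR (- (2 * a * t)) = (expR (a * t) ^+ 2)^-1.
  by rewrite expRN -expRM_natl; congr (expR _)^-1; ring.
rewrite e; move: (expR (a * t)) (expR_gt0 (a * t)) h => E E0 h.
rewrite !dotlin hp hq (dotC q p) pq.
have rE : (r * E) ^+ 2 + r ^+ 2 = 1 by rewrite -h; ring.
have rE0 : 0 <= r * E by rewrite mulr_ge0// ltW.
have rE1 : r * E <= 1.
  by rewrite -(@ler_pXn2r _ 2)// ?nnegrE// expr1n -[leRHS]rE lerDl sqr_ge0.
have h2 : (r * E) ^+ 2 <= r * E by rewrite expr2 ler_piMl.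
have h3 : r ^+ 2 <= (E ^+ 2)^-1.
  rewrite -[leRHS]mul1r ler_pdivlMr ?exprn_gt0// -exprMn; have := sqr_ge0 r; lra.
have h4 : r * r = r ^+ 2 by rewrite expr2.
lra.
Qed.

Lemma arc_near_p t : dot (arc t - p) (arc t - p) <= 2 * expR (2 * a * t).
Proof.
have [r [r0 h] ->] := arcE t.
have e : expR (2 * a * t) = expR (a * t) ^+ 2.
  by rewrite -expRM_natl; congr expR; ring.
rewrite e; move: (expR (a * t)) (expR_gt0 (a * t)) h => E E0 h.
rewrite !dotlin hp hq (dotC q p) pq.
have rE : r ^+ 2 + (r * E) ^+ 2 = 1 by rewrite -h; ring.
have r1 : r <= 1.
  by rewrite -(@ler_pXn2r _ 2)// ?nnegrE ?(ltW r0)// expr1n -[leRHS]rE lerDl sqr_ge0.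
have h2 : r ^+ 2 <= r by rewrite expr2 ler_piMl// ltW.
have h3 : (r * E) ^+ 2 <= E ^+ 2.
  by rewrite exprMn ler_piMl ?sqr_ge0// expr_le1// ltW.
have h4 : r * r = r ^+ 2 by rewrite expr2.
have h5 : r * E * (r * E) = (r * E) ^+ 2 by rewrite expr2.
lra.
Qed.

(** After a long time the orbit is close to [q]; one jump suffices. *)
Lemma chain_arc_q s : chain_stable g Y (arc s) q.
Proof.
move=> e e0; have [d d0 hd] := rdist_near hg e0.
have [T T0 hT] := exp_lt (mulr_gt0 (ltr0Sn R 1) a0) d0.
pose t := 1 + `|T - s|.
have t1 : 1 <= t by rewrite lerDl.
have tT : T <= s + t by have := ler_norm (T - s); rewrite /t; lra.
exists 1%N, (fun i => if i is 0%N then arc s else q), (fun=> t); split=> //.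
- by case=> [|i] _; [exact: arc_sphere|exact: hq].
- case=> // _; split=> //; rewrite flow_arc; apply: hd => //; first exact: arc_sphere.
  exact: le_lt_trans (arc_near_q _) (hT _ tT).
Qed.

Lemma Yp : Y p = 0.
Proof.
have := Ypq 1 0; rewrite !scale1r !scale0r addr0 => ->.
by rewrite expr0n !mulr0 oppr0 !scale0r addr0.
Qed.

(** A jump from the zero [p] to a point of the orbit far in the past. *)
Lemma chain_p_arc s : chain_stable g Y p (arc s).
Proof.
move=> e e0; have [d d0 hd] := rdist_near hg e0.
have [T T0 hT] := exp_lt (mulr_gt0 (ltr0Sn R 1) a0) d0.
pose t := 1 + `|T + s|.
have t1 : 1 <= t by rewrite lerDl.
have tT : T <= t - s by have := ler_norm (T + s); rewrite /t; lra.
exists 2%N, (fun i => if i is 0%N then p else if i is 1%N then arc (s - t) else arc s),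
  (fun i => if i is 0%N then 1 else t); split=> //.
- by case=> [|[|i]] _; [exact: hp|exact: arc_sphere|exact: arc_sphere].
- case=> [|[|i]] // _; split=> //.
    rewrite flow_singular ?Yp//; apply: hd => //; first exact: arc_sphere.
    apply: le_lt_trans (arc_near_p _) _.
    by have := hT _ tT; have -> : - (2 * a * (t - s)) = 2 * a * (s - t) by ring.
  rewrite flow_arc subrK; apply: hd; [exact: arc_sphere|exact: arc_sphere|].
  by rewrite subrr dot0l.
Qed.

Lemma chain_p_q : chain_stable g Y p q.
Proof. exact: chain_stable_trans (chain_p_arc 0) (chain_arc_q 0). Qed.

Lemma near_ball (z : V) (U : set V) : open U -> U z ->
  exists2 d, 0 < d & forall y, dot (y - z) (y - z) < d -> U y.
Proof.
move=> oU Uz; have /nbhs_ballP[e /= e0 he] := open_nbhs_nbhs (conj oU Uz).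
exists (e ^+ 2); first exact: exprn_gt0.
move=> y hy; apply: he; rewrite -ball_normE /ball_/= distrC.
rewrite -(@ltr_pXn2r _ 2)// ?nnegrE ?(ltW e0)//.
exact: le_lt_trans (dot_norm _) hy.
Qed.

Lemma arc_to_p (U : set V) : open U -> U p -> exists s, U (arc s).
Proof.
move=> oU Up; have [d d0 hd] := near_ball oU Up.
have [T T0 hT] := exp_lt (mulr_gt0 (ltr0Sn R 1) a0) d0.
exists (- T); apply: hd; apply: le_lt_trans (arc_near_p _) _.
by rewrite mulrN; exact: hT.
Qed.

Lemma arc_to_q (U : set V) : open U -> U q -> exists s, U (arc s).
Proof.
move=> oU Uq; have [d d0 hd] := near_ball oU Uq.
have [T T0 hT] := exp_lt (mulr_gt0 (ltr0Sn R 1) a0) d0.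
exists T; apply: hd; rewrite -opprB dotNl dotNr opprK.
exact: le_lt_trans (arc_near_q _) (hT _ (lexx T)).
Qed.

Lemma arc_connected : connected (range arc).
Proof.
apply: connected_continuous_connected.
  by apply/connected_intervalP => x y _ _ z _.
by apply: continuous_subspaceT; apply: is_derive_cont => t; exact: is_derive_arc.
Qed.

End Connection.

Lemma connected_split (S A B : set V) : connected S -> S `<=` A `|` B -> A `&` B = set0 ->
  closed A -> closed B -> S `<=` A \/ S `<=` B.
Proof.
move=> cS SAB AB0 cA cB.
have [[x [Sx Ax]]|nA] := pselect ((S `&` A) !=set0).
  left; suff <- : S `&` A = S by move=> y [].
  apply: (cS (S `&` A)); first by exists x.
    exists (~` B); first exact: closed_openC.
    apply/seteqP; split=> y [Sy hy]; split=> //.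
      by move=> By; have : (A `&` B) y by []; rewrite AB0.
    by have [|] := SAB y Sy.
  by exists A.
by right => y Sy; have [Ay|] := SAB y Sy => //; exfalso; apply: nA; exists y.
Qed.

End Chain.

(** * The heteroclinic cycle of the example *)

Section Main.
Variable R : realType.
Local Notation V := 'rV[R]_4.
Local Notation "x $ k" := (x (0 : 'I_1) (inord k : 'I_4)) : ring_scope.
Local Notation X := (@cycle_field R).
Let hX := @vector_field_X R.

Let b0 : V := vec4 1 0 0 0.
Let b1 : V := vec4 0 1 0 0.
Let b2 : V := vec4 0 0 1 0.
Let b3 : V := vec4 0 0 0 1.

Lemma X_arc01 al be : X (al *: b0 + be *: b1) =
  (- (2 * al * be ^+ 2)) *: b0 + (2 * al ^+ 2 * be) *: b1.
Proof. by rewrite /b0 /b1 !vec4_scale !vec4_add X_vec4; congr vec4; ring. Qed.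

Lemma X_arc12 al be : X (al *: b1 + be *: b2) =
  (- (1 * al * be ^+ 2)) *: b1 + (1 * al ^+ 2 * be) *: b2.
Proof. by rewrite /b1 /b2 !vec4_scale !vec4_add X_vec4; congr vec4; ring. Qed.

Lemma X_arc23 al be : X (al *: b2 + be *: b3) =
  (- (2 * al * be ^+ 2)) *: b2 + (2 * al ^+ 2 * be) *: b3.
Proof. by rewrite /b2 /b3 !vec4_scale !vec4_add X_vec4; congr vec4; ring. Qed.

Lemma X_arc30 al be : X (al *: b3 + be *: b0) =
  (- (1 * al * be ^+ 2)) *: b3 + (1 * al ^+ 2 * be) *: b0.
Proof. by rewrite /b3 /b0 !vec4_scale !vec4_add X_vec4; congr vec4; ring. Qed.

Let c := arc b0 b1 2.

Let bb0 : dot b0 b0 = 1. Proof. by rewrite vec4_dot; ring. Qed.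
Let bb1 : dot b1 b1 = 1. Proof. by rewrite vec4_dot; ring. Qed.
Let bb2 : dot b2 b2 = 1. Proof. by rewrite vec4_dot; ring. Qed.
Let bb3 : dot b3 b3 = 1. Proof. by rewrite vec4_dot; ring. Qed.
Let b01 : dot b0 b1 = 0. Proof. by rewrite vec4_dot; ring. Qed.
Let b12 : dot b1 b2 = 0. Proof. by rewrite vec4_dot; ring. Qed.
Let b23 : dot b2 b3 = 0. Proof. by rewrite vec4_dot; ring. Qed.
Let b30 : dot b3 b0 = 0. Proof. by rewrite vec4_dot; ring. Qed.
Let two0 : 0 < 2 :> R. Proof. by []. Qed.
Let one0 : 0 < 1 :> R. Proof. by []. Qed.

(** From a point of the first arc, the four connections lead around the cycle
    back to the beginning of this arc. *)
Lemma arc_CR (g : V -> 'M[R]_4) : riemannian_metric g -> range c `<=` CR g X.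
Proof.
move=> hg _ [s _ <-].
have h : chain_stable g X (c s) (c s).
  apply: chain_stable_trans (chain_arc_q hg hX two0 bb0 bb1 b01 X_arc01 s) _.
  apply: chain_stable_trans (chain_p_q hg hX one0 bb1 bb2 b12 X_arc12) _.
  apply: chain_stable_trans (chain_p_q hg hX two0 bb2 bb3 b23 X_arc23) _.
  apply: chain_stable_trans (chain_p_q hg hX one0 bb3 bb0 b30 X_arc30) _.
  exact: (chain_p_arc hg hX two0 bb0 bb1 b01 X_arc01).
by split; [exact: arc_sphere|split].
Qed.

Lemma heteroclinic_connected : connected (range c).
Proof. exact: (arc_connected bb0 bb1 b01 X_arc01). Qed.

Lemma c_coord t : exists2 al, 0 < al & c t = vec4 al (al * expR (2 * t)) 0 0.
Proof.
have [r [r0 _] e] := arcE 2 bb0 bb1 b01 t; exists r => //.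
by rewrite /c e /b0 /b1 !vec4_scale vec4_add; congr vec4; ring.
Qed.

Lemma X_c t : X (c t) != 0 /\ (X (c t))$2 = 0 /\ (X (c t))$3 = 0.
Proof.
have [al al0 ->] := c_coord t; have E0 := expR_gt0 (2 * t).
rewrite X_vec4; split; last by rewrite !vec4E; split; ring.
apply/eqP => /(congr1 (fun x : V => x$0)); rewrite vec4E mxE => /eqP.
rewrite mulf_eq0 gt_eqF//=; apply/negP; rewrite lt_eqF//.
have : 0 < (al * expR (2 * t)) ^+ 2 by rewrite exprn_gt0// mulr_gt0.
by rewrite !mulr0 !expr0n /=; lra.
Qed.

(** In the coordinates 2 and 3 the differential is diagonal along the arc. *)
Lemma c_rates t (v : V) : dot v (c t) = 0 ->
  (v *m sphere_diff X (c t))$2 = (- 3 * (c t)$0 ^+ 2 + (c t)$1 ^+ 2) * v$2 /\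
  (v *m sphere_diff X (c t))$3 = (- (c t)$0 ^+ 2 + 3 * (c t)$1 ^+ 2) * v$3.
Proof.
move=> vc; have cS : sphere3 (c t) by exact: arc_sphere.
rewrite sphere_diff_X// vc scale0r subr0; have [al _ ->] := c_coord t.
by rewrite (vec4_eta v) dX_vec4 /drow !vec4E; split; ring.
Qed.

Lemma delta_vec4 k : (k < 4)%N -> delta_mx 0 (inord k) =
  vec4 (k == 0%N)%:R (k == 1%N)%:R (k == 2%N)%:R (k == 3%N)%:R :> V.
Proof.
by move=> hk; apply: vec4P; rewrite vec4E mxE eqxx /= -val_eqE /= !inordK// eq_sym.
Qed.

Lemma eigen_b0 : b2 *m sphere_diff X b0 = (- 3) *: b2 /\ b3 *m sphere_diff X b0 = (- 1) *: b3.
Proof.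
have h : sphere3 b0 by exact: bb0.
rewrite !sphere_diff_X// !vec4_dot !vec4_scale !vec4_opp !vec4_add !dX_vec4 /drow.
by split; congr vec4; ring.
Qed.

Lemma eigen_b1 : b2 *m sphere_diff X b1 = 1 *: b2 /\ b3 *m sphere_diff X b1 = 3 *: b3.
Proof.
have h : sphere3 b1 by exact: bb1.
rewrite !sphere_diff_X// !vec4_dot !vec4_scale !vec4_opp !vec4_add !dX_vec4 /drow.
by split; congr vec4; ring.
Qed.

Let X_b0 : X b0 = 0. Proof. by rewrite X_vec4; apply: vec4P; rewrite vec4E mxE; ring. Qed.
Let X_b1 : X b1 = 0. Proof. by rewrite X_vec4; apply: vec4P; rewrite vec4E mxE; ring. Qed.

Let exp2 (t : R) : 1 <= t -> 2 <= expR (2 * t).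
Proof. by move=> t1; apply: le_trans (expR_ge1Dx _); lra. Qed.

(** At time t the ratio of the coordinates 1 and 0 of the arc is [expR (2 t)],
    at least 2 when t >= 1; symmetrically in [rates_early]. *)
Lemma rates_late t : 1 <= t -> 0 <= - 3 * (c t)$0 ^+ 2 + (c t)$1 ^+ 2 /\
  0 <= - (c t)$0 ^+ 2 + 3 * (c t)$1 ^+ 2.
Proof.
move=> /exp2; have [al al0 ->] := c_coord t; rewrite !vec4E; move: (expR _) => E E2.
have h := sqr_ge0 al.
have h4 : 4 <= E ^+ 2 by have := ler_pM (ltW two0) (ltW two0) E2 E2; rewrite -expr2; lra.
have := ler_wpM2l h h4; rewrite exprMn; split; lra.
Qed.

Lemma rates_early t : t <= - 1 -> 0 <= - (- 3 * (c t)$0 ^+ 2 + (c t)$1 ^+ 2) /\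
  0 <= - (- (c t)$0 ^+ 2 + 3 * (c t)$1 ^+ 2).
Proof.
move=> ht; have ht' : 1 <= - t by lra.
have := exp2 ht'; rewrite mulrN expRN; have [al al0 ->] := c_coord t; rewrite !vec4E.
have := expR_gt0 (2 * t); move: (expR _) => E E0 E2.
have e1 : 2 * E <= 1 by rewrite -ler_pdivlMr// mul1r.
have h := sqr_ge0 al.
have h4 : 4 * E ^+ 2 <= 1.
  have E0' : 0 <= 2 * E by lra.
  by have := ler_pM E0' E0' e1 e1; rewrite -expr2 exprMn; lra.
have := ler_wpM2l h h4; rewrite exprMn; split; lra.
Qed.

Lemma c_plane t : (c t)$2 = 0 /\ (c t)$3 = 0.
Proof. by have [al _ ->] := c_coord t; rewrite !vec4E. Qed.

(** [no_sectional] for the arc, which leaves [e_0]. *)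
Lemma not_positive (g : V -> 'M[R]_4) (A : set V) : riemannian_metric g ->
  range c `<=` A -> ~ sectional_hyperbolic g X A.
Proof.
move=> hg cA sh; have [[_ cpA _] _ _] := sh.
have clA : closed A by apply: compact_closed => //; exact: norm_hausdorff.
have to0 := arc_to_p two0 bb0 bb1 b01.
have A0 : A b0.
  apply: contrapT => nA; have [s] := to0 _ (closed_openC clA) nA.
  by apply; apply: cA; exists s.
have [e2 e3] := eigen_b0.
apply: (@no_sectional R g hg X hX c b0 _ _ 1 (- 3) (- 1) _ _ c_plane X_c c_rates rates_late
  bb0 X_b0 _ to0 _ _ _ _ A A0 _ sh).
- by move=> s t; exact: (flow_arc hX bb0 bb1 b01 X_arc01).
- by move=> s; exact: arc_sphere.
- by rewrite !vec4E.
- by rewrite (@delta_vec4 2).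
- by rewrite (@delta_vec4 3).
- by lra.
- by lra.
- by move=> s; apply: cA; exists s.
Qed.

(** [no_sectional] for the reversed arc, which leaves [e_1] under the flow of
    [- X]. *)
Lemma not_negative (g : V -> 'M[R]_4) (B : set V) : riemannian_metric g ->
  range c `<=` B -> ~ sectional_hyperbolic g (fun x => - X x) B.
Proof.
move=> hg cB sh; have [[_ cpB _] _ _] := sh.
have clB : closed B by apply: compact_closed => //; exact: norm_hausdorff.
have to1 := arc_to_q two0 bb0 bb1 b01.
have B1 : B b1.
  apply: contrapT => nB; have [s] := to1 _ (closed_openC clB) nB.
  by apply; apply: cB; exists s.
have [e2 e3] := eigen_b1.
apply: (@no_sectional R g hg (fun x => - X x) (vector_fieldN hX) (fun t => c (- t)) b1
  (fun t => - (- 3 * (c (- t))$0 ^+ 2 + (c (- t))$1 ^+ 2))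
  (fun t => - (- (c (- t))$0 ^+ 2 + 3 * (c (- t))$1 ^+ 2)) 1 (- 1) (- 3)
  _ _ (fun t => c_plane (- t)) _ _ _ bb1 _ _ _ _ _ _ _ B B1 _ sh).
- move=> s t; rewrite flow_opp//; last exact: arc_sphere.
  by rewrite (flow_arc hX bb0 bb1 b01 X_arc01) opprD.
- by move=> s; exact: arc_sphere.
- by move=> s; have [h1 [h2 h3]] := X_c (- s); rewrite oppr_eq0 !vec4N h2 h3 oppr0.
- move=> s v vc; have [h1 h2] := c_rates vc.
  rewrite sphere_diff_opp//; last exact: arc_sphere.
  by rewrite !vec4N h1 h2 !mulNr.
- by move=> s hs; apply: rates_early; lra.
- by rewrite X_b1 oppr0.
- by rewrite !vec4E.
- by move=> U oU U1; have [s Us] := to1 U oU U1; exists (- s); rewrite opprK.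
- by rewrite (@delta_vec4 2)// sphere_diff_opp ?e2 ?scaleN1r ?scale1r//; exact: bb1.
- by rewrite (@delta_vec4 3)// sphere_diff_opp ?e3 ?scaleNr//; exact: bb1.
- by lra.
- by lra.
- by move=> s; apply: cB; exists (- s).
Qed.

End Main.

Theorem corollary2p9 (R : realType) (g : 'rV[R]_4 -> 'M[R]_4)
    (hg : riemannian_metric g) :
  exists X : 'rV[R]_4 -> 'rV[R]_4,
    star g X /\
    ~ (exists A B : set 'rV[R]_4,
         [/\ positively_sectional_hyperbolic g X A,
             negatively_sectional_hyperbolic g X B,
             A `&` B = set0
           & CR g X = A `|` B]).
Proof.
exists (@cycle_field R); split; first exact: star_X.
move=> [A [B [hA hB AB0 CRE]]].
have [[_ cA _] _ _] := hA; have [[_ cB _] _ _] := hB.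
have clA : closed A by apply: compact_closed => //; exact: norm_hausdorff.
have clB : closed B by apply: compact_closed => //; exact: norm_hausdorff.
have sub := arc_CR hg; rewrite CRE in sub.
have [cA'|cB'] := connected_split (@heteroclinic_connected R) sub AB0 clA clB.
  exact: not_positive hg cA' hA.
exact: not_negative hg cB' hB.
Qed.
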